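(* Let $b$ be a connected infinite graph over $X$ and let $q:X\to\mathbb{R}$ be a potential such that $h\ge0$ on $C_c(X)$. Let $m:X\to(0,\infty)$ be a given measure over $X$. (a) We have $$\lambda_0(H^{(m)})\ge\sup\{\lambda\in\mathbb{R}\mid (H-\lambda m)\ge0\text{ on }X\}.$$ (b) If, in addition, $D(H^{(m)})\subseteq F(X)$, then $$\lambda_0(H^{(m)})=\max\{\lambda\in\mathbb{R}\mid (H-\lambda m)\ge0\text{ on }X\}.$$ (c) Moreover, if $\frac1m L C_c(X)\subseteq\ell^2(X,m)$, then $$\lambda_0^{\mathrm{ess}}(H^{(m)})=\sup\{\lambda\in\mathbb{R}\mid (H-\lambda m)\ge0\text{ on }X\setminus K\text{ for a finite }K\subset X\}.$$ Here, for $W\subseteq X$, ''$(H-\lambda m)\ge 0$ on $W$'' means that there exists a positive $(H-\lambda m)$-superharmonic function $u$ on $W$.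
   Context: $X$ is an infinite set with the discrete topology. A graph over $X$ is a symmetric function $b:X\times X\to[0,\infty)$ with zero diagonal such that $\sum_{y\in X}b(x,y)<\infty$ for all $x\in X$; it is connected if any two vertices are joined by a finite path $x_0,\dots,x_n$ with $b(x_i,x_{i+1})>0$. $C(X)$ is the space of real valued functions on $X$ and $C_c(X)$ the subspace of finitely supported functions. Let $F(X)=\{f\in C(X)\mid \sum_{y}b(x,y)|f(y)|<\infty \text{ for all } x\in X\}$, and for $f\in F(X)$ let $Lf(x)=\sum_{y}b(x,y)(f(x)-f(y))$ and $Hf=Lf+qf$; $H-\lambda m$ is the operator $f\mapsto Hf-\lambda mf$ on $F(X)$. The form $h$ on $C_c(X)$ is $h(\varphi)=\frac12\sum_{x,y}b(x,y)(\varphi(x)-\varphi(y))^2+\sum_x q(x)\varphi(x)^2$; $h\ge0$ on $C_c(X)$ means $h(\varphi)\ge0$ for all $\varphi\in C_c(X)$. For $W\subseteq X$, a function $u$ is $(H-\lambda m)$-superharmonic on $W$ if $u\in F(X)$ and $(H-\lambda m)u\ge0$ on $W$. A function $f$ is positive in $W$ if $f\ge0$ and $f\neq0$ in $W$ (that is, $f\ge 0$ and $f$ is not identically zero; strict positivity is not required). $\ell^2(X,m)$ is the real Hilbert space with scalar product $\langle f,g\rangle_m=\sum_x f(x)g(x)m(x)$. If $h\ge0$ on $C_c(X)$, then $h$ is closable in $\ell^2(X,m)$; $h^{(m)}$ is its closure and $H^{(m)}$, with domain $D(H^{(m)})$, is the selfadjoint operator in $\ell^2(X,m)$ associated with $h^{(m)}$.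 $\lambda_0(H^{(m)})$ and $\lambda_0^{\mathrm{ess}}(H^{(m)})$ denote the bottom of the spectrum and the bottom of the essential spectrum of $H^{(m)}$.
   Formalization: In (c), u must be ≥ 0 on all of X and not identically zero on each connected component of X∖K. With mere nontriviality on X∖K, (c) fails: on X = ℤ with b = 1 between neighbours, q = 0, m = 1, K = {−1, 1}, u = 1_{0} admits λ = 2 although the essential bottom is 0. *)

(* Defs.v *)
From HB Require Import structures.
From mathcomp Require Import all_boot all_order all_algebra.
From mathcomp Require Import all_classical all_reals all_analysis.

Set Implicit Arguments.
Unset Strict Implicit.
Unset Printing Implicit Defensive.

Import Order.TTheory GRing.Theory Num.Theory.
Import numFieldNormedType.Exports.

Local Open Scope classical_set_scope.
Local Open Scope ring_scope.

(* Meaningful when f is absolutely summable. *)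
Definition rsum (R : realType) (T : choiceType) (f : T -> R) : R :=
  fine (\esum_(t in [set: T]) (Num.max (f t) 0)%:E) -
  fine (\esum_(t in [set: T]) (Num.max (- f t) 0)%:E).

(** * Graphs and Schrödinger operators *)

Definition is_graph (R : realType) (X : choiceType) (b : X -> X -> R) : Prop :=
  [/\ forall x y, b x y = b y x,
      forall x y, 0 <= b x y,
      forall x, b x x = 0 &
      forall x, (\esum_(y in [set: X]) (b x y)%:E < +oo)%E].

Definition joined_in (R : realType) (X : choiceType) (b : X -> X -> R)
    (W : set X) (x y : X) : Prop :=
  exists p : seq X,
    [/\ path (fun u v => 0 < b u v) x p, last x p = y &
        forall z, z \in x :: p -> W z].

Definition connected_graph (R : realType) (X : choiceType) (b : X -> X -> R) :
    Prop :=
  forall x y, joined_in b setT x y.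

Definition Cc (R : realType) (X : choiceType) : set (X -> R) :=
  [set f | finite_set [set x | f x != 0]].

Definition FX (R : realType) (X : choiceType) (b : X -> X -> R) :
    set (X -> R) :=
  [set f | forall x, (\esum_(y in [set: X]) (b x y * `|f y|)%:E < +oo)%E].

Definition Lap (R : realType) (X : choiceType) (b : X -> X -> R)
    (f : X -> R) (x : X) : R :=
  rsum (fun y => b x y * (f x - f y)).

Definition Hop (R : realType) (X : choiceType) (b : X -> X -> R) (q : X -> R)
    (f : X -> R) (x : X) : R :=
  Lap b f x + q x * f x.

Definition hform (R : realType) (X : choiceType) (b : X -> X -> R)
    (q : X -> R) (phi : X -> R) : R :=
  2^-1 * rsum (fun p : X * X => b p.1 p.2 * (phi p.1 - phi p.2) ^+ 2) +
  rsum (fun x => q x * phi x ^+ 2).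

Definition form_ge0 (R : realType) (X : choiceType) (b : X -> X -> R)
    (q : X -> R) : Prop :=
  forall phi : X -> R, Cc phi -> 0 <= hform b q phi.

(** * Positive superharmonic functions *)

Definition superharmonic_on (R : realType) (X : choiceType) (b : X -> X -> R)
    (q m : X -> R) (lam : R) (W : set X) (u : X -> R) : Prop :=
  FX b u /\ forall x, W x -> 0 <= Hop b q u x - lam * m x * u x.

(* Nonnegativity is required on all of X. *)
Definition positive_in (R : realType) (X : choiceType) (W : set X)
    (u : X -> R) : Prop :=
  (forall x, 0 <= u x) /\ (exists2 x, W x & u x != 0).

Definition op_ge0_on (R : realType) (X : choiceType) (b : X -> X -> R)
    (q m : X -> R) (lam : R) (W : set X) : Prop :=
  exists u : X -> R, superharmonic_on b q m lam W u /\ positive_in W u.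

(* [op_ge0_on] with the nontriviality of u on W required on every connected
   component [joined_in b W x] of W. The two notions coincide if W is connected
   and nonempty. For disconnected W the weaker requirement "u is not
   identically zero on W" does not control the essential spectrum: on the
   integers with b = 1 between neighbours, q = 0, m = 1 and K = {-1, 1}, the
   indicator u of {0} satisfies u >= 0, u(0) = 1, (H - 2 m) u = 0 on the
   complement of K, whereas the bottom of the essential spectrum is 0. *)
Definition op_ge0_on_components (R : realType) (X : choiceType)
    (b : X -> X -> R) (q m : X -> R) (lam : R) (W : set X) : Prop :=
  exists u : X -> R, superharmonic_on b q m lam W u /\
    forall x, W x -> positive_in (joined_in b W x) u.

(** * The Hilbert space l^2(X, m) and operators in it *)

(* As m > 0, the elements of l^2(X, m) are functions, not classes. *)
Definition l2 (R : realType) (X : choiceType) (m : X -> R) : set (X -> R) :=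
  [set f | (\esum_(x in [set: X]) (f x ^+ 2 * m x)%:E < +oo)%E].

Definition l2dot (R : realType) (X : choiceType) (m : X -> R)
    (f g : X -> R) : R :=
  rsum (fun x => f x * g x * m x).

Definition l2norm (R : realType) (X : choiceType) (m : X -> R)
    (f : X -> R) : R :=
  Num.sqrt (l2dot m f f).

(* A (partially defined) operator T in l^2(X, m) is given by its graph:
   T f g means that f is in the domain of T and that T maps f to g. *)

Definition op_dom (R : realType) (X : choiceType)
    (T : (X -> R) -> (X -> R) -> Prop) : set (X -> R) :=
  [set f | exists g, T f g].

Definition resolvent_set (R : realType) (X : choiceType) (m : X -> R)
    (T : (X -> R) -> (X -> R) -> Prop) : set R :=
  [set lam |
    (forall g, l2 m g -> exists! f, T f (g \+ (fun x => lam * f x))) /\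
    (exists C : R, forall f g, T f g ->
       l2norm m f <= C * l2norm m (g \- (fun x => lam * f x)))].

(* Only real points are considered: for a selfadjoint operator in a real
   Hilbert space these make up the whole spectrum of its complexification. *)
Definition spectrum (R : realType) (X : choiceType) (m : X -> R)
    (T : (X -> R) -> (X -> R) -> Prop) : set R :=
  ~` resolvent_set m T.

Definition eigenspace (R : realType) (X : choiceType)
    (T : (X -> R) -> (X -> R) -> Prop) (lam : R) : set (X -> R) :=
  [set f | T f (fun x => lam * f x)].

Definition finite_dim (R : realType) (X : choiceType) (E : set (X -> R)) :
    Prop :=
  exists (n : nat) (e : 'I_n -> X -> R), forall f, E f ->
    exists c : 'I_n -> R, forall x, f x = \sum_(i < n) c i * e i x.

Definition discrete_spectrum (R : realType) (X : choiceType) (m : X -> R)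
    (T : (X -> R) -> (X -> R) -> Prop) : set R :=
  [set lam | [/\ isolated (spectrum m T) lam,
                 (exists2 f, eigenspace T lam f & exists x, f x != 0) &
                 finite_dim (eigenspace T lam)]].

Definition ess_spectrum (R : realType) (X : choiceType) (m : X -> R)
    (T : (X -> R) -> (X -> R) -> Prop) : set R :=
  spectrum m T `\` discrete_spectrum m T.

(* The bottoms are extended reals; +oo for an empty essential spectrum. *)
Definition lambda0 (R : realType) (X : choiceType) (m : X -> R)
    (T : (X -> R) -> (X -> R) -> Prop) : \bar R :=
  ereal_inf (EFin @` spectrum m T).

Definition lambda0_ess (R : realType) (X : choiceType) (m : X -> R)
    (T : (X -> R) -> (X -> R) -> Prop) : \bar R :=
  ereal_inf (EFin @` ess_spectrum m T).

(** * The closed form h^(m) and the selfadjoint operator H^(m) *)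

Definition form_approx (R : realType) (X : choiceType) (b : X -> X -> R)
    (q m : X -> R) (f : X -> R) (phi : nat -> X -> R) : Prop :=
  [/\ forall n, Cc (phi n),
      (fun n => l2norm m (f \- phi n)) @ \oo --> (0 : R) &
      forall e : R, 0 < e -> exists N : nat, forall n k,
        (N <= n)%N -> (N <= k)%N -> hform b q (phi n \- phi k) < e].

Definition closed_form_dom (R : realType) (X : choiceType) (b : X -> X -> R)
    (q m : X -> R) : set (X -> R) :=
  [set f | l2 m f /\ exists phi, form_approx b q m f phi].

(* The limit does not depend on the approximating sequence, by closability. *)
Definition closed_form (R : realType) (X : choiceType) (b : X -> X -> R)
    (q m : X -> R) (f : X -> R) : R :=
  xget 0 [set l | exists2 phi, form_approx b q m f phi &
                  (fun n => hform b q (phi n)) @ \oo --> l].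

Definition closed_bilin (R : realType) (X : choiceType) (b : X -> X -> R)
    (q m : X -> R) (f g : X -> R) : R :=
  4^-1 * (closed_form b q m (f \+ g) - closed_form b q m (f \- g)).

Definition Hm (R : realType) (X : choiceType) (b : X -> X -> R)
    (q m : X -> R) (f g : X -> R) : Prop :=
  [/\ closed_form_dom b q m f, l2 m g &
      forall v, closed_form_dom b q m v ->
        closed_bilin b q m f v = l2dot m g v].

(* Main.v *)
(** Writing |f| for the norm of l^2(X, m), the Allegretto-Piepenbrink theorem is
    proved for functions supported in a set W: a superharmonic u > 0 on W gives
    h >= lam |.|^2 on the functions supported in W, by the ground state
    representation; conversely, if h >= lam |.|^2 there, minimising
    h phi - mu |phi|^2 - 2 <g, phi> with g > 0 yields, for mu < lam, a positive
    superharmonic function. By Harnack's inequality, "u not identically zero" on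
    the components of W implies u > 0 on W. With W = X this gives (a), and (b)
    follows since the infimum of the form is in the spectrum and since normalised
    superharmonic functions for mu_n -> lambda_0 have a limit, superharmonic by
    Fatou's lemma.

    For (c), the essential spectrum is controlled without the spectral theorem: call
    mu good if h + K sum_e <., e>^2 >= mu |.|^2 for a finite family of vectors e.
    Below a good mu the spectrum consists of finitely many eigenvalues of finite
    multiplicity, by a Birman-Schwinger determinant and a dimension count. If s, the
    supremum of the good mu, were not in the essential spectrum, the resolvent near
    s, bounded off the finite-dimensional eigenspace of s, would produce a good
    value above s. A form bound off a finite set K gives a good value by a
    perturbation supported on K; conversely the vectors e are small off a finite
    set. *)

Require Import Defs.
From HB Require Import structures.
From mathcomp Require Import all_boot all_order all_algebra.
From mathcomp Require Import finmap.
From mathcomp Require Import all_classical all_reals all_analysis.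
From mathcomp Require Import ring lra.

Set Implicit Arguments.
Unset Strict Implicit.
Unset Printing Implicit Defensive.

Import Order.TTheory GRing.Theory Num.Theory.
Import numFieldNormedType.Exports.

Local Open Scope classical_set_scope.
Local Open Scope ring_scope.

(** * Symmetric bilinear forms *)

(** Operators are treated as relations: [form_op f g] says that f is in the domain and is mapped to
    g, tested weakly on the form domain. In place of a functional calculus, one algebraic device
    gives the spectral estimates: A^2 - c^2 = (A - c) (A + c) for a symmetric operator A. If both
    factors are bounded below, expanding the square |A^2 z - c^2 z|^2, or Cauchy-Schwarz, turns this
    into a bound for A itself. That q may be negative shapes the logical order. Closability of h is
    derived from a positive superharmonic function, so this function has to exist before the closed
    form does. The minimisation producing it therefore stays among finitely supported functions and
    works with a minimising sequence and its pointwise limit. Lower bounds with a finite-rank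
    correction fit the essential spectrum because they pass from the core to the closure, and
    because a resolvent estimate allows them to be raised: testing the bound at phi - C^-1 f gains
    C^-1 at the price of finitely many further vectors. *)

Definition symbil (R : realType) (V : lmodType R) (B : V -> V -> R) : Prop :=
  (forall x y, B x y = B y x) /\
  (forall c x y z, B (c *: x + y) z = c * B x z + B y z).

Section SymmetricBilinear.
Variables (R : realType) (V : lmodType R) (B : V -> V -> R).
Hypothesis hB : symbil B.

Lemma symbilC x y : B x y = B y x. Proof. exact: hB.1. Qed.

Lemma symbilDl x y z : B (x + y) z = B x z + B y z.
Proof. by have := hB.2 1 x y z; rewrite scale1r mul1r. Qed.

Lemma symbil0l z : B 0 z = 0.
Proof. by have := symbilDl 0 0 z; rewrite addr0; lra. Qed.

Lemma symbilZl c x z : B (c *: x) z = c * B x z.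
Proof. by have := hB.2 c x 0 z; rewrite symbil0l !addr0. Qed.

Lemma symbilNl x z : B (- x) z = - B x z.
Proof. by rewrite -scaleN1r symbilZl mulN1r. Qed.

Lemma symbilDr x y z : B z (x + y) = B z x + B z y.
Proof. by rewrite !(symbilC z) symbilDl. Qed.

Lemma symbilZr c x z : B z (c *: x) = c * B z x.
Proof. by rewrite !(symbilC z) symbilZl. Qed.

Lemma symbilNr x z : B z (- x) = - B z x.
Proof. by rewrite !(symbilC z) symbilNl. Qed.

Definition symbilE :=
  (symbilDl, symbilDr, symbilNl, symbilNr, symbilZl, symbilZr).

Lemma symbil_suml (I : Type) (r : seq I) (P : pred I) (F : I -> V) z :
  B (\sum_(i <- r | P i) F i) z = \sum_(i <- r | P i) B (F i) z.
Proof.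
elim/big_rec2: _ => [|i u v _ <-]; first exact: symbil0l.
by rewrite symbilDl.
Qed.

Lemma symbil_sumr (I : Type) (r : seq I) (P : pred I) (F : I -> V) z :
  B z (\sum_(i <- r | P i) F i) = \sum_(i <- r | P i) B z (F i).
Proof. by rewrite symbilC symbil_suml; apply: eq_bigr => i _; exact: symbilC. Qed.

Hypothesis B_ge0 : forall x, 0 <= B x x.

(** [B] is only semidefinite, so [B y y = 0] is a case of its own: an affine function of t that is
    nonnegative everywhere is constant, whence [B x y = 0]. *)
Lemma symbil_CauchySchwarz x y : B x y ^+ 2 <= B x x * B y y.
Proof.
have h t : 0 <= B x x - 2 * t * B x y + t ^+ 2 * B y y.
  have := B_ge0 (x - t *: y); rewrite !symbilE (symbilC y x).
  lra.
have [y0|y0] := eqVneq (B y y) 0.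
  rewrite y0 mulr0 in h *.
  have [->|xy0] := eqVneq (B x y) 0; first by rewrite expr0n.
  have := h ((B x x + 1) / (2 * B x y)).
  rewrite [X in _ - X + _](_ : _ = B x x + 1); last by field.
  by lra.
have yp : 0 < B y y by rewrite lt_neqAle eq_sym y0 B_ge0.
have := h (B x y / B y y).
rewrite [X in _ <= X -> _](_ : _ = B x x - B x y ^+ 2 / B y y); last by field.
by rewrite subr_ge0 ler_pdivrMr.
Qed.

Lemma symbil_parallelogram x y :
  B (x + y) (x + y) + B (x - y) (x - y) = 2 * B x x + 2 * B y y.
Proof. by rewrite !symbilE; ring. Qed.

Lemma symbil_sqD_le x y : B (x + y) (x + y) <= 2 * B x x + 2 * B y y.
Proof. by rewrite -symbil_parallelogram lerDl. Qed.

Lemma symbil_sqB_le x y : B (x - y) (x - y) <= 2 * B x x + 2 * B y y.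
Proof. by rewrite -symbil_parallelogram lerDr. Qed.

Lemma symbil_AMGM x y : 2 * B x y <= B x x + B y y.
Proof. by have := B_ge0 (x - y); rewrite !symbilE (symbilC y x); lra. Qed.

End SymmetricBilinear.

Lemma symbilD (R : realType) (V : lmodType R) (A B : V -> V -> R) :
  symbil A -> symbil B -> symbil (fun x y => A x y + B x y).
Proof.
move=> hA hB; split=> [x y|c x y z].
  by rewrite (symbilC hA) (symbilC hB).
by rewrite (hA.2) (hB.2); ring.
Qed.

Lemma symbilM (R : realType) (V : lmodType R) (k : R) (B : V -> V -> R) :
  symbil B -> symbil (fun x y => k * B x y).
Proof.
move=> hB; split=> [x y|c x y z]; first by rewrite (symbilC hB).
by rewrite (hB.2); ring.
Qed.

Lemma symbil_lin (R : realType) (V W : lmodType R) (i : {linear V -> W})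
  (B : W -> W -> R) : symbil B -> symbil (fun x y => B (i x) (i y)).
Proof.
move=> hB; split=> [x y|c x y z]; first by rewrite (symbilC hB).
by rewrite linearP hB.2.
Qed.

Lemma norm_le_of_sqr (R : realDomainType) (x e : R) :
  0 <= e -> x ^+ 2 <= e ^+ 2 -> `|x| <= e.
Proof.
by move=> e0 h; rewrite -(@ler_pXn2r _ 2) ?nnegrE // real_normK// num_real.
Qed.

(** * Minimising a quadratic functional *)

Section Minimisation.
Variables (R : realType) (V : lmodType R) (Q : V -> V -> R) (l : V -> R).
Variable L : R.
Hypothesis L_ge0 : 0 <= L.
Hypothesis hQ : symbil Q.
Hypothesis Q_ge0 : forall x, 0 <= Q x x.
Hypothesis l_lin : forall c x y, l (c *: x + y) = c * l x + l y.
Hypothesis l_bnd : forall x, l x ^+ 2 <= L * Q x x.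

Definition qfun (v : V) : R := Q v v - 2 * l v.

Lemma qfunD v w : qfun (v + w) = qfun v + 2 * (Q v w - l w) + Q w w.
Proof.
rewrite /qfun !(symbilE hQ) (symbilC hQ w v).
have := l_lin 1 v w; rewrite scale1r => ->; ring.
Qed.

Lemma qfun_inf : exists2 J0, (forall v, J0 <= qfun v) &
  (forall e : R, 0 < e -> exists v, qfun v < J0 + e).
Proof.
have lb v : - L <= qfun v.
  have := l_bnd v; have := Q_ge0 v; rewrite /qfun => q0 h.
  have : (2 * l v) ^+ 2 <= (L + Q v v) ^+ 2.
    have := sqr_ge0 (L - Q v v); nra.
  have : 0 <= L + Q v v by exact: addr_ge0.
  move=> h1 h2.
  have : 2 * l v <= L + Q v v.
    by apply: (le_trans (ler_norm _)); rewrite -(@ler_pXn2r _ 2)// ?nnegrE// real_normK// num_real.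
  lra.
pose S := [set qfun v | v in [set: V]].
have Sinf : has_inf S.
  split; first by exists (qfun 0); exists 0.
  by exists (- L) => _ [v _ <-]; exact: lb.
exists (inf S) => [v|e e0].
  by apply: ge_inf; [exact: Sinf.2|exists v].
by have [_ [v _ <-] h] := inf_adherent e0 Sinf; exists v.
Qed.

(** The parallelogram law compares v and w with their midpoint, where the functional is still at
    least [J0]. Minimising sequences are thus Cauchy for [Q]. *)
Lemma qfun_cauchy J0 e v w : (forall v, J0 <= qfun v) ->
  qfun v < J0 + e -> qfun w < J0 + e -> Q (v - w) (v - w) <= 4 * e.
Proof.
move=> lb hv hw.
have hmid := lb (2^-1 *: (v + w)).
have lmid : l (2^-1 *: (v + w)) = 2^-1 * (l v + l w).
  have l0 : l 0 = 0 by have := l_lin 1 0 0; rewrite scale1r addr0; lra.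
  rewrite -[2^-1 *: _]addr0 l_lin l0 addr0.
  by have := l_lin 1 v w; rewrite scale1r mul1r => ->.
have := symbil_parallelogram hQ v w.
move: hmid hv hw; rewrite /qfun lmid (symbilZl hQ) (symbilZr hQ).
move: (Q (v + w) _) (Q (v - w) _) => s d; lra.
Qed.

End Minimisation.

(** * The operator of a closed form and its resolvent *)

Lemma invS_small (R : realType) (e : R) : 0 < e ->
  exists N : nat, forall n, (N <= n)%N -> n.+1%:R^-1 < e.
Proof.
move=> e0; exists (Num.truncn e^-1) => n hn.
rewrite invf_plt ?posrE ?ltr0Sn//.
apply: (lt_le_trans (truncnS_gt _)).
by rewrite ler_nat.
Qed.

Section FormOperator.
Variables (R : realType) (H D : lmodType R) (i : {linear D -> H}).
Variables (dot : H -> H -> R) (a : D -> D -> R).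
Hypothesis hdot : symbil dot.
Hypothesis dot_ge0 : forall x, 0 <= dot x x.
Hypothesis ha : symbil a.

Definition form_op (f : D) (g : H) : Prop := forall v, a f v = dot g (i v).

(** With A the operator of the form, [form_op f (g + mu *: i f)] reads (A - mu) f = g. Uniqueness of
    f follows from the norm bound as soon as [dot] is definite and [i] injective. *)
Definition form_res (mu : R) : Prop :=
  (forall g, exists f, form_op f (g + mu *: i f)) /\
  exists2 C : R, 0 < C & forall f g, form_op f (g + mu *: i f) ->
    dot (i f) (i f) <= C ^+ 2 * dot g g.

Definition graph_sq (f : D) : R := a f f + dot (i f) (i f).

(** For a nonnegative form this is closedness: completeness of the form domain in the form norm. *)
Definition form_complete : Prop := forall x : nat -> D,
  (forall e : R, 0 < e -> exists N : nat, forall n k, (N <= n)%N -> (N <= k)%N ->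
     graph_sq (x n - x k) < e) ->
  exists y, forall e : R, 0 < e -> exists N : nat, forall n, (N <= n)%N ->
     graph_sq (x n - y) < e.

Lemma form_opC f g f' g' : form_op f g -> form_op f' g' ->
  dot g (i f') = dot g' (i f).
Proof. by move=> h h'; rewrite -h -h' (symbilC ha). Qed.

Section Coercive.
Hypothesis complete : form_complete.
Variables (lam mu : R).
Hypothesis a_ge0 : forall v, 0 <= a v v.
Hypothesis a_ge : forall v, lam * dot (i v) (i v) <= a v v.
Hypothesis mu_lt : mu < lam.

Let Q := fun v w => a v w + (- mu) * dot (i v) (i w).

Let hQ : symbil Q.
Proof. by apply: symbilD => //; apply: symbilM; exact: symbil_lin. Qed.

Let Q_dot v : (lam - mu) * dot (i v) (i v) <= Q v v.
Proof. by rewrite /Q; have := a_ge v; lra. Qed.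

Let Q_ge0 v : 0 <= Q v v.
Proof.
apply: le_trans (Q_dot v); apply: mulr_ge0 => //; rewrite subr_ge0; exact: ltW.
Qed.

Let Q_cauchy (C : R) v : Q v v <= C -> graph_sq v <= (1 + (1 + `|mu|) / (lam - mu)) * C.
Proof.
move=> hC; have d0 : 0 < lam - mu by rewrite subr_gt0.
have hd : dot (i v) (i v) <= C / (lam - mu).
  by rewrite ler_pdivlMr// mulrC; exact: le_trans (Q_dot v) hC.
rewrite /graph_sq; have -> : a v v = Q v v + mu * dot (i v) (i v).
  by rewrite /Q; ring.
have h1 : mu * dot (i v) (i v) <= `|mu| * (C / (lam - mu)).
  apply: (@le_trans _ _ (`|mu| * dot (i v) (i v))).
    by apply: ler_wpM2r => //; exact: ler_norm.
  by apply: ler_wpM2l.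
rewrite mulrDl mul1r -mulrA [_^-1 * C]mulrC mulrDl mul1r; lra.
Qed.

(** Below a lower bound of the form, [Q] is coercive and (A - mu) f = g is the Euler equation for
    minimising [Q v v - 2 * dot g (i v)]; the minimiser exists by completeness. *)
Lemma coercive_res : form_res mu.
Proof.
have d0 : 0 < lam - mu by rewrite subr_gt0.
split; last first.
  exists ((lam - mu)^-1); first by rewrite invr_gt0.
  move=> f g h.
  have : Q f f = dot g (i f).
    by rewrite /Q (h f) (symbilDl hdot) (symbilZl hdot); ring.
  have := Q_dot f => /[swap] ->.
  have := symbil_CauchySchwarz hdot dot_ge0 g (i f).
  have := dot_ge0 (i f); have := dot_ge0 g.
  move: (dot g g) (dot (i f) _) (dot g (i f)) => G F x G0 F0 hx hF.
  have [F1|F1] := eqVneq F 0; first by rewrite F1 mulr_ge0// sqr_ge0.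
  have Fp : 0 < F by rewrite lt_neqAle eq_sym F1.
  rewrite exprVn mulrC ler_pdivlMr ?exprn_gt0//.
  have : ((lam - mu) * F) ^+ 2 <= x ^+ 2.
    have dF : 0 <= (lam - mu) * F by rewrite mulr_ge0// ltW.
    have x0 := le_trans dF hF; by rewrite !expr2 ler_pM.
  move=> h1; have : ((lam - mu) * F) ^+ 2 <= G * F by exact: le_trans h1 hx.
  by rewrite exprMn [F ^+ 2]expr2 mulrA ler_pM2r// mulrC.
move=> g.
pose l v := dot g (i v).
have l_lin c x y : l (c *: x + y) = c * l x + l y.
  by rewrite /l linearP !(symbilE hdot).
have l_bnd v : l v ^+ 2 <= dot g g / (lam - mu) * Q v v.
  apply: (le_trans (symbil_CauchySchwarz hdot dot_ge0 _ _)).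
  by rewrite -mulrA; apply: ler_wpM2l => //; rewrite ler_pdivlMl.
have [|J0 lbJ infJ] := qfun_inf _ Q_ge0 l_bnd.
  by rewrite divr_ge0// ltW.
have /choice[x hx] : forall n : nat, exists v, qfun Q l v < J0 + n.+1%:R^-1.
  by move=> n; apply: infJ; rewrite invr_gt0.
set K := 1 + (1 + `|mu|) / (lam - mu).
have K0 : 0 < K.
  have : 0 <= (1 + `|mu|) / (lam - mu) by apply: divr_ge0; [exact: addr_ge0|exact: ltW].
  by rewrite /K; lra.
have [e e0|y hy] := complete (x := x).
  have e' : 0 < e / (5 * K) by rewrite divr_gt0// mulr_gt0.
  have [N hN] := invS_small e'; exists N => n k hn hk.
  have h n' : (N <= n')%N -> qfun Q l (x n') < J0 + e / (5 * K).
    by move=> hn'; apply: (lt_trans (hx _)); rewrite ltrD2l; exact: hN.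
  have := Q_cauchy (qfun_cauchy hQ l_lin lbJ (h _ hn) (h _ hk)).
  move/le_lt_trans; apply; rewrite -/K.
  have -> : K * (4 * (e / (5 * K))) = 4 / 5 * e by field; rewrite gt_eqF.
  lra.
exists y => v.
suff : Q y v = l v.
  by rewrite /Q /l (symbilDl hdot) (symbilZl hdot); lra.
(* The minimality of y is only known through the sequence x, hence the slack. *)
have key (t e : R) : 0 < e -> 0 <= 2 * t * (Q y v - l v) + t ^+ 2 * Q v v + e * (1 + 2 * `|t|).
  move=> e0.
  have [N hN] := invS_small e0.
  have Qv1 : 0 < Q v v + 1 by rewrite ltr_pwDr.
  (* [Q] is at most 1 + |mu| times the squared form norm, so this tolerance makes Cauchy-Schwarz
     give |Q (x n - y) v| <= e. Adding 1 to [Q v v] guards the division. *)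
  have e1 : 0 < e ^+ 2 / ((Q v v + 1) * (1 + `|mu|)) .
    by rewrite divr_gt0// ?exprn_gt0// mulr_gt0// ltr_pwDl.
  have [M hM] := hy _ e1.
  pose n := maxn N M.
  have h1 := hN n (leq_maxl _ _); have h2 := hM n (leq_maxr _ _).
  have h3 := lbJ (x n + t *: v); have h4 := hx n.
  have h5 : `|Q (x n - y) v| <= e.
    apply: norm_le_of_sqr; first exact: ltW.
    apply: (le_trans (symbil_CauchySchwarz hQ Q_ge0 _ _)).
    have : Q (x n - y) (x n - y) <= (1 + `|mu|) * graph_sq (x n - y).
      rewrite /Q /graph_sq; have := dot_ge0 (i (x n - y)).
      have := a_ge0 (x n - y); move: (a _ _) (dot _ _) => A B A0 B0.
      have : - mu * B <= `|mu| * B by apply: ler_wpM2r => //; rewrite -normrN ler_norm.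
      have : 0 <= `|mu| * A by rewrite mulr_ge0.
      rewrite mulrDl mul1r mulrDr; lra.
    move=> h6; apply: (@le_trans _ _ ((1 + `|mu|) * (e ^+ 2 / ((Q v v + 1) * (1 + `|mu|))) * (Q v v + 1))).
      apply: ler_pM => //; last by rewrite lerDl.
      apply: (le_trans h6); apply: ler_wpM2l; first by rewrite addr_ge0.
      exact: ltW.
    rewrite le_eqVlt; apply/orP; left; apply/eqP; field.
    by rewrite !gt_eqF// ltr_pwDl.
  move: h3 h4; rewrite qfunD//.
  have -> : l (t *: v) = t * l v by rewrite /l linearZ (symbilZr hdot).
  rewrite !(symbilZr hQ) !(symbilZl hQ).
  have -> : Q (x n) v = Q y v + Q (x n - y) v by rewrite !(symbilE hQ); ring.
  have h7 : t * Q (x n - y) v <= `|t| * e.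
    apply: (le_trans (ler_norm _)); rewrite normrM; exact: ler_wpM2l.
  move: h1 h7; move: (n.+1%:R^-1) (Q y v) (Q (x n - y) v) (qfun Q l (x n)) (l v) (Q v v) `|t|.
  by move=> d A B C E F T h1 h7 h8 h9; lra.
have key0 (t : R) : 0 <= 2 * t * (Q y v - l v) + t ^+ 2 * Q v v.
  apply/ler_addgt0Pr => e e0.
  have t0 : 0 < 1 + 2 * `|t| by rewrite ltr_pwDl// mulr_ge0.
  have := key t (e / (1 + 2 * `|t|)) (divr_gt0 e0 t0).
  by rewrite divfK// gt_eqF.
apply/eqP; rewrite -subr_eq0; apply/eqP.
move: (Q y v - l v) key0 (Q_ge0 v) => d key0 q0.
(* Nearly the minimiser -d / Q v v of the quadratic polynomial in [key0], shifted by 1 to allow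
   [Q v v = 0]; its value there is a negative multiple of d^2. *)
have := key0 (- d / (Q v v + 1)).
have q1 : 0 < Q v v + 1 by rewrite ltr_pwDr.
set q := Q v v in q0 q1 *.
have -> : 2 * (- d / (q + 1)) * d + (- d / (q + 1)) ^+ 2 * q = - (d ^+ 2 * ((q + 2) / (q + 1) ^+ 2)).
  by field; rewrite gt_eqF.
rewrite oppr_ge0 pmulr_lle0; last by rewrite divr_gt0// ?exprn_gt0// ltr_wpDl.
by move=> hd; apply/eqP; rewrite -sqrf_eq0 eq_le hd sqr_ge0.
Qed.

End Coercive.


(* The resolvent of a selfadjoint operator has norm 1 / (distance to the
   spectrum): if rho, the square of the best constant, were below delta^2, then
   mu - sqrt rho and mu + sqrt rho would lie in the resolvent set. *)
Lemma form_res_ball (mu delta : R) : 0 < delta ->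
  (forall t, `|t| < delta -> form_res (mu + t)) ->
  forall f g, form_op f (g + mu *: i f) ->
    delta ^+ 2 * dot (i f) (i f) <= dot g g.
Proof.
move=> delta0 hres.
pose Z := [set x : R | forall f g, form_op f (g + mu *: i f) ->
  x * dot (i f) (i f) <= dot g g].
suff : Z (delta ^+ 2) by [].
apply: contrapT => nZ.
have Zle x : Z x -> x <= delta ^+ 2.
  move=> Zx; rewrite leNgt; apply/negP => lt; apply: nZ => f g h.
  by apply: le_trans (Zx f g h); apply: ler_wpM2r => //; exact: ltW.
have Z0 : Z 0 by move=> f g _; rewrite mul0r.
have supZ : has_sup Z by split; [exists 0|exists (delta ^+ 2)].
set rho := sup Z.
have rho0 : 0 <= rho by apply: ub_le_sup => //; exact: supZ.2.
have Zrho : Z rho.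
  move=> f g h; apply/ler_addgt0Pr => e e0.
  have e1 : 0 < e / (dot (i f) (i f) + 1) by rewrite divr_gt0// ltr_pwDr.
  have [x Zx hx] := sup_adherent e1 supZ.
  have := Zx f g h; have : e / (dot (i f) (i f) + 1) * dot (i f) (i f) <= e.
    rewrite mulrAC ler_pdivrMr ?ltr_pwDr//; apply: ler_wpM2l; first exact: ltW.
    by rewrite lerDl.
  have := dot_ge0 (i f); rewrite -/rho in hx; nra.
have rho_lt : rho < delta ^+ 2.
  rewrite lt_neqAle (ge_sup _ Zle) ?andbT; last by exists 0.
  by apply/eqP => rE; apply: nZ; rewrite -rE.
pose c := Num.sqrt rho.
have c0 : 0 <= c by exact: sqrtr_ge0.
have c2 : c ^+ 2 = rho by exact: sqr_sqrtr.
have cd : c < delta.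
  by rewrite ltNge; apply/negP => h; move: rho_lt; rewrite -c2 ltNge !expr2 ler_pM// ltW.
have [_ [C1 C10 h1]] : form_res (mu + c) by apply: hres; rewrite ger0_norm.
have [_ [C2 C20 h2]] : form_res (mu - c) by apply: hres; rewrite normrN ger0_norm.
pose K := (C1 ^+ 2 * C2 ^+ 2).
have K0 : 0 < K by rewrite mulr_gt0// exprn_gt0.
have [hG _] : form_res mu by rewrite -[mu]addr0; apply: hres; rewrite normr0.
(* Small enough for [K * (rho + 1) * e < 1]; then [rho + e] is still admissible, against the choice
   of [rho] as a supremum. *)
pose e := (1 + K * (rho + 1))^-1 / 2.
have k1 : 0 < 1 + K * (rho + 1) by rewrite ltr_pwDl// mulr_ge0// ?addr_ge0// ltW.
have e0 : 0 < e by rewrite divr_gt0// invr_gt0.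
have e1 : e <= 1.
  rewrite ler_pdivrMr// mul1r; apply: (@le_trans _ _ 1); last by rewrite ler1n.
  by rewrite invf_le1// lerDl mulr_ge0// ?addr_ge0// ltW.
have eK : K * (rho + 1) * e < 1.
  have : (1 + K * (rho + 1)) * e = 1 / 2 by rewrite /e; field; rewrite gt_eqF.
  rewrite mulrDl mul1r; lra.
suff : Z (rho + e).
  move=> Ze; have : rho + e <= rho by apply: ub_le_sup => //; exact: supZ.2.
  by rewrite gerDl leNgt e0.
(* With A = form_op - mu, both A - c and A + c are bounded below, hence so is
   A^2 - c^2, which maps w to v - c^2 w. *)
move=> f v hf.
have [w hw] := hG (i f).
pose w1 := c *: w + f.
have iw1 : i w1 = c *: i w + i f by rewrite linearP.
have hw1 : form_op w (i w1 + (mu - c) *: i w).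
  by move=> z; rewrite hw iw1 !(symbilE hdot); ring.
have hy : form_op w1 ((v - rho *: i w) + (mu + c) *: i w1).
  by move=> z; rewrite ha.2 hw hf iw1 !(symbilE hdot) -c2; ring.
have := h2 _ _ hw1; have := h1 _ _ hy; have := Zrho _ _ hw.
have : dot v (i w) = dot (i f) (i f).
  by have := form_opC hw hf; rewrite !(symbilE hdot) (symbilC hdot (i w)); lra.
have := symbil_CauchySchwarz hdot dot_ge0 v (i w).
rewrite !(symbilE hdot) (symbilC hdot (i w) v) => + vw; rewrite vw.
have := dot_ge0 (i f); have := dot_ge0 v; have := dot_ge0 (i w); have := dot_ge0 (i w1).
move: (dot (i f) (i f)) (dot v v) (dot (i w) (i w)) (dot (i w1) (i w1)).
move=> F G W W1 W10 W0 G0 F0 hcs hrho hW1 hW.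
(* Here F, G, W are the squared norms of f, v = (A - mu) f and w = (A - mu)^-1 f, so that <v, w> = F
   and F^2 <= G W. With W <= K (G - rho F), the assumption G < (rho + e) F yields F^2 <= K (rho + 1)
   e F^2 < F^2. *)
rewrite leNgt; apply/negP => hlt.
have hK : W <= K * (G - rho * F).
  have -> : K * (G - rho * F) = C2 ^+ 2 * (C1 ^+ 2 * (G - rho * F)) by rewrite /K; ring.
  apply: (le_trans hW); rewrite ler_pM2l ?exprn_gt0//.
  apply: (le_trans hW1); rewrite ler_pM2l ?exprn_gt0//.
  have : rho * (rho * W) <= rho * F by apply: ler_wpM2l.
  lra.
have Fp : 0 < F.
  rewrite lt_neqAle F0 andbT eq_sym; apply/eqP => F1; move: hlt; rewrite F1 mulr0.
  by rewrite ltNge G0.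
have h3 : F ^+ 2 <= K * ((rho + 1) * F * (e * F)).
  apply: (le_trans hcs); apply: (@le_trans _ _ (G * (K * (G - rho * F)))).
    exact: ler_wpM2l.
  rewrite mulrCA ler_pM2l//; apply: ler_pM => //.
  - have : 0 <= K * (G - rho * F) by exact: le_trans W0 hK.
    by rewrite pmulr_rge0.
  - apply: ltW; apply: (lt_le_trans hlt); apply: ler_wpM2r => //; lra.
  - lra.
have : K * (rho + 1) * e * F ^+ 2 < 1 * F ^+ 2 by rewrite ltr_pM2r// exprn_gt0.
by move: h3; lra.
Qed.

End FormOperator.

(** * Orthonormal families and finite-rank lower bounds *)

Lemma symbil_sqD_weighted (R : realType) (V : lmodType R) (B : V -> V -> R)
    (k : R) x y :
  symbil B -> (forall v, 0 <= B v v) -> 0 < k ->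
  B (x + y) (x + y) <= (1 + k) * B x x + (1 + k^-1) * B y y.
Proof.
move=> hB B0 k0; have := B0 (k *: x - y).
rewrite !(symbilE hB) (symbilC hB y x) => h.
have : 0 <= k^-1 * (k * (k * B x x) - k * B x y - (k * B x y - B y y)).
  by apply: mulr_ge0; [rewrite invr_ge0 ltW|lra].
have -> : k^-1 * (k * (k * B x x) - k * B x y - (k * B x y - B y y)) =
  k * B x x - 2 * B x y + k^-1 * B y y by field; rewrite gt_eqF.
lra.
Qed.

Section Orthonormal.
Variables (R : realType) (H : lmodType R) (dot : H -> H -> R).
Hypothesis hdot : symbil dot.
Hypothesis dot_ge0 : forall x, 0 <= dot x x.

Definition orthonormal (fs : seq H) : Prop :=
  uniq fs /\ {in fs &, forall f g, dot f g = (f == g)%:R}.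

Definition proj (fs : seq H) (v : H) : H := \sum_(f <- fs) dot v f *: f.

Lemma dot_proj fs v w : dot (proj fs v) w = \sum_(f <- fs) dot v f * dot f w.
Proof.
by rewrite (symbil_suml hdot); apply: eq_bigr => f _; rewrite (symbilZl hdot).
Qed.

Lemma dot_proj_mem fs v f : orthonormal fs -> f \in fs ->
  dot (proj fs v) f = dot v f.
Proof.
move=> [fsu fso] ffs; rewrite dot_proj (bigD1_seq f)//= (fso f f)// eqxx mulr1 big1_seq ?addr0//.
by move=> g /andP[gf gfs]; rewrite (fso g f)// (negbTE gf) mulr0.
Qed.

Lemma dot_projC_mem fs v f : orthonormal fs -> f \in fs ->
  dot (v - proj fs v) f = 0.
Proof. by move=> ho ffs; rewrite !(symbilE hdot) dot_proj_mem// subrr. Qed.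

Lemma dot_projC fs v w : orthonormal fs ->
  (forall f, f \in fs -> dot w f = 0) -> dot (v - proj fs v) w = dot v w.
Proof.
move=> ho hw; rewrite !(symbilE hdot) dot_proj big1_seq ?subr0// => f /andP[_ ffs].
by rewrite (symbilC hdot f) hw// mulr0.
Qed.

Lemma dot_projCl fs v : orthonormal fs ->
  dot (v - proj fs v) v = dot v v - \sum_(f <- fs) dot v f ^+ 2.
Proof.
move=> ho; rewrite !(symbilE hdot) dot_proj; congr (_ - _).
by apply: eq_bigr => f _; rewrite (symbilC hdot f) expr2.
Qed.

Lemma dot_projCC fs v : orthonormal fs ->
  dot (v - proj fs v) (v - proj fs v) = dot v v - \sum_(f <- fs) dot v f ^+ 2.
Proof.
move=> ho; rewrite -dot_projCl// [LHS]dot_projC// 1?(symbilC hdot)// => f ffs.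
exact: dot_projC_mem.
Qed.

(** Stability of [E] under scaling suffices: a vector of [E] orthogonal to a longest list needs only
    to be normalised to extend it, without Gram-Schmidt. *)
Lemma orthonormal_max (E : set H) (n : nat) :
  (forall c u, E u -> E (c *: u)) ->
  (forall fs, orthonormal fs -> (forall f, f \in fs -> E f) -> (size fs <= n)%N) ->
  exists fs, [/\ orthonormal fs, forall f, f \in fs -> E f &
    forall u, E u -> (forall f, f \in fs -> dot u f = 0) -> dot u u = 0].
Proof.
move=> EZ hn.
pose P k := `[< exists fs, [/\ orthonormal fs, forall f, f \in fs -> E f & size fs = k] >].
have exP : exists k, P k by exists 0%N; apply/asboolP; exists [::].
have bP k : P k -> (k <= n)%N by move=> /asboolP[fs [ho hE <-]]; exact: hn.
case: (ex_maxnP exP bP) => k /asboolP[fs [[fsu fso] hE hk]] kmax.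
exists fs; split=> // u Eu hu; apply/eqP; apply: contrapT => /negP u0.
have up : 0 < dot u u by rewrite lt_neqAle eq_sym u0 dot_ge0.
pose w := (Num.sqrt (dot u u))^-1 *: u.
have ww : dot w w = 1.
  rewrite /w !(symbilE hdot) mulrA -expr2 exprVn sqr_sqrtr// mulVf//.
have wf f : f \in fs -> dot w f = 0.
  by move=> ffs; rewrite /w (symbilZl hdot) (hu f)// mulr0.
have wfs : w \notin fs.
  by apply/negP => wfs; have := wf _ wfs; rewrite ww; apply/eqP; rewrite oner_eq0.
have : (size (w :: fs) <= k)%N.
  apply: kmax; apply/asboolP; exists (w :: fs); split=> //; last first.
    by move=> f; rewrite in_cons => /orP[/eqP->|/hE//]; exact: EZ.
  split; first by rewrite /= wfs.
  move=> f g; rewrite !in_cons => /orP[/eqP->|ffs] /orP[/eqP->|gfs].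
  - by rewrite ww eqxx.
  - by rewrite wf//; case: eqP => // wg; rewrite wg gfs in wfs.
  - by rewrite (symbilC hdot) wf//; case: eqP => // wg; rewrite -wg ffs in wfs.
  - exact: fso.
by rewrite /= hk ltnn.
Qed.

End Orthonormal.

Section SpectralGap.
Variables (R : realType) (H D : lmodType R) (i : {linear D -> H}).
Variables (dot : H -> H -> R) (a : D -> D -> R).
Hypothesis hdot : symbil dot.
Hypothesis dot_ge0 : forall x, 0 <= dot x x.
Hypothesis ha : symbil a.

Local Notation form_op := (form_op i dot a).
Local Notation form_res := (form_res i dot a).
Local Notation N := (fun f : D => dot (i f) (i f)).

Definition form_ker (s : R) : set H :=
  [set h | exists2 f, i f = h & form_op f (s *: h)].

(* The supremum of these mu is the bottom of the essential spectrum. *)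
Definition form_good (mu : R) : Prop :=
  exists2 K : R, 0 <= K & exists es : seq H, forall f,
    mu * N f <= a f f + K * \sum_(e <- es) dot (i f) e ^+ 2.

(* The lower bound is applied to phi - C^-1 f, where f solves (H - mu) f = phi'
   for the component phi' of phi orthogonal to fs. *)
Lemma form_good_step (mu C eta K : R) (fs es : seq H) :
  orthonormal dot fs -> 0 < C -> 0 <= eta -> 0 <= K -> form_res mu ->
  (forall f g, form_op f (g + mu *: i f) -> (forall e, e \in fs -> dot g e = 0) ->
    N f <= C ^+ 2 * dot g g) ->
  (forall f, (mu - eta) * N f <= a f f + K * \sum_(e <- es) dot (i f) e ^+ 2) ->
  exists2 K' : R, 0 <= K' & exists2 es' : seq H,
    (es = [::] -> fs = [::] -> es' = [::]) &
    forall f, (mu + C^-1 - 4 * eta) * N f <=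
      a f f + K' * \sum_(e <- es') dot (i f) e ^+ 2.
Proof.
move=> ho C0 eta0 K0 [hG _] hC hgood.
have [G hGe] := choice hG.
(* The solution f for phi' depends on phi, but a lower bound needs fixed vectors. As the resolvent
   is symmetric, <f, e> = <phi', (A - mu)^-1 e>, and moving the projection to the other side gives
   <phi, g' e>. *)
pose g' e := i (G e) - proj dot fs (i (G e)).
pose t := C^-1; have t0 : 0 < t by rewrite invr_gt0.
have tC : t * C = 1 by rewrite mulVf// gt_eqF.
(* The summands are the coefficients arising for the three families: K + K t for [es], 2 t for [fs],
   and K t + K t^2 for the vectors [g' e]. *)
exists (K + K * t + 2 * t + (K * t + K * t ^+ 2)).
  by rewrite !addr_ge0// ?mulr_ge0// ?exprn_ge0// ltW.
exists (es ++ fs ++ [seq g' e | e <- es]) => [-> ->//|phi].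
set v := i phi.
have [phi' phi'E] : exists p, p = v - proj dot fs v by exists (v - proj dot fs v).
have [f hf] := hG phi'.
rewrite !big_cat/= big_map.
have phiL e : e \in fs -> dot phi' e = 0 by move=> efs; rewrite phi'E; exact: dot_projC_mem.
have S2E : \sum_(e <- es) dot v (g' e) ^+ 2 = \sum_(e <- es) dot (i f) e ^+ 2.
  apply: eq_bigr => e _; congr (_ ^+ 2).
  rewrite (symbilC hdot) /g' !(symbilE hdot) (dot_proj hdot).
  have := form_opC ha hf (hGe e); rewrite !(symbilE hdot) (symbilC hdot (i (G e)) (i f)).
  move=> h; have {h} : dot phi' (i (G e)) = dot e (i f) by lra.
  rewrite (symbilC hdot e) => <-.
  rewrite phi'E !(symbilE hdot) (dot_proj hdot) (symbilC hdot v); congr (_ - _).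
  by apply: eq_bigr => h _; rewrite (symbilC hdot h v) (symbilC hdot h (i (G e))) mulrC.
rewrite S2E.
(* The terms in mu other than mu |phi|^2 cancel. Up to the sum over [fs], the cross term gains 2 t
   |phi|^2, while t^2 <phi', f> costs at most t |phi|^2; and |phi - t f| <= 2 |phi| is the source of
   4 eta. *)
have := hgood (phi - t *: f).
have -> : \sum_(e <- es) dot (i (phi - t *: f)) e ^+ 2 =
    \sum_(e <- es) dot v e ^+ 2 - 2 * t * \sum_(e <- es) dot v e * dot (i f) e +
    t ^+ 2 * \sum_(e <- es) dot (i f) e ^+ 2.
  rewrite !mulr_sumr -sumrB -big_split/=; apply: eq_bigr => e _.
  by rewrite linearB linearZ !(symbilE hdot) -/v; ring.
have hS12 : - (\sum_(e <- es) dot v e ^+ 2 + \sum_(e <- es) dot (i f) e ^+ 2) <=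
    2 * \sum_(e <- es) dot v e * dot (i f) e.
  rewrite -subr_ge0 opprK mulr_sumr -!big_split/=; apply: sumr_ge0 => e _.
  by have := sqr_ge0 (dot v e + dot (i f) e); lra.
have hN : dot phi' phi' <= dot v v.
  rewrite phi'E dot_projCC// gerBl; apply: sumr_ge0 => e _; exact: sqr_ge0.
have hNf : N f <= C ^+ 2 * dot v v.
  by apply: (le_trans (hC _ _ hf phiL)); rewrite ler_pM2l ?exprn_gt0.
have hx : `|dot (i f) v| <= C * dot v v.
  apply: norm_le_of_sqr; first by rewrite mulr_ge0// ltW.
  apply: (le_trans (symbil_CauchySchwarz hdot dot_ge0 _ _)).
  apply: (le_trans (ler_wpM2r (dot_ge0 v) hNf)).
  by rewrite le_eqVlt; apply/orP; left; apply/eqP; ring.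
have hw : `|dot phi' (i f)| <= C * dot v v.
  apply: norm_le_of_sqr; first by rewrite mulr_ge0// ltW.
  apply: (le_trans (symbil_CauchySchwarz hdot dot_ge0 _ _)).
  apply: (@le_trans _ _ (dot v v * (C ^+ 2 * dot v v))).
    by apply: ler_pM.
  by rewrite le_eqVlt; apply/orP; left; apply/eqP; ring.
have phiphi : dot phi' v = dot v v - \sum_(e <- fs) dot v e ^+ 2 by rewrite phi'E dot_projCl.
have afp : a f phi = dot phi' v + mu * dot (i f) v.
  by rewrite hf !(symbilE hdot).
have aff : a f f = dot phi' (i f) + mu * N f by rewrite hf !(symbilE hdot).
rewrite linearB linearZ/= !(symbilE hdot) !(symbilE ha) (symbilC ha phi f) afp aff -/v.
rewrite (symbilC hdot v (i f)) phiphi.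
have sq_ge0 (r : seq H) w : 0 <= \sum_(e <- r) dot w e ^+ 2.
  by apply: sumr_ge0 => e _; exact: sqr_ge0.
have tx : - dot v v <= t * dot (i f) v.
  have : t * `|dot (i f) v| <= t * (C * dot v v) by rewrite ler_pM2l.
  rewrite mulrA tC mul1r => h; have := ler_norm (- dot (i f) v); rewrite normrN => h1.
  have : t * (- dot (i f) v) <= t * `|dot (i f) v| by rewrite ler_pM2l.
  lra.
have tw : t ^+ 2 * dot phi' (i f) <= t * dot v v.
  have : t * dot phi' (i f) <= t * (C * dot v v).
    by rewrite ler_pM2l//; apply: le_trans hw; exact: ler_norm.
  by rewrite mulrA tC mul1r expr2 -mulrA ler_pM2l.
have tf : t ^+ 2 * N f <= dot v v.
  have : t ^+ 2 * N f <= t ^+ 2 * (C ^+ 2 * dot v v) by rewrite ler_pM2l// exprn_gt0.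
  by rewrite mulrA -exprMn tC expr1n mul1r.
have etx : eta * (- dot v v) <= eta * (t * dot (i f) v) by apply: ler_wpM2l.
have etf : eta * (t ^+ 2 * N f) <= eta * dot v v by apply: ler_wpM2l.
have Kt : 0 <= K * t by rewrite mulr_ge0// ltW.
have Kt2 : 0 <= K * t ^+ 2 by rewrite mulr_ge0// exprn_ge0// ltW.
have hS := ler_wpM2l Kt hS12.
move: hS (sq_ge0 es v) (sq_ge0 es (i f)) (sq_ge0 fs v).
move: (\sum_(e <- es) dot v e ^+ 2) (\sum_(e <- es) dot (i f) e ^+ 2).
move: (\sum_(e <- fs) dot v e ^+ 2) (\sum_(e <- es) dot v e * dot (i f) e).
rewrite -/t => p S12 S1 S2 hS S10 S20 p0 hmain.
have e1 : 0 <= (K * t + K * t ^+ 2 + 2 * t) * S1 by rewrite mulr_ge0//; lra.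
have e2 : 0 <= (K + K * t + 2 * t) * S2 by rewrite mulr_ge0//; lra.
have e3 : 0 <= (K + K * t + (K * t + K * t ^+ 2)) * p by rewrite mulr_ge0//; lra.
move: (dot v v) (dot (i f) v) (dot phi' (i f)) (N f) (a phi phi) tx tw tf etx etf hmain.
move=> n x w F A *; lra.
Qed.

End SpectralGap.

(** * Isolated points of the spectrum *)

Section IsolatedPoint.
Variables (R : realType) (H D : lmodType R) (i : {linear D -> H}).
Variables (dot : H -> H -> R) (a : D -> D -> R).
Hypothesis hdot : symbil dot.
Hypothesis dot_ge0 : forall x, 0 <= dot x x.
Hypothesis ha : symbil a.
Hypothesis a_ge0 : forall v, 0 <= a v v.
Hypothesis complete : form_complete i dot a.

Local Notation form_op := (form_op i dot a).
Local Notation form_res := (form_res i dot a).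
Local Notation form_ker := (form_ker i dot a).
Local Notation N := (fun f : D => dot (i f) (i f)).

Section Gap.
Variables (s eps : R).
Hypothesis eps0 : 0 < eps.
Hypothesis hres : forall t : R, t != 0 -> `|t| < eps -> form_res (s + t).

(** The ball of radius |t| about s + t misses s, and 2 |t| <= eps keeps it in the neighbourhood
    covered by [hres]; [form_res_ball] then applies. *)
Let punctured_ball (t : R) f g : t != 0 -> 2 * `|t| <= eps ->
  form_op f (g + (s + t) *: i f) -> t ^+ 2 * N f <= dot g g.
Proof.
move=> t0 te; rewrite -[t ^+ 2]real_normK ?num_real//.
apply: (form_res_ball hdot dot_ge0 ha); first by rewrite normr_gt0.
move=> u ut; rewrite -addrA; apply: hres.
  by apply: contraTneq ut => /eqP; rewrite addr_eq0 => /eqP ->; rewrite normrN ltxx.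
by apply: (le_lt_trans (ler_normD _ _)); lra.
Qed.

Let tau := eps / 4.
Let tau0 : 0 < tau. Proof. by rewrite divr_gt0. Qed.

(* With A = form_op - s, the operator A^2 - tau^2 = (A - tau) (A + tau) is bounded
   below by tau^2; expanding the square gives |A z|^2 >= 2 tau^2 |z|^2 for z in the
   range of A. *)
Let range_gap w z y : form_op w (i z + s *: i w) -> form_op z (y + s *: i z) ->
  2 * tau ^+ 2 * N z <= dot y y.
Proof.
move=> hw hz.
pose w1 := tau *: w + z.
have iw1 : i w1 = tau *: i w + i z by rewrite linearP.
have hw1 : form_op w (i w1 + (s + - tau) *: i w).
  by move=> u; rewrite hw iw1 !(symbilE hdot); ring.
have hy : form_op w1 ((y - tau ^+ 2 *: i w) + (s + tau) *: i w1).
  by move=> u; rewrite ha.2 hw hz iw1 !(symbilE hdot); ring.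
have tn : `|tau| = tau by rewrite gtr0_norm.
have te : 2 * tau <= eps by rewrite /tau; have := eps0; lra.
have := punctured_ball _ _ hw1; rewrite oppr_eq0 normrN tn sqrrN gt_eqF// => /(_ isT te) h1.
have := punctured_ball _ _ hy; rewrite tn gt_eqF// => /(_ isT te) h2.
have := form_opC ha hw hz; rewrite !(symbilE hdot) (symbilC hdot (i w) (i z)) => yw.
move: h2; rewrite !(symbilE hdot) (symbilC hdot (i w) y) => h2.
have h3 : tau ^+ 2 * (tau ^+ 2 * N w) <= tau ^+ 2 * N w1.
  by apply: ler_wpM2l => //; exact: sqr_ge0.
have yw' : dot y (i w) = N z by lra.
rewrite yw' in h2; lra.
Qed.

(* The vectors z + t_n x_n, with x_n = (A - t_n)^-1 z and t_n -> 0, lie in the range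
   of A; they converge, and their limit differs from z by an element of the kernel
   of A orthogonal to fs. *)
Lemma isolated_gap (fs : seq H) :
  (forall f, f \in fs -> form_ker s f) ->
  (forall u, form_ker s u -> (forall f, f \in fs -> dot u f = 0) -> dot u u = 0) ->
  exists2 c, 0 < c & forall z y, form_op z (y + s *: i z) ->
    (forall f, f \in fs -> dot (i z) f = 0) -> c ^+ 2 * N z <= dot y y.
Proof.
move=> fsker fsmax; exists tau => // z y hz zfs.
pose t n : R := tau / n.+1%:R.
have t0 n : 0 < t n by rewrite divr_gt0.
have ttau n : t n <= tau by rewrite ler_pdivrMr// ler_peMr ?ler1n// ltW.
have tn n : `|t n| = t n by rewrite gtr0_norm.
have te n : 2 * t n <= eps.
  by have := ttau n; rewrite /tau; have := eps0; lra.
have /choice[x hx] : forall n, exists x, form_op x (i z + (s + t n) *: i x).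
  move=> n; have [||h _] := @hres (t n); last exact: h.
    by rewrite gt_eqF.
  by rewrite tn; have := te n; have := t0 n; lra.
pose zn n := t n *: x n + z.
have izn n : i (zn n) = t n *: i (x n) + i z by rewrite linearP.
have hxn n : form_op (x n) (i (zn n) + s *: i (x n)).
  by move=> u; rewrite (hx n u) izn !(symbilE hdot); ring.
have hzn n : form_op (zn n) ((y + t n *: i (zn n)) + s *: i (zn n)).
  by move=> u; rewrite ha.2 hxn hz izn !(symbilE hdot); ring.
clearbody zn.
have zn4 n : N (zn n) <= 4 * N z.
  have : t n ^+ 2 * N (x n) <= N z.
    by apply: punctured_ball (hx n); rewrite ?gt_eqF// tn te.
  have := symbil_sqD_le hdot dot_ge0 (t n *: i (x n)) (i z).
  rewrite -izn !(symbilZl hdot) !(symbilZr hdot); lra.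
(* A maps [zn n] to y + t_n zn_n. In differences y cancels and what remains tends to 0, so
   [range_gap] makes [zn] a Cauchy sequence. *)
have hdiff k n : form_op (zn k - zn n)
    ((t k *: i (zn k) - t n *: i (zn n)) + s *: i (zn k - zn n)).
  move=> u; have := hzn k u; have := hzn n u.
  by rewrite linearB !(symbilE hdot) !(symbilE ha) => -> ->; ring.
have Pdiff k n : dot (t k *: i (zn k) - t n *: i (zn n)) (t k *: i (zn k) - t n *: i (zn n))
    <= 8 * N z * (t k ^+ 2 + t n ^+ 2).
  apply: (le_trans (symbil_sqB_le hdot dot_ge0 _ _)).
  rewrite !(symbilZl hdot) !(symbilZr hdot).
  have := ler_wpM2l (sqr_ge0 (t k)) (zn4 k); have := ler_wpM2l (sqr_ge0 (t n)) (zn4 n).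
  lra.
have Ndiff k n : 2 * tau ^+ 2 * N (zn k - zn n) <= 8 * N z * (t k ^+ 2 + t n ^+ 2).
  apply: le_trans (Pdiff k n); apply: (@range_gap (x k - x n)); last exact: hdiff.
  move=> u; have := hxn k u; have := hxn n u.
  by rewrite !linearB !(symbilE hdot) !(symbilE ha) => -> ->; ring.
pose C := 8 * N z * (1 + (2 + `|s|) / (2 * tau ^+ 2)).
have C0 : 0 <= C.
  have q0 : 0 <= (2 + `|s|) / (2 * tau ^+ 2).
    by apply: divr_ge0; [exact: addr_ge0|apply: mulr_ge0 => //; exact: sqr_ge0].
  by apply: mulr_ge0; [exact: mulr_ge0|exact: addr_ge0].
have gdiff k n : graph_sq i dot a (zn k - zn n) <= C * (t k ^+ 2 + t n ^+ 2).
  rewrite /graph_sq (hdiff k n) (symbilDl hdot) (symbilZl hdot).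
  set p := _ - _; set e := i _.
  have h1 : 2 * dot p e <= dot p p + dot e e.
    exact: symbil_AMGM.
  have := Pdiff k n; have := Ndiff k n; rewrite -/e -/p; move: (dot_ge0 e) (dot_ge0 p) h1.
  rewrite /C; move: (dot p p) (dot e e) (dot p e) (N z) (t k ^+ 2 + t n ^+ 2).
  move=> P E pe Z T E0 P0 h1 hE hP.
  have hE' : E <= 8 * Z * T / (2 * tau ^+ 2).
    by rewrite ler_pdivlMr 1?mulrC// mulr_gt0// exprn_gt0.
  have : (2 + `|s|) * E <= (2 + `|s|) * (8 * Z * T / (2 * tau ^+ 2)).
    by apply: ler_wpM2l => //; rewrite addr_ge0.
  have : s * E <= `|s| * E by apply: ler_wpM2r => //; exact: ler_norm.
  have -> : 8 * Z * (1 + (2 + `|s|) / (2 * tau ^+ 2)) * T =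
    8 * Z * T + (2 + `|s|) * (8 * Z * T / (2 * tau ^+ 2)) by ring.
  lra.
have tsmall (e : R) : 0 < e -> exists N : nat, forall n, (N <= n)%N -> t n ^+ 2 < e.
  move=> e0; have e1 : 0 < e / tau ^+ 2 by rewrite divr_gt0// exprn_gt0.
  have [M hM] := invS_small e1; exists M => n /hM.
  rewrite ltr_pdivlMr ?exprn_gt0// => h; apply: le_lt_trans h.
  rewrite /t exprMn mulrC ler_pM2r ?exprn_gt0// expr2 ler_piMr ?invr_ge0//.
  by rewrite invf_le1// ler1n.
have [e e0|zeta hzeta] := complete (x := zn).
  have e1 : 0 < e / (2 * (C + 1)) by rewrite divr_gt0// mulr_gt0// ltr_wpDl.
  have [M hM] := tsmall _ e1; exists M => k n /hM hk /hM hn.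
  apply: (le_lt_trans (gdiff k n)).
  apply: (@le_lt_trans _ _ (C * (2 * (e / (2 * (C + 1)))))).
    by apply: ler_wpM2l => //; lra.
  have -> : C * (2 * (e / (2 * (C + 1)))) = e * (C / (C + 1)).
    by field; rewrite gt_eqF// ltr_wpDl.
  by rewrite gtr_pMr// ltr_pdivrMr ?ltr_wpDl// mul1r ltrDl.
have both (e : R) : 0 < e -> exists n, t n ^+ 2 < e /\ graph_sq i dot a (zn n - zeta) < e.
  move=> e0; have [M1 h1] := tsmall _ e0; have [M2 h2] := hzeta _ e0.
  by exists (maxn M1 M2); rewrite h1 ?leq_maxl// h2// leq_maxr.
have dot_graph w : N w <= graph_sq i dot a w by rewrite /graph_sq lerDr.
pose G x y := a x y + dot (i x) (i y).
have hG : symbil G by apply: symbilD => //; exact: symbil_lin.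
have G0 v : 0 <= G v v by rewrite addr_ge0.
pose u := z - zeta.
have iu : i u = i z - i zeta by rewrite linearB.
have uker : form_ker s (i u).
  exists u => // v; apply/eqP; rewrite -subr_eq0 -sqrf_eq0 eq_le sqr_ge0 andbT.
  apply/ler_addgt0Pr => e e0; rewrite add0r.
  pose B := 3 * (4 * N z * N v + G v v + (1 + s) ^+ 2 * G v v).
  have B0 : 0 <= B.
    apply: mulr_ge0 => //; apply: addr_ge0; first apply: addr_ge0 => //.
      by apply: mulr_ge0 => //; exact: mulr_ge0.
    by apply: mulr_ge0 => //; exact: sqr_ge0.
  have e1 : 0 < e / (B + 1) by rewrite divr_gt0// ltr_wpDl.
  have [n [hn1 hn2]] := both _ e1.
  pose X := t n * dot (i (zn n)) (i v).
  pose Y := G (zn n - zeta) v.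
  pose W := (1 + s) * dot (i (zn n - zeta)) (i v).
  (* A maps both z and, in the limit, zeta to y. X is the error t_n zn_n in the equation for [zn n];
     Y and W come from replacing zeta by [zn n]. All three vanish in the limit. *)
  have -> : a u v - dot (s *: i u) (i v) = - X + Y - W.
    rewrite /X /Y /W /G /u !linearB !(symbilE hdot) !(symbilE ha) hzn hz.
    by rewrite !(symbilE hdot); ring.
  have hX : X ^+ 2 <= 4 * N z * N v * (e / (B + 1)).
    rewrite /X exprMn mulrC; apply: ler_pM => //; try exact: sqr_ge0; last exact: ltW.
    apply: (le_trans (symbil_CauchySchwarz hdot dot_ge0 _ _)).
    by apply: ler_wpM2r.
  have hY : Y ^+ 2 <= G v v * (e / (B + 1)).
    apply: (le_trans (symbil_CauchySchwarz hG G0 _ _)); rewrite mulrC.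
    by apply: ler_wpM2l => //; exact: ltW.
  have hW : W ^+ 2 <= (1 + s) ^+ 2 * G v v * (e / (B + 1)).
    rewrite /W exprMn -mulrA; apply: ler_wpM2l; first exact: sqr_ge0.
    apply: (le_trans (symbil_CauchySchwarz hdot dot_ge0 _ _)); rewrite mulrC.
    by apply: ler_pM => //; exact: (le_trans (dot_graph _) (ltW hn2)).
  have : (- X + Y - W) ^+ 2 <= 3 * (X ^+ 2 + Y ^+ 2 + W ^+ 2).
    have := sqr_ge0 (X + Y); have := sqr_ge0 (Y + W); have := sqr_ge0 (X - W).
    by lra.
  move/le_trans; apply; apply: (@le_trans _ _ (B * (e / (B + 1)))).
    by rewrite /B in hX hY hW *; lra.
  by rewrite mulrCA ger_pMr// ler_pdivrMr ?ltr_wpDl// mul1r lerDl.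
have ufs f : f \in fs -> dot (i u) f = 0.
  move=> ffs; have znf n : dot (i (zn n)) f = 0.
    have [f0 if0 hf0] := fsker _ ffs.
    have := form_opC ha (hx n) hf0; rewrite if0 izn !(symbilE hdot) zfs//.
    rewrite (symbilC hdot f) => h.
    have /eqP : t n * dot (i (x n)) f = 0 by lra.
    rewrite mulf_eq0 gt_eqF//= => /eqP ->; lra.
  apply/eqP; rewrite -sqrf_eq0 eq_le sqr_ge0 andbT.
  apply/ler_addgt0Pr => e e0; rewrite add0r.
  have e1 : 0 < e / (dot f f + 1) by rewrite divr_gt0// ltr_wpDl.
  have [n [_ hn]] := both _ e1.
  have -> : dot (i u) f = dot (i (zn n - zeta)) f.
    by rewrite iu linearB !(symbilE hdot) znf zfs.
  apply: (le_trans (symbil_CauchySchwarz hdot dot_ge0 _ _)).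
  apply: (@le_trans _ _ (e / (dot f f + 1) * dot f f)).
    by apply: ler_wpM2r => //; exact: (le_trans (dot_graph _) (ltW hn)).
  by rewrite mulrAC -mulrA ger_pMr// ler_pdivrMr ?ltr_wpDl// mul1r lerDl.
have u0 : N u = 0 by exact: fsmax.
apply/ler_addgt0Pr => e e0.
pose B := 12 * tau ^+ 2 + 24 * N z.
have B0 : 0 <= B.
  by apply: addr_ge0; apply: mulr_ge0 => //; exact: sqr_ge0.
have e1 : 0 < e / (B + 1) by rewrite divr_gt0// ltr_wpDl.
have [n [hn1 hn2]] := both _ e1.
(* The weights 1/2 here and 1/3 in [h3] are matched: 3/2 times 4/3 equals 2, so passing to the limit
   turns the constant 2 tau^2 of [range_gap] into tau^2. *)
have h1 : N z <= 3/2 * N (zn n) + 6 * graph_sq i dot a (zn n - zeta).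
  have iz : i z = i (zn n) + i (z - zn n) by rewrite linearB addrC subrK.
  have := @symbil_sqD_weighted _ _ dot (2^-1) (i (zn n)) (i (z - zn n)) hdot dot_ge0.
  rewrite invr_gt0 invrK -iz => /(_ (ltr0Sn _ _)).
  have iz2 : i (z - zn n) = i u - i (zn n - zeta).
    by rewrite iu [i (z - _)]linearB [i (_ - zeta)]linearB opprB addrA subrK.
  have := symbil_sqB_le hdot dot_ge0 (i u) (i (zn n - zeta)); rewrite -iz2 u0.
  have := dot_graph (zn n - zeta); lra.
have h2 := range_gap (hxn n) (hzn n).
have h3 := @symbil_sqD_weighted _ _ dot (3^-1) y (t n *: i (zn n)) hdot dot_ge0.
move: h3; rewrite invr_gt0 invrK !(symbilZl hdot) !(symbilZr hdot) => /(_ (ltr0Sn _ _)) h3.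
have h4 : t n ^+ 2 * N (zn n) <= (e / (B + 1)) * (4 * N z).
  by apply: ler_pM => //; [exact: sqr_ge0|exact: ltW].
have h5 := ler_wpM2l (sqr_ge0 tau) h1.
have h6 : tau ^+ 2 * graph_sq i dot a (zn n - zeta) <= tau ^+ 2 * (e / (B + 1)).
  by apply: ler_wpM2l; [exact: sqr_ge0|exact: ltW].
have h7 : B * (e / (B + 1)) <= e.
  by rewrite mulrCA ger_pMr// ler_pdivrMr ?ltr_wpDl// mul1r lerDl.
move: h2 h3 h4 h5 h6 h7; rewrite /B /= => h2 h3 h4 h5 h6 h7; lra.
Qed.

End Gap.

Lemma form_ker_scale s c u : form_ker s u -> form_ker s (c *: u).
Proof.
move=> [f <- hf]; exists (c *: f); first by rewrite linearZ.
by move=> v; rewrite (symbilZl ha) hf !(symbilE hdot); ring.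
Qed.

(** In the resolvent set there is no eigenspace to split off, so [form_good_step] is used with [fs =
    [::]]; eta = C^-1 / 8 spends half of the gain C^-1. *)
Lemma form_good_sup_res (s : R) :
  (forall eta, 0 < eta -> exists2 K : R, 0 <= K & exists es : seq H, forall f,
     (s - eta) * N f <= a f f + K * \sum_(e <- es) dot (i f) e ^+ 2) ->
  form_res s -> exists2 mu, s < mu & form_good i dot a mu.
Proof.
move=> hgood hs; have [_ [C C0 hC]] := hs.
have eta0 : 0 < C^-1 / 8 by rewrite divr_gt0// invr_gt0.
have [K K0 [es hes]] := hgood _ eta0.
have ho : orthonormal dot [::] by split.
have [|K' K'0 [es' _ hes']] := form_good_step hdot dot_ge0 ha ho C0 (ltW eta0) K0 hs _ hes.
  by move=> f g h _; exact: hC.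
exists (s + C^-1 - 4 * (C^-1 / 8)); last by exists K' => //; exists es'.
have : 0 < C^-1 by rewrite invr_gt0.
lra.
Qed.

(** The resolvent may fail to exist at s itself, so the step is made at s + t. Off the eigenspace of
    s its bound is 2 / c by [isolated_gap], independently of t, and the gain c / 2 exceeds the
    losses. *)
Lemma form_good_sup_isolated (s : R) :
  (forall eta, 0 < eta -> exists2 K : R, 0 <= K & exists es : seq H, forall f,
     (s - eta) * N f <= a f f + K * \sum_(e <- es) dot (i f) e ^+ 2) ->
  (exists2 eps : R, 0 < eps & forall t : R, t != 0 -> `|t| < eps -> form_res (s + t)) ->
  (exists n : nat, forall fs, orthonormal dot fs ->
     (forall f, f \in fs -> form_ker s f) -> (size fs <= n)%N) ->
  exists2 mu, s < mu & form_good i dot a mu.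
Proof.
move=> hgood [eps eps0 hres] [n hn].
have [fs [ho hker hmax]] := orthonormal_max hdot dot_ge0 (@form_ker_scale s) hn.
have [c c0 hc] := isolated_gap eps0 hres hker hmax.
(* t <= c / 32 lets t f be absorbed in the gap estimate and leaves c / 16 - t positive, so that the
   bound at s + t - c / 16 lies strictly below the supremum; t < eps puts s + t in the resolvent
   set. *)
pose t := Num.min (c / 32) (eps / 2).
have t0 : 0 < t by rewrite lt_min !divr_gt0.
have tc : t <= c / 32 by rewrite ge_min lexx.
have te : t < eps by rewrite gt_min; apply/orP; right; lra.
have eta0 : 0 < c / 16 - t by lra.
have [K K0 [es hes]] := hgood _ eta0.
have ht : form_res (s + t) by apply: hres; rewrite ?gt_eqF// gtr0_norm.
have C0 : 0 < 2 / c by rewrite divr_gt0.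
have eta1 : 0 <= c / 16 by rewrite divr_ge0// ltW.
have [f g hf hg|f|K' K'0 [es' _ hes']] :=
  @form_good_step _ _ _ _ _ _ hdot dot_ge0 ha (s + t) (2 / c) (c / 16) K fs es ho C0 eta1 K0 ht.
- have ffs e : e \in fs -> dot (i f) e = 0.
    move=> efs; have [f0 if0 hf0] := hker _ efs.
    have := form_opC ha hf hf0; rewrite if0 !(symbilE hdot) hg// (symbilC hdot e).
    move=> h; have /eqP : t * dot (i f) e = 0 by lra.
    by rewrite mulf_eq0 gt_eqF//= => /eqP.
  have hf' : form_op f ((g + t *: i f) + s *: i f).
    by move=> v; rewrite hf !(symbilE hdot); ring.
  have := hc _ _ hf' ffs.
  have := @symbil_sqD_weighted _ _ dot 1 g (t *: i f) hdot dot_ge0 ltr01.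
  rewrite invr1 !(symbilZl hdot) !(symbilZr hdot).
  have : t * (t * N f) <= c / 32 * (c / 32 * N f).
    have tt : t * t <= c / 32 * (c / 32) by apply: ler_pM => //; exact: ltW.
    by have := ler_wpM2r (dot_ge0 (i f)) tt; rewrite -!mulrA.
  move=> h1 h2 h3; have h4 : c ^+ 2 * N f <= 2 * dot g g + 2 * (c / 32 * (c / 32 * N f)).
    lra.
  have := dot_ge0 (i f) => F0.
  have h5 : 0 <= c ^+ 2 * N f by rewrite mulr_ge0// sqr_ge0.
  rewrite exprMn exprVn mulrAC ler_pdivlMr ?exprn_gt0//.
  lra.
- have -> : s + t - c / 16 = s - (c / 16 - t) by ring.
  exact: hes.
exists (s + t + (2 / c)^-1 - 4 * (c / 16)); last by exists K' => //; exists es'.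
by rewrite invf_div; lra.
Qed.

Lemma form_good_above (lam : R) :
  (forall s, s <= lam -> form_res s \/
    (exists2 eps : R, 0 < eps & forall t : R, t != 0 -> `|t| < eps -> form_res (s + t)) /\
    (exists n : nat, forall fs, orthonormal dot fs ->
       (forall f, f \in fs -> form_ker s f) -> (size fs <= n)%N)) ->
  exists2 mu, lam < mu & form_good i dot a mu.
Proof.
move=> hlam; apply: contrapT => hno.
have hub mu : form_good i dot a mu -> mu <= lam.
  by move=> h; rewrite leNgt; apply/negP => hlt; apply: hno; exists mu.
have hsup : has_sup (form_good i dot a).
  split; last by exists lam.
  (* 0 is good without any correction, as the form is nonnegative. *)
  by exists 0; exists 0 => //; exists [::] => f; rewrite mul0r mul0r addr0.
set s := sup (form_good i dot a).
have slam : s <= lam by apply: ge_sup => //; exact: hsup.1.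
have hgood eta : 0 < eta -> exists2 K : R, 0 <= K & exists es : seq H, forall f,
     (s - eta) * N f <= a f f + K * \sum_(e <- es) dot (i f) e ^+ 2.
  move=> eta0; have [mu [K K0 [es hes]] hmu] := sup_adherent eta0 hsup.
  exists K => //; exists es => f; apply: le_trans (hes f).
  by apply: ler_wpM2r => //; exact: ltW.
suff [mu smu gmu] : exists2 mu, s < mu & form_good i dot a mu.
  by have := ub_le_sup hsup.2 gmu; rewrite leNgt smu.
have [hs|[hs1 hs2]] := hlam _ slam; first exact: form_good_sup_res.
exact: form_good_sup_isolated.
Qed.

End IsolatedPoint.

(** * Finite-rank perturbations *)

Lemma symbil_sq_sum_le (R : realType) (V : lmodType R) (B : V -> V -> R)
    (n : nat) (x : 'I_n -> V) :
  symbil B -> (forall v, 0 <= B v v) ->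
  B (\sum_j x j) (\sum_j x j) <= n%:R * \sum_j B (x j) (x j).
Proof.
move=> hB B0.
have -> : B (\sum_j x j) (\sum_j x j) = \sum_j \sum_k B (x j) (x k).
  by rewrite (symbil_suml hB); apply: eq_bigr => j _; rewrite (symbil_sumr hB).
suff : 2 * (\sum_j \sum_k B (x j) (x k)) <= 2 * (n%:R * \sum_j B (x j) (x j)).
  by rewrite ler_pM2l.
have -> : 2 * (n%:R * \sum_j B (x j) (x j)) =
    \sum_j \sum_k (B (x j) (x j) + B (x k) (x k)).
  transitivity (\sum_j \sum_(k < n) B (x j) (x j) + \sum_(j < n) \sum_k B (x k) (x k)).
    rewrite [X in _ + X]sumr_const card_ord.
    under [X in _ = X + _]eq_bigr do rewrite sumr_const card_ord.
    by rewrite sumrMnl -[_ *+ n]mulr_natl; ring.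
  by rewrite -big_split; apply: eq_bigr => j _; rewrite -big_split.
rewrite mulr_sumr; apply: ler_sum => j _; rewrite mulr_sumr; apply: ler_sum => k _.
exact: symbil_AMGM.
Qed.

Section FiniteRankPerturbation.
Variables (R : realType) (H D : lmodType R) (i : {linear D -> H}).
Variables (dot : H -> H -> R) (a : D -> D -> R).
Hypothesis hdot : symbil dot.
Hypothesis dot_ge0 : forall x, 0 <= dot x x.
Hypothesis dot_eq0 : forall x, dot x x = 0 -> x = 0.
Hypothesis ha : symbil a.
Hypothesis a_ge0 : forall v, 0 <= a v v.
Hypothesis complete : form_complete i dot a.

Local Notation opa := (form_op i dot a).
Local Notation form_res := (form_res i dot a).
Local Notation form_ker := (form_ker i dot a).
Local Notation N := (fun f : D => dot (i f) (i f)).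

Variables (lam K : R) (n : nat) (e : 'I_n -> H).
Hypothesis K0 : 0 <= K.
Hypothesis hlam : forall f, lam * N f <= a f f + K * \sum_k dot (i f) (e k) ^+ 2.

(** The correction is added to the form, so lam is a genuine lower bound of [a'] and the resolvent
    of its operator A' exists at every mu < lam by [coercive_res]. *)
Let a' := fun f g : D => a f g + K * \sum_k dot (i f) (e k) * dot (i g) (e k).

Local Notation opa' := (form_op i dot a').

Let ha' : symbil a'.
Proof.
apply: symbilD => //; apply: symbilM; split=> [x y|c x y z].
  by apply: eq_bigr => k _; rewrite mulrC.
rewrite mulr_sumr -big_split/=; apply: eq_bigr => k _.
by rewrite linearP !(symbilE hdot); ring.
Qed.

Let sum_sq f : \sum_k dot (i f) (e k) * dot (i f) (e k) = \sum_k dot (i f) (e k) ^+ 2.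
Proof. by apply: eq_bigr => k _; rewrite expr2. Qed.

Let sum_sq_ge0 f : 0 <= K * \sum_k dot (i f) (e k) ^+ 2.
Proof. by apply: mulr_ge0 => //; apply: sumr_ge0 => k _; exact: sqr_ge0. Qed.

Let a'_ge0 v : 0 <= a' v v.
Proof. by rewrite /a' sum_sq addr_ge0. Qed.

Let complete' : form_complete i dot a'.
Proof.
move=> x hx.
have [|y hy] := complete (x := x).
  move=> eps eps0; have [M hM] := hx _ eps0; exists M => p q hp hq.
  apply: le_lt_trans (hM p q hp hq).
  by rewrite /graph_sq /a' sum_sq; have := sum_sq_ge0 (x p - x q); lra.
exists y => eps eps0.
pose B := 1 + K * \sum_k dot (e k) (e k).
have B1 : 1 <= B.
  by rewrite /B lerDl; apply: mulr_ge0 => //; apply: sumr_ge0.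
have B0 : 0 < B by exact: lt_le_trans B1.
have [M hM] := hy _ (divr_gt0 eps0 B0); exists M => p /hM.
rewrite ltr_pdivlMr// => h; apply: le_lt_trans h.
rewrite /graph_sq /a' sum_sq; set z := x p - y.
have : \sum_k dot (i z) (e k) ^+ 2 <= N z * \sum_k dot (e k) (e k).
  by rewrite mulr_sumr; apply: ler_sum => k _; exact: symbil_CauchySchwarz.
move/(ler_wpM2l K0); have := a_ge0 z; have := dot_ge0 (i z); rewrite /B /=.
have : 0 <= K * \sum_k dot (e k) (e k) by apply: mulr_ge0 => //; apply: sumr_ge0.
move: (\sum_k dot (e k) (e k)) (\sum_k dot (i z) (e k) ^+ 2) (dot (i z) (i z)) (a z z) => E S Z A KE Z0 A0 h.
have : 0 <= A * (K * E) by exact: mulr_ge0.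
lra.
Qed.

Let form_opa' f g : opa f g -> opa' f (g + K *: \sum_k dot (i f) (e k) *: e k).
Proof.
move=> hf v; rewrite /a' hf !(symbilE hdot) (symbil_suml hdot); congr (_ + K * _).
by apply: eq_bigr => k _; rewrite (symbilZl hdot) (symbilC hdot (e k)).
Qed.

Let form_op_a' f g : opa' f g -> opa f (g - K *: \sum_k dot (i f) (e k) *: e k).
Proof.
move=> hf v; have := hf v; rewrite /a' !(symbilE hdot) (symbil_suml hdot) => <-.
rewrite -[LHS]addr0 -addrA; congr (_ + _); apply/esym/eqP; rewrite subr_eq0; apply/eqP; congr (K * _).
by apply: eq_bigr => k _; rewrite (symbilZl hdot) (symbilC hdot (e k)).
Qed.

(** As A f = A' f - K sum_k <f, e k> e k, solving (A - mu) f = g amounts to a linear system for the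
    n numbers <f, e k>. The alternative in the statement is that of its matrix [M]. *)
Lemma form_res_or_ker (mu : R) : mu < lam ->
  form_res mu \/ exists2 h, form_ker mu h & h != 0.
Proof.
move=> hmu.
have hlam' v : lam * N v <= a' v v by rewrite /a' sum_sq.
have [hG [C C0 hC]] := coercive_res hdot dot_ge0 ha' complete' a'_ge0 hlam' hmu.
have /choice[r hr] : forall k, exists f, opa' f (e k + mu *: i f).
  by move=> k; exact: hG.
pose M : 'M[R]_n := 1%:M - \matrix_(k, j) (K * dot (i (r k)) (e j)).
have vM (v : 'rV_n) j : (v *m M) 0 j = v 0 j - K * \sum_k v 0 k * dot (i (r k)) (e j).
  rewrite mulmxBr mulmx1 !mxE mulr_sumr; congr (_ - _).
  by apply: eq_bigr => k _; rewrite !mxE; ring.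
have [/eqP/det0P[v v0 vM0]|] := eqVneq (\det M) 0.
  (* v M = 0 says that the numbers <f, e j> are the v_j; so the right-hand side of the equation of
     A' is exactly the perturbation, which leaves A f = mu f. *)
  right; pose f := K *: \sum_k v 0 k *: r k.
  have ife j : dot (i f) (e j) = v 0 j.
    have := vM v j; rewrite vM0 mxE => /esym/eqP; rewrite subr_eq0 => /eqP ->.
    rewrite /f linearZ linear_sum/= (symbilZl hdot) (symbil_suml hdot).
    by congr (_ * _); apply: eq_bigr => k _; rewrite linearZ (symbilZl hdot).
  have hf : opa' f (K *: \sum_k v 0 k *: e k + mu *: i f).
    move=> w; rewrite /f (symbilZl ha') (symbil_suml ha') !(symbilE hdot) linearZ linear_sum.
    rewrite (symbilZl hdot) !(symbil_suml hdot) mulrCA -mulrDr; congr (_ * _).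
    rewrite mulr_sumr -big_split/=; apply: eq_bigr => k _.
    by rewrite (symbilZl ha') hr linearZ !(symbilE hdot); ring.
  exists (i f).
    exists f => // w; rewrite (form_op_a' hf); congr (dot _ _).
    under [X in _ - K *: X]eq_bigr => k _ do rewrite ife.
    by rewrite addrAC subrr add0r.
  apply: contra_neq v0 => if0; apply/rowP => j; rewrite mxE -ife if0.
  exact: symbil0l.
move=> detM; left.
have uM : M \in unitmx by rewrite unitmxE unitfE.
pose sol (d : 'rV[R]_n) : D := K *: \sum_k (d *m invmx M) 0 k *: r k.
have hsol d : opa' (sol d) (K *: \sum_k (d *m invmx M) 0 k *: e k + mu *: i (sol d)).
  move=> w; rewrite /sol (symbilZl ha') (symbil_suml ha') !(symbilE hdot) linearZ linear_sum.
  rewrite (symbilZl hdot) !(symbil_suml hdot) mulrCA -mulrDr; congr (_ * _).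
  rewrite mulr_sumr -big_split/=; apply: eq_bigr => k _.
  by rewrite (symbilZl ha') hr linearZ !(symbilE hdot); ring.
have isol d j : dot (i (sol d)) (e j) = (d *m invmx M) 0 j - d 0 j.
  have := vM (d *m invmx M) j; rewrite mulmxKV// => ->.
  rewrite opprB addrC subrK /sol linearZ linear_sum/= (symbilZl hdot) (symbil_suml hdot).
  by congr (_ * _); apply: eq_bigr => k _; rewrite linearZ (symbilZl hdot).
split.
  move=> g; have [f0 hf0] := hG g.
  pose d : 'rV[R]_n := \row_j dot (i f0) (e j).
  have dE j : d 0 j = dot (i f0) (e j) by rewrite mxE.
  exists (f0 + sol d).
  have hf : opa' (f0 + sol d)
      (g + K *: (\sum_k (d *m invmx M) 0 k *: e k) + mu *: i (f0 + sol d)).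
    move=> w; rewrite (symbilDl ha') hf0 hsol linearD !(symbilE hdot); ring.
  move=> w; rewrite (form_op_a' hf); congr (dot _ _).
  under [X in _ - K *: X]eq_bigr => k _.
    rewrite linearD (symbilDl hdot) isol dE addrC subrK; over.
  by rewrite addrAC addrK.
pose w j : H := K *: \sum_k invmx M j k *: i (r k).
have solE d : i (sol d) = \sum_j d 0 j *: w j.
  rewrite /sol linearZ linear_sum/= scaler_sumr /w.
  under [LHS]eq_bigr => k _ do rewrite [i _]linearZ/= mxE scaler_suml scaler_sumr.
  rewrite exchange_big/=; apply: eq_bigr => j _.
  rewrite !scaler_sumr; apply: eq_bigr => k _.
  by rewrite !scalerA; congr (_ *: _); ring.
pose B := n%:R * \sum_j dot (e j) (e j) * dot (w j) (w j).
have B0 : 0 <= B by apply: mulr_ge0 => //; apply: sumr_ge0 => j _; exact: mulr_ge0.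
have X0 : 0 <= 2 * (1 + B) * C ^+ 2.
  by apply: mulr_ge0; [apply: mulr_ge0 => //; exact: addr_ge0|exact: sqr_ge0].
exists (1 + 2 * (1 + B) * C ^+ 2); first by rewrite ltr_pwDl.
move=> f g hf.
(* c collects the numbers <f, e j>, and d = c M those of f1 = f - sol d. Since f1 solves the
   equation of A' with the same g, [hC] bounds f1, and through d also [sol d]. *)
pose c : 'rV[R]_n := \row_j dot (i f) (e j).
pose d := c *m M.
have dM : d *m invmx M = c by rewrite mulmxK.
pose f1 := f - sol d.
have hf1 : opa' f1 (g + mu *: i f1).
  move=> z; have := form_opa' hf z; have := hsol d z; rewrite dM.
  rewrite /f1 linearB !(symbilE ha') => -> ->; rewrite !(symbilE hdot).
  have -> : dot (\sum_k c 0 k *: e k) (i z) = dot (\sum_k dot (i f) (e k) *: e k) (i z).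
    by congr dot; apply: eq_bigr => k _; rewrite mxE.
  ring.
have hN1 := hC _ _ hf1.
have df1 j : dot (i f1) (e j) = d 0 j.
  by rewrite /f1 linearB !(symbilE hdot) isol dM mxE opprB addrC subrK.
have hsold : dot (i (sol d)) (i (sol d)) <= B * N f1.
  rewrite solE; apply: (le_trans (symbil_sq_sum_le _ hdot dot_ge0)).
  rewrite /B -mulrA; apply: ler_wpM2l => //; rewrite mulr_suml; apply: ler_sum => j _.
  rewrite (symbilZl hdot) (symbilZr hdot) -df1.
  have := ler_wpM2r (dot_ge0 (w j)) (symbil_CauchySchwarz hdot dot_ge0 (i f1) (e j)).
  lra.
have : N f <= 2 * N f1 + 2 * dot (i (sol d)) (i (sol d)).
  have -> : i f = i f1 + i (sol d) by rewrite /f1 linearB subrK.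
  exact: symbil_sqD_le.
move=> h; have : N f <= 2 * (1 + B) * C ^+ 2 * dot g g.
  have : (1 + B) * N f1 <= (1 + B) * (C ^+ 2 * dot g g).
    by apply: ler_wpM2l => //; exact: addr_ge0.
  lra.
move=> h1; apply: (le_trans h1); apply: ler_wpM2r => //.
by rewrite sqrrD; have := sqr_ge0 (2 * (1 + B) * C ^+ 2); lra.
Qed.

(** More than n vectors have a nontrivial combination g orthogonal to every [e k]; there the
    correction vanishes, while a g g is a sum of c_j^2 mu_j and hence below lam |g|^2. The family mu
    is arbitrary, which serves both distinct eigenvalues and multiplicities. *)
Lemma eigenvectors_below (p : nat) (mu : 'I_p -> R) (h : 'I_p -> H) :
  (forall j, mu j < lam) -> (forall j, form_ker (mu j) (h j)) ->
  (forall j k, dot (h j) (h k) = (j == k)%:R) -> (p <= n)%N.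
Proof.
move=> hmu hker ho; rewrite leqNgt; apply/negP => np.
have /choice[f hf] : forall j, exists f, i f = h j /\ opa f (mu j *: h j).
  by move=> j; have [f ? ?] := hker j; exists f.
pose M : 'M[R]_(p, n) := \matrix_(j, k) dot (h j) (e k).
have : kermx M != 0.
  rewrite kermx_eq0 /row_free; apply/eqP => rk.
  by have := rank_leq_col M; rewrite rk leqNgt np.
case/rowV0Pn => c /sub_kermxP cM c0.
pose g := \sum_j c 0 j *: f j.
have ig : i g = \sum_j c 0 j *: h j.
  by rewrite /g linear_sum; apply: eq_bigr => j _; rewrite linearZ (hf j).1.
have ge k : dot (i g) (e k) = 0.
  have /rowP/(_ k) := cM; rewrite !mxE => <-.
  rewrite ig (symbil_suml hdot); apply: eq_bigr => j _.
  by rewrite (symbilZl hdot) mxE.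
have hg j : dot (h j) (i g) = c 0 j.
  rewrite ig (symbil_sumr hdot) (bigD1 j)//= big1 ?addr0.
    by rewrite (symbilZr hdot) ho eqxx mulr1.
  by move=> k kj; rewrite (symbilZr hdot) ho eq_sym (negbTE kj) mulr0.
have := hlam g; rewrite [X in K * X]big1; last by move=> k _; rewrite ge expr0n.
have -> : a g g = \sum_j c 0 j ^+ 2 * mu j.
  rewrite {1}/g (symbil_suml ha); apply: eq_bigr => j _.
  by rewrite (symbilZl ha) (hf j).2 (symbilZl hdot) hg expr2 -mulrA [mu j * _]mulrC.
have -> : dot (i g) (i g) = \sum_j c 0 j ^+ 2.
  rewrite {1}ig (symbil_suml hdot); apply: eq_bigr => j _.
  by rewrite (symbilZl hdot) hg expr2.
rewrite mulr0 addr0 mulr_sumr leNgt => /negP; apply.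
have [j cj] : exists j, c 0 j != 0 by apply/rV0Pn.
rewrite (bigD1 j)//= [ltRHS](bigD1 j)//= ltr_leD//.
  by rewrite mulrC ltr_pM2r// exprn_even_gt0.
apply: ler_sum => k _; rewrite mulrC; apply: ler_wpM2r; first exact: sqr_ge0.
exact: ltW.
Qed.

(** By [form_res_or_ker] these points are eigenvalues, and eigenvectors for distinct ones are
    orthogonal; n + 1 of them would contradict the dimension count. *)
Lemma nonresolvent_below_finite : finite_set [set s | s < lam /\ ~ form_res s].
Proof.
apply: contrapT => /(infinite_set_fset n.+1)[F FS Fn].
pose s (j : 'I_n.+1) := nth 0 (enum_fset F) j.
have sF j : s j \in F by apply: mem_nth; exact: leq_trans Fn.
have /choice[h hh] : forall j, exists h, form_ker (s j) h /\ dot h h = 1.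
  move=> j; have [slt /(_ _)nres] := FS _ (sF j).
  have [//|[h [f fh hf] h0]] := form_res_or_ker slt.
  have hp : 0 < dot h h.
    rewrite lt_neqAle dot_ge0 andbT eq_sym; apply: contra_neq h0; exact: dot_eq0.
  exists ((Num.sqrt (dot h h))^-1 *: h); split.
    by apply: form_ker_scale => //; exists f.
  by rewrite !(symbilE hdot) mulrA -expr2 exprVn sqr_sqrtr// mulVf// gt_eqF.
have := @eigenvectors_below n.+1 s h; rewrite ltnn; move=> /(_ _ _ _)/negP; apply=> //.
- by move=> j; have [] := FS _ (sF j).
- by move=> j; have [] := hh j.
move=> j k; have [->|jk] := eqVneq j k; first by have [] := hh k.
have sjk : s j != s k.
  rewrite /s nth_uniq ?fset_uniq//; first by exact: leq_trans Fn.
  exact: leq_trans Fn.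
have [[fj ifj hfj] _] := hh j; have [[fk ifk hfk] _] := hh k.
have := form_opC ha hfj hfk; rewrite ifj ifk !(symbilE hdot) (symbilC hdot (h k)).
move=> /eqP; rewrite -subr_eq0 -mulrBl mulf_eq0 subr_eq0 (negbTE sjk)/= => /eqP ->.
by [].
Qed.

End FiniteRankPerturbation.

Lemma seq_isolated (R : realType) (r : seq R) (mu : R) :
  exists2 eps : R, 0 < eps & forall t : R, t != 0 -> `|t| < eps -> mu + t \notin r.
Proof.
elim: r => [|x r [eps eps0 IH]]; first by exists 1.
have [xmu|xmu] := eqVneq x mu.
  exists eps => // t t0 ht; rewrite in_cons negb_or IH// andbT xmu.
  by apply: contraNneq t0 => /eqP; rewrite -subr_eq0 addrC addKr => /eqP ->.
exists (Num.min eps `|x - mu|); first by rewrite lt_min eps0 normr_gt0 subr_eq0.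
move=> t t0; rewrite lt_min => /andP[te tx]; rewrite in_cons negb_or IH// andbT.
by apply: contraTneq tx => <-; rewrite addrC addKr ltxx.
Qed.

Lemma form_good_discrete (R : realType) (H D : lmodType R) (i : {linear D -> H})
    (dot : H -> H -> R) (a : D -> D -> R) (lam mu : R) :
  symbil dot -> (forall x, 0 <= dot x x) -> (forall x, dot x x = 0 -> x = 0) ->
  symbil a -> (forall v, 0 <= a v v) -> form_complete i dot a ->
  form_good i dot a lam -> mu < lam -> ~ form_res i dot a mu ->
  [/\ exists2 eps : R, 0 < eps &
        forall t : R, t != 0 -> `|t| < eps -> form_res i dot a (mu + t),
      exists2 h, form_ker i dot a mu h & h != 0 &
      exists fs : seq H, forall u, form_ker i dot a mu u -> u = proj dot fs u].
Proof.
move=> hdot dot_ge0 dot_eq0 ha a_ge0 complete [K K0 [es hes]] hmu hres.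
pose e (k : 'I_(size es)) := nth 0 es k.
have he f : lam * dot (i f) (i f) <= a f f + K * \sum_k dot (i f) (e k) ^+ 2.
  by have := hes f; rewrite (big_nth 0) big_mkord.
split.
- have /finite_seqP[r hr] :=
    nonresolvent_below_finite hdot dot_ge0 dot_eq0 ha a_ge0 complete K0 he.
  have [eps eps0 heps] := seq_isolated r mu.
  exists (Num.min eps (lam - mu)); first by rewrite lt_min eps0 subr_gt0.
  move=> t t0; rewrite lt_min => /andP[te tl]; apply: contrapT => nres.
  have : mu + t \in r.
    have : [set` r] (mu + t); last by [].
    rewrite -hr /=; split=> //; rewrite addrC -ltrBrDr.
    by apply: le_lt_trans tl; exact: ler_norm.
  by apply/negP; exact: heps.
- by have [] := form_res_or_ker hdot dot_ge0 ha a_ge0 complete K0 he hmu.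
have [||fs [ho hker hmax]] := @orthonormal_max _ _ _ hdot dot_ge0 (form_ker i dot a mu) (size es).
- by move=> c u; exact: form_ker_scale.
- move=> fs [fsu ho] hker.
  apply: (@eigenvectors_below _ _ _ _ _ _ hdot ha lam K (size es) e he (size fs)
            (fun=> mu) (fun j => nth 0 fs j)) => // [j|j k].
    by apply: hker; exact: mem_nth.
  by rewrite ho ?mem_nth// nth_uniq.
exists fs => u hu; apply/eqP; rewrite -subr_eq0; apply/eqP; apply: dot_eq0.
apply: hmax; last by move=> f ffs; exact: dot_projC_mem.
have kerN v w : form_ker i dot a mu v -> form_ker i dot a mu w -> form_ker i dot a mu (v - w).
  move=> [f <- hf] [g <- hg]; exists (f - g); first by rewrite linearB.
  by move=> z; rewrite !(symbilE ha) hf hg !(symbilE hdot); ring.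
apply: (kerN) => //; rewrite /proj.
have ker0 : form_ker i dot a mu 0.
  by have := kerN _ _ hu hu; rewrite subrr.
elim: (fs) hker {ho} => [|f r IH] hker; first by rewrite big_nil.
rewrite big_cons -[X in _ + X]opprK; apply: (kerN).
  by apply: form_ker_scale => //; apply: hker; rewrite mem_head.
rewrite -scaleN1r; apply: form_ker_scale => //; apply: IH => g gr.
by apply: hker; rewrite in_cons gr orbT.
Qed.

(** * Subspaces as modules *)

Definition is_subspace (R : realType) (V : lmodType R) (S : set V) : Prop :=
  S 0 /\ forall c x y, S x -> S y -> S (c *: x + y).

Section Subspace.
Variables (R : realType) (V : lmodType R) (S : set V).
Hypothesis hS : is_subspace S.

(** The proof of [is_subspace S] is an argument so that closure under linear combinations can be
    attached to the predicate as a canonical structure. *)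
Definition subspace_pred of is_subspace S : {pred V} := fun x => `[< S x >].

Record subspace := Subspace { sval_sub : V; _ : sval_sub \in subspace_pred hS }.

HB.instance Definition _ := [isSub for sval_sub].
HB.instance Definition _ := [Choice of subspace by <:].

Lemma subspace_closed : submod_closed (subspace_pred hS).
Proof.
split; first by apply/asboolP; exact: hS.1.
by move=> c x y /asboolP hx /asboolP hy; apply/asboolP; exact: hS.2.
Qed.

HB.instance Definition _ := GRing.isSubmodClosed.Build R V (subspace_pred hS) subspace_closed.
HB.instance Definition _ := [SubChoice_isSubLmodule of subspace by <:].

Lemma sval_sub_mem (u : subspace) : S (sval_sub u).
Proof. by case: u => x /= /asboolP. Qed.

Lemma mem_subspace_pred x : S x -> x \in subspace_pred hS.
Proof. by move=> Sx; apply/asboolP. Qed.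

Definition to_sub x (Sx : S x) : subspace := Subspace (mem_subspace_pred Sx).

Lemma sval_subP c (u v : subspace) :
  sval_sub (c *: u + v) = c *: sval_sub u + sval_sub v.
Proof. exact: (linearP (val : subspace -> V)). Qed.

Lemma sval_subB (u v : subspace) : sval_sub (u - v) = sval_sub u - sval_sub v.
Proof. exact: (linearB (val : subspace -> V)). Qed.

Lemma sval_subD (u v : subspace) : sval_sub (u + v) = sval_sub u + sval_sub v.
Proof. exact: (linearD (val : subspace -> V)). Qed.

Lemma sval_sub0 : sval_sub (0 : subspace) = 0.
Proof. exact: (linear0 (val : subspace -> V)). Qed.

Lemma sval_subZ c (u : subspace) : sval_sub (c *: u) = c *: sval_sub u.
Proof. by rewrite -[c *: u]addr0 sval_subP sval_sub0 addr0. Qed.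

Lemma sval_sub_inj : injective sval_sub.
Proof. exact: val_inj. Qed.

HB.instance Definition _ := GRing.isLinear.Build R subspace V _ sval_sub sval_subP.
End Subspace.

Section Inclusion.
Variables (R : realType) (V : lmodType R) (S S' : set V).
Hypotheses (hS : is_subspace S) (hS' : is_subspace S') (SS' : S `<=` S').

Definition incl_sub (u : subspace hS) : subspace hS' :=
  to_sub hS' (SS' (sval_sub_mem u)).

Lemma incl_sub_linear : linear incl_sub.
Proof. by move=> c u v; apply: sval_sub_inj; rewrite sval_subP; exact: sval_subP. Qed.

HB.instance Definition _ := GRing.isLinear.Build R (subspace hS) (subspace hS') _
  incl_sub incl_sub_linear.
End Inclusion.

(** * Summation *)

Section Summation.
Variables (R : realType) (T : choiceType).
Implicit Types (f g : T -> R) (s : seq T).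

(** Equivalent to finiteness of the [esum] of |f| by [rsummableP]; in this form the estimates stay
    in R. *)
Definition rsummable f : Prop :=
  exists M : R, forall s, uniq s -> \sum_(x <- s) `|f x| <= M.

Lemma esum_le_bound f (M : R) :
  (forall s, uniq s -> \sum_(x <- s) f x <= M) ->
  (\esum_(x in [set: T]) (f x)%:E <= M%:E)%E.
Proof.
move=> h; apply: ge_ereal_sup => _ [A [Afin _] <-].
by rewrite fsbig_finite//= sumEFin lee_fin; apply: h; exact: fset_uniq.
Qed.

Lemma sum_le_esum f s : uniq s ->
  ((\sum_(x <- s) f x)%:E <= \esum_(x in [set: T]) (f x)%:E)%E.
Proof.
move=> su; apply: esum_ge; exists [set` s].
  by split=> //; exact: finite_seq.
by rewrite -fsbig_seq// sumEFin.
Qed.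

Lemma esum_bound f (M : R) :
  (\esum_(x in [set: T]) (f x)%:E <= M%:E)%E ->
  forall s, uniq s -> \sum_(x <- s) f x <= M.
Proof. by move=> h s su; rewrite -lee_fin; exact: le_trans (sum_le_esum _ su) h. Qed.

Lemma esum_ltP f : (forall x, 0 <= f x) ->
  (\esum_(x in [set: T]) (f x)%:E < +oo)%E <->
  exists M : R, forall s, uniq s -> \sum_(x <- s) f x <= M.
Proof.
move=> f0; split=> [h|[M hM]]; last first.
  by apply: le_lt_trans (esum_le_bound hM) _; rewrite ltry.
have h0 : (0 <= \esum_(x in [set: T]) (f x)%:E)%E by apply: esum_ge0 => x _; rewrite lee_fin.
exists (fine (\esum_(x in [set: T]) (f x)%:E)); apply: esum_bound.
by rewrite fineK// ge0_fin_numE.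
Qed.

Lemma rsummableP f :
  rsummable f <-> (\esum_(x in [set: T]) `|f x|%:E < +oo)%E.
Proof. by rewrite esum_ltP. Qed.

Lemma rsummable_fin_num f : (forall x, 0 <= f x) -> rsummable f ->
  \esum_(x in [set: T]) (f x)%:E \is a fin_num.
Proof.
move=> f0 /rsummableP; under eq_esum do rewrite ger0_norm//.
by move=> h; rewrite ge0_fin_numE// esum_ge0// => x _; rewrite lee_fin.
Qed.

Lemma rsummable_le f g : (forall x, `|f x| <= g x) -> rsummable g -> rsummable f.
Proof.
move=> fg [M hM]; exists M => s su; apply: le_trans (hM s su).
by apply: ler_sum => x _; apply: (le_trans (fg x)); exact: ler_norm.
Qed.

Lemma rsummableD f g : rsummable f -> rsummable g -> rsummable (fun x => f x + g x).
Proof.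
move=> [M hM] [M' hM']; exists (M + M') => s su.
apply: le_trans (lerD (hM s su) (hM' s su)).
by rewrite -big_split; apply: ler_sum => x _; exact: ler_normD.
Qed.

Lemma rsummableZ c f : rsummable f -> rsummable (fun x => c * f x).
Proof.
move=> [M hM]; exists (`|c| * M) => s su.
under eq_bigr do rewrite normrM; rewrite -mulr_sumr.
by apply: ler_wpM2l => //; exact: hM.
Qed.

Lemma rsummableN f : rsummable f -> rsummable (fun x => - f x).
Proof.
by move=> /(rsummableZ (-1)); congr rsummable; apply/funext => x; rewrite mulN1r.
Qed.

Lemma rsummable_norm f : rsummable f -> rsummable (fun x => `|f x|).
Proof.
move=> [M hM]; exists M => s su.
by under eq_bigr do rewrite normr_id; exact: hM.
Qed.

Lemma rsummable_finite f s : (forall x, x \notin s -> f x = 0) -> rsummable f.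
Proof.
move=> hf; exists (\sum_(x <- undup s) `|f x|) => r ru.
rewrite (bigID (mem s))/= [X in _ + X]big1 ?addr0; last first.
  by move=> x xs; rewrite hf// normr0.
rewrite -big_filter.
rewrite [leRHS](perm_big ([seq x <- r | x \in s] ++ [seq x <- undup s | x \notin r]))/=.
  by rewrite big_cat/= lerDl; apply: sumr_ge0.
apply: uniq_perm; first exact: undup_uniq.
  rewrite cat_uniq !filter_uniq ?undup_uniq// andbT.
  apply/hasPn => x; rewrite !mem_filter => /andP[xr _].
  by rewrite (negbTE xr) andbF.
move=> x; rewrite mem_undup mem_cat !mem_filter mem_undup.
by case: (x \in s); case: (x \in r).
Qed.

Lemma rsum_ge0E f : (forall x, 0 <= f x) ->
  rsum f = fine (\esum_(x in [set: T]) (f x)%:E).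
Proof.
move=> f0; rewrite /rsum.
under eq_esum => x _ do rewrite max_l//.
by rewrite [X in _ - fine X]esum1 ?subr0// => x _; rewrite max_r// oppr_le0.
Qed.

(** [rsum] is defined by one particular splitting into positive and negative part. Any other
    splitting gives the same value because max(f, 0) + n = p + max(- f, 0), an identity between
    nonnegative functions; additivity of [rsum] rests on this. *)
Lemma rsum_subE p n : (forall x, 0 <= p x) -> (forall x, 0 <= n x) ->
  rsummable p -> rsummable n ->
  rsum (fun x => p x - n x) = rsum p - rsum n.
Proof.
move=> p0 n0 sp sn; rewrite [rsum p]rsum_ge0E// [rsum n]rsum_ge0E// /rsum.
set f := fun x => p x - n x.
have spn : rsummable (fun x => p x + n x) by exact: rsummableD.
have fpn x : `|f x| <= p x + n x.
  rewrite /f; apply: (le_trans (ler_normB _ _)).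
  by rewrite ger0_norm// ger0_norm.
have fp0 x : 0 <= Num.max (f x) 0 by rewrite le_max lexx orbT.
have fn0 x : 0 <= Num.max (- f x) 0 by rewrite le_max lexx orbT.
have sfp : rsummable (fun x => Num.max (f x) 0).
  apply: rsummable_le spn => x; rewrite ger0_norm// ge_max addr_ge0// andbT.
  exact: le_trans (ler_norm _) (fpn x).
have sfn : rsummable (fun x => Num.max (- f x) 0).
  apply: rsummable_le spn => x; rewrite ger0_norm// ge_max addr_ge0// andbT.
  by apply: le_trans (fpn x); rewrite -normrN ler_norm.
have E : (\esum_(x in [set: T]) (Num.max (f x) 0)%:E + \esum_(x in [set: T]) (n x)%:E =
          \esum_(x in [set: T]) (p x)%:E + \esum_(x in [set: T]) (Num.max (- f x) 0)%:E)%E.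
  rewrite -!esumD; try by move=> x _; rewrite lee_fin.
  apply: eq_esum => x _; rewrite -!EFinD; congr EFin.
  rewrite /f; have [h|h] := leP (p x - n x) 0.
    by rewrite max_l; lra.
  by rewrite max_r; lra.
have := congr1 fine E; rewrite !fineD ?rsummable_fin_num// => h.
apply/eqP; rewrite subr_eq addrAC eq_sym subr_eq eq_sym; apply/eqP; lra.
Qed.

Lemma rsum_posneg f : rsummable f ->
  rsum f = rsum (fun x => Num.max (f x) 0) - rsum (fun x => Num.max (- f x) 0).
Proof.
have fp0 x : 0 <= Num.max (f x) 0 by rewrite le_max lexx orbT.
have fn0 x : 0 <= Num.max (- f x) 0 by rewrite le_max lexx orbT.
by move=> sf; rewrite [in RHS]rsum_ge0E// [X in _ - X]rsum_ge0E.
Qed.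

Let posneg f : rsummable f -> exists p n,
  [/\ forall x, 0 <= p x, forall x, 0 <= n x, rsummable p, rsummable n &
      f = fun x => p x - n x].
Proof.
move=> sf; exists (fun x => Num.max (f x) 0), (fun x => Num.max (- f x) 0); split.
- by move=> x; rewrite le_max lexx orbT.
- by move=> x; rewrite le_max lexx orbT.
- apply: (@rsummable_le _ (fun x => `|f x|)).
    move=> x; rewrite ger0_norm ?le_max ?lexx ?orbT// ge_max normr_ge0 andbT.
    exact: ler_norm.
  exact: rsummable_norm.
- apply: (@rsummable_le _ (fun x => `|f x|)).
    move=> x; rewrite ger0_norm ?le_max ?lexx ?orbT// ge_max normr_ge0 andbT.
    by rewrite -normrN ler_norm.
  exact: rsummable_norm.
apply/funext => x; have [h|h] := leP (f x) 0.
  by rewrite max_l; lra.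
by rewrite max_r; lra.
Qed.

Let rsumD_ge0 p q : (forall x, 0 <= p x) -> (forall x, 0 <= q x) ->
  rsummable p -> rsummable q -> rsum (fun x => p x + q x) = rsum p + rsum q.
Proof.
move=> p0 q0 sp sq; rewrite !rsum_ge0E//; last by move=> x; exact: addr_ge0.
rewrite -fineD ?rsummable_fin_num//; congr fine.
by rewrite -esumD//; move=> x _; rewrite lee_fin.
Qed.

Lemma rsumD f g : rsummable f -> rsummable g ->
  rsum (fun x => f x + g x) = rsum f + rsum g.
Proof.
move=> /posneg[p [n [p0 n0 sp sn ->]]] /posneg[p' [n' [p'0 n'0 sp' sn' ->]]].
rewrite !rsum_subE//.
have -> : (fun x => p x - n x + (p' x - n' x)) = (fun x => (p x + p' x) - (n x + n' x)).
  by apply/funext => x; ring.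
rewrite rsum_subE//; try (by move=> x; exact: addr_ge0); try exact: rsummableD.
by rewrite !rsumD_ge0//; ring.
Qed.

Lemma rsum0 : rsum (fun _ : T => 0 : R) = 0.
Proof. by rewrite rsum_ge0E// esum1. Qed.

Lemma rsumN f : rsummable f -> rsum (fun x => - f x) = - rsum f.
Proof.
move=> sf; have := rsumD sf (rsummableN sf).
rewrite (_ : (fun x => f x + - f x) = fun=> 0) ?rsum0; last first.
  by apply/funext => x; rewrite subrr.
by move=> h; lra.
Qed.

Lemma rsumB f g : rsummable f -> rsummable g ->
  rsum (fun x => f x - g x) = rsum f - rsum g.
Proof. by move=> sf sg; rewrite rsumD// ?rsumN//; exact: rsummableN. Qed.

Lemma rsum_ge0 f : (forall x, 0 <= f x) -> 0 <= rsum f.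
Proof.
by move=> f0; rewrite rsum_ge0E//; apply: fine_ge0; apply: esum_ge0 => x _; rewrite lee_fin.
Qed.

Lemma sum_le_rsum f s : (forall x, 0 <= f x) -> rsummable f -> uniq s ->
  \sum_(x <- s) f x <= rsum f.
Proof.
move=> f0 sf su; rewrite rsum_ge0E// -lee_fin fineK ?rsummable_fin_num//.
exact: sum_le_esum.
Qed.

Lemma rsum_le_bound f (M : R) : (forall x, 0 <= f x) ->
  (forall s, uniq s -> \sum_(x <- s) f x <= M) -> rsum f <= M.
Proof.
move=> f0 h; rewrite rsum_ge0E// -lee_fin fineK; first exact: esum_le_bound.
apply: rsummable_fin_num => //; exists M => s /h.
by under [in X in _ -> X]eq_bigr do rewrite ger0_norm//.
Qed.

Lemma rsum_finite f s : uniq s -> (forall x, x \notin s -> f x = 0) ->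
  rsum f = \sum_(x <- s) f x.
Proof.
move=> su.
have ge0case g : (forall x, 0 <= g x) -> (forall x, x \notin s -> g x = 0) ->
    rsum g = \sum_(x <- s) g x.
  move=> g0 hg; apply/le_anti/andP; split; last first.
    by apply: sum_le_rsum => //; exact: rsummable_finite hg.
  apply: rsum_le_bound => // r ru.
  rewrite (bigID (mem s))/= [X in _ + X]big1 ?addr0; last by move=> x xs; rewrite hg.
  rewrite -big_filter [leRHS](bigID (mem r))/= -[X in _ <= X + _]big_filter.
  rewrite (perm_big [seq x <- s | x \in r]).
    by rewrite lerDl; apply: sumr_ge0.
  apply: uniq_perm; rewrite ?filter_uniq// => x.
  by rewrite !mem_filter andbC.
move=> hf; rewrite rsum_posneg; last exact: rsummable_finite hf.
rewrite !ge0case.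
- rewrite -sumrB; apply: eq_bigr => x _; have [h|h] := leP (f x) 0.
    by rewrite max_l; lra.
  by rewrite max_r; lra.
- by move=> x; rewrite le_max lexx orbT.
- by move=> x xs; rewrite hf// oppr0 maxxx.
- by move=> x; rewrite le_max lexx orbT.
- by move=> x xs; rewrite hf// maxxx.
Qed.

Lemma rsumZ c f : rsummable f -> rsum (fun x => c * f x) = c * rsum f.
Proof.
have pos d g : 0 < d -> (forall x, 0 <= g x) -> rsummable g ->
    rsum (fun x => d * g x) = d * rsum g.
  move=> d0 g0 sg; have dg0 x : 0 <= d * g x by rewrite mulr_ge0// ltW.
  apply/le_anti/andP; split.
    apply: rsum_le_bound => // s su; rewrite -mulr_sumr ler_pM2l//.
    exact: sum_le_rsum.
  rewrite -ler_pdivlMl//; apply: rsum_le_bound => // s su.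
  rewrite ler_pdivlMl// mulr_sumr; apply: sum_le_rsum => //; exact: rsummableZ.
have pos2 d g : 0 < d -> rsummable g -> rsum (fun x => d * g x) = d * rsum g.
  move=> d0 /posneg[p [n [p0 n0 sp sn ->]]].
  rewrite rsum_subE// mulrBr -!pos//.
  rewrite -rsum_subE//.
  - by congr rsum; apply/funext => x; rewrite mulrBr.
  - by move=> x; rewrite mulr_ge0// ltW.
  - by move=> x; rewrite mulr_ge0// ltW.
  - exact: rsummableZ.
  - exact: rsummableZ.
move=> sf; have [c0|c0|->] := ltgtP c 0.
- rewrite -[c]opprK mulNr -pos2 ?oppr_gt0// -rsumN//; last exact: rsummableZ.
  by congr rsum; apply/funext => x; ring.
- exact: pos2.
rewrite mul0r -[RHS]rsum0; congr rsum; apply/funext => x; exact: mul0r.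
Qed.

Lemma rsummable_tail f (e : R) : (forall x, 0 <= f x) -> rsummable f -> 0 < e ->
  exists s, uniq s /\ forall r, uniq r -> (forall x, x \in r -> x \notin s) ->
    \sum_(x <- r) f x < e.
Proof.
move=> f0 sf e0.
have fn := rsummable_fin_num f0 sf.
have [_ [A [Afin _] <-] hA] := ub_ereal_sup_adherent e0 fn.
move: hA; rewrite fsbig_finite//= sumEFin; set s := enum_fset (fset_set A) => hs.
exists s; split; first exact: fset_uniq.
move=> r ru hr; have : \sum_(x <- s ++ r) f x <= rsum f.
  apply: sum_le_rsum => //; rewrite cat_uniq ru fset_uniq andbT/=.
  by apply/hasPn => x /hr.
rewrite big_cat/= rsum_ge0E//; move: hs.
by rewrite -/(esum _ _) -{1}(fineK fn) -EFinB lte_fin; lra.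
Qed.

End Summation.

(** * The form on finitely supported functions *)

Lemma esum_rsum (R : realType) (T : choiceType) (f : T -> R) :
  (forall x, 0 <= f x) -> rsummable f ->
  (\esum_(x in [set: T]) (f x)%:E = (rsum f)%:E)%E.
Proof. by move=> f0 sf; rewrite rsum_ge0E// fineK// rsummable_fin_num. Qed.

Lemma sum_supset (R : realType) (T : choiceType) (f : T -> R) (s s' : seq T) :
  uniq s -> uniq s' -> (forall x, x \notin s -> f x = 0) -> {subset s <= s'} ->
  \sum_(x <- s) f x = \sum_(x <- s') f x.
Proof.
move=> su su' hs ss'; rewrite -(rsum_finite su hs) (rsum_finite su')// => x xs'.
by apply: hs; apply: contra xs'; exact: ss'.
Qed.

Section FiniteSupport.
Variables (R : realType) (X : choiceType).
Implicit Types (phi psi chi : X -> R) (s : seq X).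

Lemma CcP phi : Cc phi <-> exists2 s, uniq s & forall x, x \notin s -> phi x = 0.
Proof.
split=> [/finite_seqP[s hs]|[s su hs]].
  exists (undup s); first exact: undup_uniq.
  move=> x; rewrite mem_undup => xs; apply: contraNeq xs => phix.
  by have : [set x | phi x != 0] x by []; rewrite hs.
apply/finite_seqP; exists [seq x <- s | phi x != 0]; apply/seteqP; split=> x /=.
  by move=> phix; rewrite mem_filter phix/=; apply: contraNT phix => /hs ->; rewrite eqxx.
by rewrite mem_filter => /andP[].
Qed.

Lemma lincombE (c : R) (f g : X -> R^o) x : (c *: f + g) x = c * f x + g x.
Proof. by []. Qed.

Lemma Cc_is_subspace : is_subspace (@Cc R X : set (X -> R^o)).
Proof.
split; first by apply/CcP; exists [::].
move=> c phi psi /CcP[s su hs] /CcP[r ru hr]; apply/CcP.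
exists (undup (s ++ r)); first exact: undup_uniq.
move=> x; rewrite mem_undup mem_cat negb_or => /andP[xs xr].
by rewrite lincombE hs// hr// mulr0 addr0.
Qed.

Lemma Cc_common phi psi : Cc phi -> Cc psi -> exists s,
  [/\ uniq s, forall x, x \notin s -> phi x = 0 & forall x, x \notin s -> psi x = 0].
Proof.
move=> /CcP[s su hs] /CcP[r ru hr]; exists (undup (s ++ r)).
split; first exact: undup_uniq.
  by move=> x; rewrite mem_undup mem_cat negb_or => /andP[/hs].
by move=> x; rewrite mem_undup mem_cat negb_or => /andP[_ /hr].
Qed.

Lemma Cc_common3 phi psi chi : Cc phi -> Cc psi -> Cc chi -> exists s,
  [/\ uniq s, forall x, x \notin s -> phi x = 0, forall x, x \notin s -> psi x = 0
    & forall x, x \notin s -> chi x = 0].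
Proof.
move=> cphi cpsi /CcP[r ru hr]; have [s [su h1 h2]] := Cc_common cphi cpsi.
exists (undup (s ++ r)); split; first exact: undup_uniq.
- by move=> x; rewrite mem_undup mem_cat negb_or => /andP[/h1].
- by move=> x; rewrite mem_undup mem_cat negb_or => /andP[/h2].
by move=> x; rewrite mem_undup mem_cat negb_or => /andP[_ /hr].
Qed.

Definition indic (x : X) : X -> R := fun y => (y == x)%:R.

Lemma indic_out x y s : x \in s -> y \notin s -> indic x y = 0.
Proof. by move=> xs ys; rewrite /indic; case: eqP => // yx; rewrite yx xs in ys. Qed.

Lemma Cc_indic x : Cc (indic x).
Proof. by apply/CcP; exists [:: x] => // y; apply: indic_out; rewrite mem_head. Qed.

Lemma sum_indic (f : X -> R) s x : uniq s -> x \in s ->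
  \sum_(y <- s) f y * indic x y = f x.
Proof.
move=> su xs; rewrite (bigD1_seq x)//= big1 ?addr0.
  by rewrite /indic eqxx mulr1.
by move=> y /negbTE yx; rewrite /indic yx mulr0.
Qed.

End FiniteSupport.

Section GraphForm.
Variables (R : realType) (X : choiceType) (b : X -> X -> R) (q : X -> R).
Hypothesis hb : is_graph b.
Implicit Types (phi psi chi : X -> R) (s : seq X).

Lemma graph_sym x y : b x y = b y x. Proof. by case: hb. Qed.
Lemma graph_ge0 x y : 0 <= b x y. Proof. by case: hb. Qed.
Lemma graph_summable x : rsummable (b x).
Proof.
have [_ b0 _ bs] := hb; apply/rsummableP.
by under eq_esum do rewrite ger0_norm//.
Qed.

Definition hdiag (x : X) : R := rsum (b x) + q x.

(** H with its diagonal separated: it agrees with [Hop] on F(X), and the remaining sum has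
    nonnegative coefficients, so that for psi >= 0 it is governed by its finite partial sums. *)
Definition Hcc (psi : X -> R) (x : X) : R :=
  hdiag x * psi x - rsum (fun y => b x y * psi y).

Lemma FX_summable f x : FX b f -> rsummable (fun y => b x y * f y).
Proof.
move=> /(_ x) h; apply/rsummableP.
by under eq_esum do rewrite normrM (ger0_norm (graph_ge0 _ _)).
Qed.

Lemma HopE f x : FX b f -> Hop b q f x = Hcc f x.
Proof.
move=> hf; rewrite /Hop /Lap /Hcc /hdiag.
have -> : (fun y => b x y * (f x - f y)) = (fun y => f x * b x y - b x y * f y).
  by apply/funext => y; ring.
rewrite rsumB ?rsumZ; [ring|exact: graph_summable|apply: rsummableZ; exact: graph_summable|exact: FX_summable].
Qed.

Definition bform phi psi : R := rsum (fun x => phi x * Hcc psi x).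

Lemma bform_finite phi psi s : uniq s -> (forall x, x \notin s -> phi x = 0) ->
  (forall x, x \notin s -> psi x = 0) ->
  bform phi psi = \sum_(x <- s) hdiag x * phi x * psi x -
     \sum_(x <- s) \sum_(y <- s) b x y * phi x * psi y.
Proof.
move=> su hphi hpsi; rewrite /bform (rsum_finite su); last first.
  by move=> x xs; rewrite hphi// mul0r.
rewrite -sumrB; apply: eq_bigr => x _; rewrite /Hcc (rsum_finite su); last first.
  by move=> y ys; rewrite hpsi// mulr0.
rewrite mulrBr mulr_sumr; congr (_ - _); first by ring.
by apply: eq_bigr => y _; ring.
Qed.

(** Green's formula. The sum over pairs in [hform] may be infinite even for finitely supported phi,
    since edges leave the support; after expanding the square, Tonelli sums the two square terms to
    weighted degrees, and the mixed term is finite. *)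
Lemma hform_bform phi : Cc phi -> hform b q phi = bform phi phi.
Proof.
move=> /CcP[s su hs]; rewrite (bform_finite su)// /hform.
pose F1 (p : X * X) := b p.1 p.2 * phi p.1 ^+ 2.
pose F2 (p : X * X) := b p.1 p.2 * phi p.2 ^+ 2.
pose F3 (p : X * X) := b p.1 p.2 * phi p.1 * phi p.2.
pose d := \sum_(x <- s) rsum (b x) * phi x ^+ 2.
have F10 p : 0 <= F1 p by rewrite mulr_ge0 ?graph_ge0// sqr_ge0.
have F20 p : 0 <= F2 p by rewrite mulr_ge0 ?graph_ge0// sqr_ge0.
have E1 : (\esum_(p in [set: X * X]) (F1 p)%:E = d%:E)%E.
  have := @esum_esum R X X setT (fun=> setT) (fun x y => (b x y * phi x ^+ 2)%:E).
  have -> : setT `*`` (fun=> [set: X]) = [set: X * X] by apply/seteqP; split.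
  move=> <-; last by move=> x y _ _; rewrite lee_fin mulr_ge0 ?graph_ge0// sqr_ge0.
  have inner x : \esum_(y in [set: X]) (b x y * phi x ^+ 2)%:E = (rsum (b x) * phi x ^+ 2)%:E.
    rewrite [rsum (b x) * _]mulrC -(rsumZ (phi x ^+ 2) (graph_summable x)).
    rewrite -esum_rsum; first by apply: eq_esum => y _; rewrite mulrC.
      by move=> y; rewrite mulr_ge0 ?graph_ge0// sqr_ge0.
    by apply: rsummableZ; exact: graph_summable.
  under eq_esum do rewrite inner.
  rewrite esum_rsum.
  - by rewrite (rsum_finite su)// => x xs; rewrite hs// expr0n mulr0.
  - by move=> x; rewrite mulr_ge0 ?sqr_ge0// rsum_ge0// => y; exact: graph_ge0.
  by apply: (@rsummable_finite _ _ _ s) => x xs; rewrite hs// expr0n mulr0.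
have E2 : (\esum_(p in [set: X * X]) (F2 p)%:E = d%:E)%E.
  rewrite -E1 (@reindex_esum _ _ _ setT setT (fun p : X * X => (p.2, p.1))).
  - by apply: eq_esum => -[x y] _; rewrite /F1 /F2/= graph_sym.
  - split=> //.
    + by move=> [x y] [x' y'] _ _ [-> ->].
    + by move=> [x y] _; exists (y, x).
have s1 : rsummable F1 by apply/rsummableP; under eq_esum do rewrite ger0_norm//; rewrite E1 ltry.
have s2 : rsummable F2 by apply/rsummableP; under eq_esum do rewrite ger0_norm//; rewrite E2 ltry.
have r1 : rsum F1 = d by rewrite rsum_ge0E// E1.
have r2 : rsum F2 = d by rewrite rsum_ge0E// E2.
have F3out p : p \notin [seq (x, y) | x <- s, y <- s] -> F3 p = 0.
  case: p => x y /=; rewrite /F3/=.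
  have [xs|/hs ->] := boolP (x \in s); last by rewrite mulr0 mul0r.
  have [ys|/hs ->] := boolP (y \in s); last by rewrite mulr0.
  by move=> /negP; case; apply/allpairsP; exists (x, y).
have s3 : rsummable F3 by exact: rsummable_finite F3out.
have r3 : rsum F3 = \sum_(x <- s) \sum_(y <- s) b x y * phi x * phi y.
  rewrite (rsum_finite _ F3out); last by apply: allpairs_uniq => // -[x y] [x' y'] _ _ [-> ->].
  by rewrite big_allpairs.
have -> : (fun p : X * X => b p.1 p.2 * (phi p.1 - phi p.2) ^+ 2) =
    (fun p => (F1 p + F2 p) + (- 2) * F3 p).
  by apply/funext => p; rewrite /F1 /F2 /F3; ring.
rewrite rsumD; [|exact: rsummableD|exact: rsummableZ].
rewrite rsumD// rsumZ// r1 r2 r3 (rsum_finite su); last first.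
  by move=> x xs; rewrite hs// expr0n mulr0.
have -> : \sum_(x <- s) hdiag x * phi x * phi x = d + \sum_(x <- s) q x * phi x ^+ 2.
  by rewrite /d -big_split; apply: eq_bigr => x _; rewrite /hdiag/=; ring.
by field.
Qed.

Definition ccform (u v : subspace (Cc_is_subspace R X)) : R :=
  bform (sval_sub u) (sval_sub v).

Lemma ccform_symbil : symbil ccform.
Proof.
split=> [u v|c u v w].
  have [s [su hu hv]] := Cc_common (sval_sub_mem u) (sval_sub_mem v).
  rewrite /ccform !(bform_finite su)//; congr (_ - _).
    by apply: eq_bigr => x _; ring.
  rewrite exchange_big/=; apply: eq_bigr => x _; apply: eq_bigr => y _.
  by rewrite graph_sym; ring.
have [s [su hu hv hw]] := Cc_common3 (sval_sub_mem u) (sval_sub_mem v) (sval_sub_mem w).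
rewrite /ccform sval_subP !(bform_finite su)//; last first.
  by move=> x xs; rewrite lincombE hu// hv// mulr0 addr0.
rewrite mulrBr [RHS]addrACA -opprD; congr (_ - _).
  rewrite mulr_sumr -big_split/=; apply: eq_bigr => x _.
  by rewrite lincombE; ring.
rewrite mulr_sumr -big_split/=; apply: eq_bigr => x _.
rewrite mulr_sumr -big_split/=; apply: eq_bigr => y _.
by rewrite lincombE; ring.
Qed.

End GraphForm.

(** * The space l2 *)

Lemma cvg_epsP (R : realType) (u : nat -> R) (l : R) :
  u @ \oo --> l <->
  forall e : R, 0 < e -> exists N : nat, forall n, (N <= n)%N -> `|u n - l| < e.
Proof.
split=> [/cvgrPdist_lt h e e0|h].
  have [N _ hN] := h e e0; exists N => n Nn; rewrite distrC; exact: hN.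
apply/cvgrPdist_lt => e e0; have [N hN] := h e e0; exists N => // n Nn.
by rewrite distrC; exact: hN.
Qed.

Lemma cauchy_eps_cvg (R : realType) (u : nat -> R) :
  (forall e : R, 0 < e -> exists N : nat, forall n k, (N <= n)%N -> (N <= k)%N ->
     `|u n - u k| < e) -> exists l : R, u @ \oo --> l.
Proof.
move=> h; have /cauchy_cvg cu : cauchy (u @ \oo).
  apply: cauchy_exP => e e0.
  have [N hN] := h e e0; exists (u N); exists N => // n Nn.
  by rewrite -ball_normE /=; exact: hN.
by exists (lim (u @ \oo)).
Qed.

Lemma cvg_sum_seq (R : realType) (I T : Type) (F : set_system T) (s : seq I)
    (f : T -> I -> R) (l : I -> R) : ProperFilter F ->
  (forall i, f t i @[t --> F] --> l i) ->
  (\sum_(i <- s) f t i) @[t --> F] --> \sum_(i <- s) l i.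
Proof.
move=> FF h; elim: s => [|i s IH].
  by under eq_fun do rewrite big_nil; rewrite big_nil; exact: cvg_cst.
by under eq_fun do rewrite big_cons; rewrite big_cons; apply: cvgD.
Qed.

Lemma cvg_le_bound (R : realType) (T : Type) (F : set_system T) (f : T -> R) (l M : R) :
  ProperFilter F -> f t @[t --> F] --> l -> (\forall t \near F, f t <= M) -> l <= M.
Proof.
move=> FF cf hf; exact: (@closed_cvg _ _ F FF f [set y | y <= M] (closed_le (y := M)) hf l cf).
Qed.

Section L2.
Variables (R : realType) (X : choiceType) (m : X -> R).
Hypothesis hm : forall x, 0 < m x.
Implicit Types (f g : X -> R) (s : seq X).

Lemma l2P f : l2 m f <-> rsummable (fun x => f x ^+ 2 * m x).
Proof.
rewrite /l2/= rsummableP; under [X in _ <-> (X < _)%E]eq_esum.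
  move=> x _; rewrite ger0_norm; last by rewrite mulr_ge0 ?sqr_ge0// ltW.
  over.
by [].
Qed.

Lemma l2_mul_summable f g : l2 m f -> l2 m g -> rsummable (fun x => f x * g x * m x).
Proof.
move=> /l2P sf /l2P sg; apply: rsummable_le (rsummableD sf sg) => x.
rewrite -mulrDl normrM (gtr0_norm (hm x))// ler_pM2r// normrM.
rewrite -[f x ^+ 2]real_normK ?num_real// -[g x ^+ 2]real_normK ?num_real//.
have := sqr_ge0 (`|f x| - `|g x|); have := normr_ge0 (f x); have := normr_ge0 (g x).
by nra.
Qed.

Lemma l2_is_subspace : is_subspace (l2 m : set (X -> R^o)).
Proof.
split.
  by apply/l2P; exists 0 => s _; rewrite big1// => x _; rewrite expr0n mul0r normr0.
move=> c f g hf hg; apply/l2P.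
have -> : (fun x => (c *: f + g) x ^+ 2 * m x) =
   (fun x => (c ^+ 2 * (f x ^+ 2 * m x) + g x ^+ 2 * m x) + (2 * c) * (f x * g x * m x)).
  by apply/funext => x; rewrite lincombE; ring.
apply: rsummableD; last by apply: rsummableZ; exact: l2_mul_summable.
by apply: rsummableD; [apply: rsummableZ; exact/l2P|exact/l2P].
Qed.

Definition l2space : lmodType R := subspace l2_is_subspace.

Definition l2d (u v : l2space) : R := l2dot m (sval_sub u) (sval_sub v).

Lemma l2d_symbil : symbil l2d.
Proof.
split=> [u v|c u v w].
  by rewrite /l2d /l2dot; congr rsum; apply/funext => x; ring.
rewrite /l2d /l2dot sval_subP.
have -> : (fun x => (c *: sval_sub u + sval_sub v) x * sval_sub w x * m x) =
  (fun x => c * (sval_sub u x * sval_sub w x * m x) + sval_sub v x * sval_sub w x * m x).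
  by apply/funext => x; rewrite lincombE; ring.
have su := l2_mul_summable (sval_sub_mem u) (sval_sub_mem w).
have sv := l2_mul_summable (sval_sub_mem v) (sval_sub_mem w).
by rewrite rsumD ?rsumZ//; exact: rsummableZ.
Qed.

Lemma l2dot_ge0 f : 0 <= l2dot m f f.
Proof. by apply: rsum_ge0 => x; rewrite -expr2 mulr_ge0 ?sqr_ge0// ltW. Qed.

Lemma l2d_ge0 u : 0 <= l2d u u.
Proof. exact: l2dot_ge0. Qed.

Lemma l2dot_sqE f : l2dot m f f = rsum (fun x => f x ^+ 2 * m x).
Proof. by rewrite /l2dot; congr rsum; apply/funext => x; rewrite expr2. Qed.

Lemma sum_le_l2dot f s : l2 m f -> uniq s ->
  \sum_(x <- s) f x ^+ 2 * m x <= l2dot m f f.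
Proof.
move=> hf su; rewrite l2dot_sqE; apply: sum_le_rsum => //; last exact/l2P.
by move=> x; rewrite mulr_ge0 ?sqr_ge0// ltW.
Qed.

Lemma pointwise_le_l2dot f x : l2 m f -> f x ^+ 2 * m x <= l2dot m f f.
Proof.
move=> hf; have := @sum_le_l2dot f [:: x] hf isT.
by rewrite big_cons big_nil addr0.
Qed.

Lemma l2d_eq0 u : l2d u u = 0 -> u = 0.
Proof.
move=> u0; apply: sval_sub_inj; apply/funext => x; rewrite sval_sub0.
apply/eqP; have := pointwise_le_l2dot x (sval_sub_mem u).
by rewrite -/(l2d u u) u0 pmulr_lle0// => h; rewrite -sqrf_eq0 eq_le h sqr_ge0.
Qed.

Lemma l2_le_bound f (M : R) :
  (forall s, uniq s -> \sum_(x <- s) f x ^+ 2 * m x <= M) ->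
  l2 m f /\ l2dot m f f <= M.
Proof.
move=> h; have f0 x : 0 <= f x ^+ 2 * m x by rewrite mulr_ge0 ?sqr_ge0// ltW.
split; last by rewrite l2dot_sqE; exact: rsum_le_bound.
by apply/l2P; exists M => s /h; under [in X in _ -> X]eq_bigr do rewrite ger0_norm//.
Qed.

Lemma Cc_l2 : @Cc R X `<=` l2 m.
Proof.
move=> phi /CcP[s su hs]; apply/l2P; apply: (@rsummable_finite _ _ _ s) => x xs.
by rewrite hs// expr0n mul0r.
Qed.

Lemma l2dot_finite f g s : uniq s -> (forall x, x \notin s -> f x = 0) ->
  l2dot m f g = \sum_(x <- s) f x * g x * m x.
Proof. by move=> su hs; rewrite /l2dot (rsum_finite su)// => x xs; rewrite hs// !mul0r. Qed.

Lemma l2_complete (f : nat -> X -> R) : (forall n, l2 m (f n)) ->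
  (forall e : R, 0 < e -> exists N : nat, forall n k, (N <= n)%N -> (N <= k)%N ->
     l2dot m (f n \- f k) (f n \- f k) < e) ->
  exists g, [/\ l2 m g, forall x, (fun n => f n x) @ \oo --> g x &
    forall e : R, 0 < e -> exists N : nat, forall n, (N <= n)%N ->
      l2dot m (f n \- g) (f n \- g) < e].
Proof.
move=> fl2 hf.
have l2B u v : l2 m u -> l2 m v -> l2 m (u \- v).
  move=> hu hv; have := l2_is_subspace.2 (-1) _ _ hv hu; congr l2.
  by apply/funext => x; rewrite lincombE /= mulN1r addrC.
have /choice[g hg] : forall x, exists l : R, (fun n => f n x) @ \oo --> l.
  move=> x; apply: cauchy_eps_cvg => e e0.
  have e1 : 0 < e ^+ 2 * m x by rewrite mulr_gt0// exprn_gt0.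
  have [N hN] := hf _ e1; exists N => n k Nn Nk.
  have := le_lt_trans (pointwise_le_l2dot x (l2B _ _ (fl2 n) (fl2 k))) (hN n k Nn Nk).
  rewrite ltr_pM2r//= => h; have e0' := ltW e0.
  by rewrite -(@ltr_pXn2r _ 2) ?nnegrE // real_normK ?num_real.
have key (e : R) : 0 < e -> exists N : nat, forall n, (N <= n)%N ->
    l2 m (f n \- g) /\ l2dot m (f n \- g) (f n \- g) <= e.
  move=> e0; have [N hN] := hf _ e0; exists N => n Nn.
  apply: l2_le_bound => s su.
  have cv : (fun k => \sum_(x <- s) (f n x - f k x) ^+ 2 * m x) @ \oo -->
      \sum_(x <- s) (f n x - g x) ^+ 2 * m x.
    apply: cvg_sum_seq => x; apply: cvgMr_tmp.
    by apply: cvgM; apply: cvgB => //; exact: cvg_cst.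
  apply: (@cvg_le_bound R nat \oo _ _ e _ cv); exists N => // k Nk /=.
  apply: ltW; apply: le_lt_trans (hN n k Nn Nk).
  exact: (sum_le_l2dot (l2B _ _ (fl2 n) (fl2 k)) su).
exists g; split=> //.
  have [N hN] := key 1 ltr01; have [h _] := hN N (leqnn _).
  have := l2B _ _ (fl2 N) h; congr l2; apply/funext => x /=; ring.
move=> e e0; have [|N hN] := key (e / 2); first by rewrite divr_gt0.
by exists N => n /hN[_ h]; apply: (le_lt_trans h); lra.
Qed.

End L2.

(** * Closure of a form *)

Lemma cvg_real_unique (R : realType) (u : nat -> R) (l l' : R) :
  u @ \oo --> l -> u @ \oo --> l' -> l = l'.
Proof. by move=> h h'; rewrite -(cvg_lim (@norm_hausdorff _ _) h) -(cvg_lim (@norm_hausdorff _ _) h'). Qed.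

(** The hypothesis has the shape in which Cauchy-Schwarz delivers it: one factor below e^2 / B, the
    other at most B. *)
Lemma small_of_sq (R : realType) (x e B : R) : 0 < e -> 0 < B -> x ^+ 2 < e ^+ 2 / B * B -> `|x| < e.
Proof.
move=> e0 B0; rewrite divfK ?gt_eqF// => h; have e0' := ltW e0.
by rewrite -(@ltr_pXn2r _ 2) ?nnegrE // real_normK ?num_real.
Qed.

Section FormClosure.
Variables (R : realType) (C L : lmodType R) (j : {linear C -> L}).
Variables (dot : L -> L -> R) (c : C -> C -> R).
Hypothesis hdot : symbil dot.
Hypothesis dot_ge0 : forall x, 0 <= dot x x.
Hypothesis hc : symbil c.
Hypothesis c_ge0 : forall x, 0 <= c x x.
Implicit Types (f g : L) (phi psi : nat -> C).

Definition sq_cauchy (V : lmodType R) (B : V -> V -> R) (x : nat -> V) : Prop :=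
  forall e : R, 0 < e -> exists N : nat, forall n k, (N <= n)%N -> (N <= k)%N ->
    B (x n - x k) (x n - x k) < e.

Definition sq_cvg (V : lmodType R) (B : V -> V -> R) (x : nat -> V) (y : V) : Prop :=
  forall e : R, 0 < e -> exists N : nat, forall n, (N <= n)%N ->
    B (y - x n) (y - x n) < e.

Definition approx f phi : Prop := sq_cvg dot (fun n => j (phi n)) f /\ sq_cauchy c phi.

Hypothesis closable : forall phi, approx 0 phi ->
  (fun n => c (phi n) (phi n)) @ \oo --> (0 : R).
Hypothesis Lcomplete : forall x : nat -> L, sq_cauchy dot x -> exists y, sq_cvg dot x y.

Definition form_dom : set L := [set f | exists phi, approx f phi].

Lemma approx_lin k f g phi psi : approx f phi -> approx g psi ->
  approx (k *: f + g) (fun n => k *: phi n + psi n).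
Proof.
have aux (V : lmodType R) (B : V -> V -> R) x y : symbil B -> (forall v, 0 <= B v v) ->
    B (k *: x + y) (k *: x + y) <= 2 * k ^+ 2 * B x x + 2 * B y y.
  move=> hB B0; apply: (le_trans (symbil_sqD_le hB B0 _ _)).
  by rewrite (symbilZl hB) (symbilZr hB); lra.
have small (e A B : R) : 0 < e -> 0 <= A -> A < e / (4 * (k ^+ 2 + 1)) -> B < e / 4 ->
    2 * k ^+ 2 * A + 2 * B < e.
  move=> e0 A0; have k0 := sqr_ge0 k.
  rewrite ltr_pdivlMr ?mulr_gt0 ?ltr_wpDl// => hA hB.
  have : k ^+ 2 * A <= A * (k ^+ 2 + 1) by lra.
  lra.
have e1 (e : R) : 0 < e -> 0 < e / (4 * (k ^+ 2 + 1)).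
  by move=> e0; rewrite divr_gt0// mulr_gt0// ltr_wpDl// sqr_ge0.
have e2 (e : R) : 0 < e -> 0 < e / 4 by move=> e0; rewrite divr_gt0.
move=> [f1 f2] [g1 g2]; split=> e e0.
  have [N hN] := f1 _ (e1 e e0); have [M hM] := g1 _ (e2 e e0).
  exists (maxn N M) => n; rewrite geq_max => /andP[/hN h1 /hM h2].
  have -> : k *: f + g - j (k *: phi n + psi n) = k *: (f - j (phi n)) + (g - j (psi n)).
    by rewrite linearP scalerBr opprD addrACA.
  by apply: (le_lt_trans (aux _ _ _ _ hdot dot_ge0)); exact: small.
have [N hN] := f2 _ (e1 e e0); have [M hM] := g2 _ (e2 e e0).
exists (maxn N M) => n p; rewrite !geq_max => /andP[n1 n2] /andP[p1 p2].
have -> : k *: phi n + psi n - (k *: phi p + psi p) = k *: (phi n - phi p) + (psi n - psi p).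
  by rewrite scalerBr opprD addrACA.
by apply: (le_lt_trans (aux _ _ _ _ hc c_ge0)); apply: small => //; [exact: hN|exact: hM].
Qed.

Lemma approx_const (x : C) : approx (j x) (fun=> x).
Proof.
by split=> e e0; exists 0%N => *; rewrite subrr symbil0l.
Qed.

Lemma approxD f g phi psi : approx f phi -> approx g psi ->
  approx (f + g) (fun n => phi n + psi n).
Proof.
move=> hf hg; have := approx_lin 1 hf hg; rewrite scale1r; congr approx.
by apply/funext => n; rewrite scale1r.
Qed.

Lemma approxB f g phi psi : approx f phi -> approx g psi ->
  approx (f - g) (fun n => phi n - psi n).
Proof.
move=> hf hg; have := approx_lin (-1) hg hf; rewrite scaleN1r addrC; congr approx.
by apply/funext => n; rewrite scaleN1r addrC.
Qed.

Lemma form_dom_is_subspace : is_subspace form_dom.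
Proof.
split; first by exists (fun=> 0); rewrite -(linear0 j); exact: approx_const.
move=> k f g [phi hf] [psi hg]; exists (fun n => k *: phi n + psi n).
exact: approx_lin.
Qed.

Lemma sq_cvg_sq (x : nat -> L) (y : L) : sq_cvg dot x y ->
  (fun n => dot (x n) (x n)) @ \oo --> dot y y.
Proof.
move=> h; apply/cvg_epsP => e e0.
(* An upper bound for |x_n + y|^2 once |y - x_n|^2 < 1, which is why the tolerance below is a
   minimum with 1. *)
pose B := 6 * dot y y + 4; have B0 : 0 < B by rewrite ltr_wpDl// mulr_ge0.
have e1 : 0 < Num.min 1 (e ^+ 2 / B) by rewrite lt_min ltr01 divr_gt0// exprn_gt0.
have [N hN] := h _ e1; exists N => n /hN; rewrite lt_min => /andP[h1 h2].
apply: (small_of_sq e0 B0).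
have -> : dot (x n) (x n) - dot y y = dot (y - x n) (- (x n + y)).
  by rewrite !(symbilE hdot) (symbilC hdot y (x n)); ring.
apply: (le_lt_trans (symbil_CauchySchwarz hdot dot_ge0 _ _)).
apply: (@le_lt_trans _ _ (dot (y - x n) (y - x n) * B)); last by rewrite ltr_pM2r.
apply: ler_wpM2l => //; rewrite (symbilNl hdot) (symbilNr hdot) opprK.
apply: (le_trans (symbil_sqD_le hdot dot_ge0 _ _)).
have := symbil_sqB_le hdot dot_ge0 y (y - x n); rewrite subKr /B; lra.
Qed.

Lemma sq_cvg_dot (x : nat -> L) (y z : L) : sq_cvg dot x y ->
  (fun n => dot (x n) z) @ \oo --> dot y z.
Proof.
move=> h; apply/cvg_epsP => e e0.
have B0 : 0 < dot z z + 1 by rewrite ltr_wpDl.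
have e1 : 0 < e ^+ 2 / (dot z z + 1) by rewrite divr_gt0// exprn_gt0.
have [N hN] := h _ e1; exists N => n /hN hn.
rewrite distrC; apply: (small_of_sq e0 B0).
have -> : dot y z - dot (x n) z = dot (y - x n) z by rewrite !(symbilE hdot).
apply: (le_lt_trans (symbil_CauchySchwarz hdot dot_ge0 _ _)).
apply: (@le_lt_trans _ _ (dot (y - x n) (y - x n) * (dot z z + 1))).
  by apply: ler_wpM2l => //; rewrite lerDl.
by rewrite ltr_pM2r.
Qed.

Lemma sq_diff_le (x y : C) :
  (c x x - c y y) ^+ 2 <= c (x - y) (x - y) * (2 * c x x + 2 * c y y).
Proof.
have -> : c x x - c y y = c (x - y) (x + y) by rewrite !(symbilE hc) (symbilC hc y x); ring.
apply: (le_trans (symbil_CauchySchwarz hc c_ge0 _ _)).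
by apply: ler_wpM2l => //; exact: symbil_sqD_le.
Qed.

Lemma approx_bounded f phi : approx f phi -> exists2 B : R, 0 < B &
  exists N : nat, forall n, (N <= n)%N -> c (phi n) (phi n) <= B.
Proof.
move=> [_ hphi]; have [N hN] := hphi 1 ltr01.
exists (2 + 2 * c (phi N) (phi N)); first by rewrite ltr_pwDl// mulr_ge0.
exists N => n Nn; have := hN n N Nn (leqnn _).
by have := symbil_sqD_le hc c_ge0 (phi n - phi N) (phi N); rewrite subrK; lra.
Qed.

Lemma approx_cvg f phi : approx f phi ->
  exists l : R, (fun n => c (phi n) (phi n)) @ \oo --> l.
Proof.
move=> hphi; have [B B0 [N hN]] := approx_bounded hphi.
apply: cauchy_eps_cvg => e e0.
have B4 : 0 < 4 * B by rewrite mulr_gt0.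
have e1 : 0 < e ^+ 2 / (4 * B) by rewrite divr_gt0// exprn_gt0.
have [M hM] := hphi.2 _ e1; exists (maxn N M) => n k.
rewrite !geq_max => /andP[n1 n2] /andP[k1 k2]; apply: (small_of_sq e0 B4).
apply: (le_lt_trans (sq_diff_le _ _)).
apply: (@le_lt_trans _ _ (c (phi n - phi k) (phi n - phi k) * (4 * B))).
  by apply: ler_wpM2l => //; have := hN n n1; have := hN k k1; lra.
by rewrite ltr_pM2r//; exact: hM.
Qed.

(** The difference of the two sequences approximates 0. This is the place where closability enters
    and what makes [closure_sq] well defined. *)
Lemma approx_unique f phi psi (l : R) : approx f phi -> approx f psi ->
  (fun n => c (phi n) (phi n)) @ \oo --> l -> (fun n => c (psi n) (psi n)) @ \oo --> l.
Proof.
move=> hphi hpsi cl.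
have [B1 B10 [N1 hN1]] := approx_bounded hphi.
have [B2 B20 [N2 hN2]] := approx_bounded hpsi.
have := approxB hphi hpsi; rewrite subrr => /closable/cvg_epsP h0.
have {}cl := (cvg_epsP _ _).1 cl; apply/cvg_epsP => e e0.
pose B := 2 * B1 + 2 * B2; have B0 : 0 < B by rewrite addr_gt0// mulr_gt0.
have e2 : 0 < e / 2 by rewrite divr_gt0.
have [N3 hN3] := cl _ e2.
have e1 : 0 < (e / 2) ^+ 2 / B by rewrite divr_gt0// exprn_gt0.
have [N4 hN4] := h0 _ e1.
exists (maxn (maxn N1 N2) (maxn N3 N4)) => n; rewrite !geq_max.
move=> /andP[/andP[/hN1 h1 /hN2 h2] /andP[/hN3 h3 /hN4 h4]].
have h5 : `|c (phi n) (phi n) - c (psi n) (psi n)| < e / 2.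
  apply: (small_of_sq e2 B0); apply: (le_lt_trans (sq_diff_le _ _)).
  apply: (@le_lt_trans _ _ (c (phi n - psi n) (phi n - psi n) * B)).
    by apply: ler_wpM2l => //; rewrite /B; lra.
  by rewrite ltr_pM2r//; move: h4; rewrite subr0 ger0_norm.
have -> : c (psi n) (psi n) - l = (c (phi n) (phi n) - l) - (c (phi n) (phi n) - c (psi n) (psi n)) by ring.
by apply: (le_lt_trans (ler_normB _ _)); lra.
Qed.

Definition closure_sq (f : L) : R :=
  xget 0 [set l : R | exists2 phi, approx f phi & (fun n => c (phi n) (phi n)) @ \oo --> l].

Lemma closure_sqE f phi : approx f phi ->
  (fun n => c (phi n) (phi n)) @ \oo --> closure_sq f.
Proof.
move=> hphi; rewrite /closure_sq; case: xgetP => [l _ [psi hpsi cpsi]|h].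
  exact: approx_unique hpsi hphi cpsi.
by have [l cl] := approx_cvg hphi; exfalso; apply: (h l); exists phi.
Qed.

Definition closure_bilin (f g : L) : R := 4^-1 * (closure_sq (f + g) - closure_sq (f - g)).

(** Polarisation passes to the limit; symmetry and linearity of the closed form then follow from
    those of [c] by uniqueness of limits. *)
Lemma closure_bilinE f g phi psi : approx f phi -> approx g psi ->
  (fun n => c (phi n) (psi n)) @ \oo --> closure_bilin f g.
Proof.
move=> hf hg.
pose u n := c (phi n + psi n) (phi n + psi n) - c (phi n - psi n) (phi n - psi n).
have cu : u @ \oo --> closure_sq (f + g) - closure_sq (f - g).
  apply: cvgB; first exact: (closure_sqE (approxD hf hg)).
  exact: (closure_sqE (approxB hf hg)).
have -> : (fun n => c (phi n) (psi n)) = (fun n => 4^-1 * u n).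
  by apply/funext => n; rewrite /u !(symbilE hc) (symbilC hc (psi n)); field.
exact: cvgMl_tmp.
Qed.

Definition form_space : lmodType R := subspace form_dom_is_subspace.
Definition fbil (u v : form_space) : R := closure_bilin (sval_sub u) (sval_sub v).
Definition fincl : {linear form_space -> L} := @sval_sub R L form_dom form_dom_is_subspace.

Lemma fbil_symbil : symbil fbil.
Proof.
split=> [u v|k u v w].
  have [phi hf] := sval_sub_mem u; have [psi hg] := sval_sub_mem v.
  have h1 := closure_bilinE hf hg; have h2 := closure_bilinE hg hf.
  apply: (cvg_real_unique h1); have -> // : (fun n => c (phi n) (psi n)) = (fun n => c (psi n) (phi n)).
  by apply/funext => n; rewrite (symbilC hc).
have [phi hf] := sval_sub_mem u; have [psi hg] := sval_sub_mem v.
have [chi hk] := sval_sub_mem w.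
have h1 := closure_bilinE (approx_lin k hf hg) hk.
rewrite /fbil sval_subP; apply: (cvg_real_unique h1).
have -> : (fun n => c (k *: phi n + psi n) (chi n)) = (fun n => k * c (phi n) (chi n) + c (psi n) (chi n)).
  by apply/funext => n; rewrite hc.2.
by apply: cvgD; [apply: cvgMl_tmp|]; exact: closure_bilinE.
Qed.

Lemma fbil_approx u phi : approx (fincl u) phi ->
  (fun n => c (phi n) (phi n)) @ \oo --> fbil u u.
Proof. by move=> h; exact: (closure_bilinE h h). Qed.

Lemma fbil_ge0 u : 0 <= fbil u u.
Proof.
have [phi hf] := sval_sub_mem u; have h := closure_bilinE hf hf.
rewrite -oppr_le0; apply: (@cvg_le_bound R nat \oo (fun n => - c (phi n) (phi n))).
  exact: cvgN.
by exists 0 => // n _ /=; rewrite oppr_le0.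
Qed.

Lemma cc_mem (x : C) : form_dom (j x).
Proof. by exists (fun=> x); exact: approx_const. Qed.

Definition of_core (x : C) : form_space := to_sub form_dom_is_subspace (cc_mem x).

Lemma of_core_linear : linear of_core.
Proof. by move=> k x y; apply: sval_sub_inj; rewrite sval_subP /= linearP. Qed.

HB.instance Definition _ := GRing.isLinear.Build R C form_space _ of_core of_core_linear.

Lemma fbil_of_core x y : fbil (of_core x) (of_core y) = c x y.
Proof.
have h := closure_bilinE (approx_const x) (approx_const y).
by apply: (cvg_real_unique h); exact: cvg_cst.
Qed.

Lemma approx_graph u phi : approx (fincl u) phi -> forall e : R, 0 < e ->
  exists N : nat, forall n, (N <= n)%N -> graph_sq fincl dot fbil (u - of_core (phi n)) < e.
Proof.
move=> hphi e e0; have e2 : 0 < e / 2 by rewrite divr_gt0.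
have [N hN] := hphi.1 _ e2.
have e3 : 0 < e / 3 by rewrite divr_gt0.
have [M hM] := hphi.2 _ e3.
exists (maxn N M) => n; rewrite geq_max => /andP[n1 n2].
rewrite /graph_sq linearB.
have h1 : fbil (u - of_core (phi n)) (u - of_core (phi n)) <= e / 3.
  apply: (@cvg_le_bound R nat \oo (fun k => c (phi k - phi n) (phi k - phi n))).
    apply: fbil_approx; rewrite linearB; apply: approxB => //; exact: approx_const.
  by exists M => // k Mk /=; apply: ltW; exact: hM.
have := hN n n1; rewrite /fincl/= -/(of_core _); lra.
Qed.

Lemma core_dense u (e : R) : 0 < e -> exists x : C, graph_sq fincl dot fbil (u - of_core x) < e.
Proof.
move=> e0; have [phi hf] := sval_sub_mem u.
by have [N hN] := approx_graph hf e0; exists (phi N); exact: hN.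
Qed.

(** The correction involves finitely many inner products, hence is continuous in the norm, and the
    bound survives the closure. *)
Lemma fbil_lower (lam K : R) (es : seq L) :
  (forall x, lam * dot (j x) (j x) <= c x x + K * \sum_(e <- es) dot (j x) e ^+ 2) ->
  forall u, lam * dot (fincl u) (fincl u) <=
    fbil u u + K * \sum_(e <- es) dot (fincl u) e ^+ 2.
Proof.
move=> hlam u; have [phi hphi] := sval_sub_mem u.
have h1 := fbil_approx hphi; have h2 := sq_cvg_sq hphi.1.
rewrite -subr_le0.
apply: (@cvg_le_bound R nat \oo (fun n => lam * dot (j (phi n)) (j (phi n)) -
    (c (phi n) (phi n) + K * \sum_(e <- es) dot (j (phi n)) e ^+ 2)) _ 0).
  apply: cvgB; first exact: cvgMl_tmp.
  apply: cvgD => //; apply: cvgMl_tmp; apply: cvg_sum_seq => e.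
  have h := sq_cvg_dot (z := e) hphi.1.
  by apply: cvgM.
by exists 0 => // n _ /=; rewrite subr_le0.
Qed.

(** Each x n is replaced by a core element within 1 / (n + 1) of it. The new sequence is Cauchy for
    both [dot] and [c], so its limit in [L] belongs to the form domain by definition. *)
Lemma fbil_complete : form_complete fincl dot fbil.
Proof.
move=> x hx.
have hG : symbil (fun v w => fbil v w + dot (fincl v) (fincl w)).
  by apply: symbilD; [exact: fbil_symbil|exact: symbil_lin].
have G0 v : 0 <= fbil v v + dot (fincl v) (fincl v) by rewrite addr_ge0// fbil_ge0.
have /choice[phi hphi] : forall n : nat, exists y : C,
    graph_sq fincl dot fbil (x n - of_core y) < n.+1%:R^-1.
  by move=> n; apply: core_dense; rewrite invr_gt0.
have sqle (u v w : form_space) : graph_sq fincl dot fbil (u - w) <=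
    2 * graph_sq fincl dot fbil (u - v) + 2 * graph_sq fincl dot fbil (v - w).
  have -> : u - w = (u - v) + (v - w) by rewrite addrA subrK.
  exact: (symbil_sqD_le hG G0).
have gN (u v : form_space) : graph_sq fincl dot fbil (u - v) = graph_sq fincl dot fbil (v - u).
  rewrite -opprB /graph_sq linearN (symbilNl fbil_symbil) (symbilNr fbil_symbil).
  by rewrite (symbilNl hdot) (symbilNr hdot) !opprK.
have phic (e : R) : 0 < e -> exists N : nat, forall n k, (N <= n)%N -> (N <= k)%N ->
    graph_sq fincl dot fbil (of_core (phi n) - of_core (phi k)) < e.
  move=> e0; have e1 : 0 < e / 12 by rewrite divr_gt0.
  have [N hN] := hx _ e1; have [M hM] := invS_small e1.
  exists (maxn N M) => n k; rewrite !geq_max => /andP[n1 n2] /andP[k1 k2].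
  have h1 := lt_trans (hphi n) (hM n n2); have h2 := lt_trans (hphi k) (hM k k2).
  have h3 := hN n k n1 k1.
  have h4 := sqle (of_core (phi n)) (x n) (of_core (phi k)).
  have h5 := sqle (x n) (x k) (of_core (phi k)).
  rewrite gN in h1; lra.
have jphi n k : dot (j (phi n) - j (phi k)) (j (phi n) - j (phi k)) <=
    graph_sq fincl dot fbil (of_core (phi n) - of_core (phi k)).
  by rewrite /graph_sq linearB lerDr fbil_ge0.
have cphi n k : c (phi n - phi k) (phi n - phi k) <=
    graph_sq fincl dot fbil (of_core (phi n) - of_core (phi k)).
  by rewrite /graph_sq -linearB fbil_of_core lerDl.
have [y hy] : exists y, sq_cvg dot (fun n => j (phi n)) y.
  apply: Lcomplete => e e0; have [N hN] := phic e e0; exists N => n k n1 k1.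
  exact: le_lt_trans (jphi n k) (hN n k n1 k1).
have hyphi : approx y phi.
  split=> // e e0; have [N hN] := phic e e0; exists N => n k n1 k1.
  exact: le_lt_trans (cphi n k) (hN n k n1 k1).
have hyD : form_dom y by exists phi.
pose z : form_space := to_sub form_dom_is_subspace hyD.
exists z => e e0; have e4 : 0 < e / 4 by rewrite divr_gt0.
have [N hN] := @approx_graph z phi hyphi _ e4; have [M hM] := invS_small e4.
exists (maxn N M) => n; rewrite geq_max => /andP[n1 n2].
have h1 := hN n n1; have h2 := lt_trans (hphi n) (hM n n2).
have := sqle (x n) (of_core (phi n)) z; rewrite gN in h1; lra.
Qed.

End FormClosure.

(** * Harnack inequality and ground state representation *)

Lemma sum_subset_le (R : realType) (T : choiceType) (f : T -> R) (r s : seq T) :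
  uniq r -> uniq s -> {subset r <= s} -> (forall x, 0 <= f x) ->
  \sum_(x <- r) f x <= \sum_(x <- s) f x.
Proof.
move=> ru su rs f0; rewrite [leRHS](bigID (mem r))/= -[X in _ <= X + _]big_filter.
rewrite (perm_big [seq x <- s | x \in r]); first by rewrite lerDl; apply: sumr_ge0.
apply: uniq_perm; rewrite ?filter_uniq// => x; rewrite mem_filter.
by case xr : (x \in r) => //=; rewrite (rs _ xr).
Qed.

Lemma rsummable_countable (R : realType) (T : choiceType) (f : T -> R) :
  (forall x, 0 <= f x) -> rsummable f -> countable [set x | 0 < f x].
Proof.
move=> f0 sf.
have -> : [set x | 0 < f x] = \bigcup_(n in [set: nat]) [set x | n.+1%:R^-1 <= f x].
  apply/seteqP; split=> [x /= fx|x [n _] /= h].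
    by have [N hN] := invS_small fx; exists N => //=; apply: ltW; exact: hN.
  by apply: lt_le_trans h; rewrite invr_gt0.
apply: bigcup_countable => // n _; apply: finite_set_countable.
apply: contrapT => inf.
pose K := Num.truncn (rsum f * n.+1%:R).
have [B Bs hB] := infinite_set_fset K.+1 inf.
have := sum_le_rsum f0 sf (fset_uniq B).
have : \sum_(x <- B) n.+1%:R^-1 <= \sum_(x <- B) f x.
  by rewrite big_seq [leRHS]big_seq; apply: ler_sum => x xB; exact: Bs.
rewrite big_const_seq count_predT iter_addr addr0 => h1 h2.
have := le_trans h1 h2; rewrite -[leLHS]mulr_natl ler_pdivrMr// => h3.
have := lt_le_trans (truncnS_gt (rsum f * n.+1%:R)) (le_trans _ h3).
by rewrite ltxx => /(_ ltac:(by rewrite ler_nat)).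
Qed.

Section Countability.
Variables (R : realType) (X : choiceType) (b : X -> X -> R) (m : X -> R).
Hypothesis hb : is_graph b.
Hypothesis hm : forall x, 0 < m x.

(** Every vertex is reached from x0 in finitely many steps, and summable weights allow only
    countably many neighbours. Countability serves to find a strictly positive function in l^2(X,
    m). *)
Lemma connected_countable : connected_graph b -> countable [set: X].
Proof.
move=> hc; have [[x0]|h0] := pselect (exists x : X, True); last first.
  have -> : [set: X] = set0 by apply/seteqP; split=> // x _; apply: h0; exists x.
  exact: countable0.
move=> _; pose F := fix F n := if n is n'.+1 then
  \bigcup_(x in F n') [set y | 0 < b x y] else [set x0].
have -> : [set: X] = \bigcup_(n in [set: nat]) F n.
  apply/seteqP; split=> // y _; have [p [pth lst _]] := hc x0 y.
  suff H : forall p x n, F n x -> path (fun u v => 0 < b u v) x p ->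
      F (n + size p)%N (last x p).
    by exists (0 + size p)%N => //; rewrite -lst; exact: H.
  elim=> [|z r IH] x n Fx /=; first by rewrite addn0.
  by move=> /andP[bxz pr]; rewrite addnS -addSn; apply: IH => //; exists x.
apply: bigcup_countable => // n _; elim: n => [|n IH] /=; first exact: countable1.
apply: bigcup_countable => // x _; apply: rsummable_countable.
  exact: graph_ge0.
exact: graph_summable.
Qed.

Lemma sum_pow_half (s : seq nat) : uniq s -> \sum_(k <- s) (2^-1 : R) ^+ k <= 2.
Proof.
move=> su; pose N := (\max_(k <- s) k).+1.
have sN k : k \in s -> k \in iota 0 N.
  by move=> ks; rewrite mem_iota/= add0n ltnS; exact: leq_bigmax_seq.
have p0 k : 0 <= (2^-1 : R) ^+ k by rewrite exprn_ge0// invr_ge0.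
apply: (le_trans (sum_subset_le su (iota_uniq 0 N) sN p0)).
have -> : \sum_(k <- iota 0 N) (2^-1 : R) ^+ k = 2 - 2 * 2^-1 ^+ N.
  rewrite -[N in iota 0 N]subn0 -/(index_iota 0 N); elim: N {sN} => [|n IH].
    by rewrite big_geq// expr0; ring.
  by rewrite big_nat_recr//= IH exprS; field.
by rewrite gerBl; apply: mulr_ge0.
Qed.

Lemma positive_l2 : countable [set: X] -> exists g, (forall x, 0 < g x) /\ l2 m g.
Proof.
move=> /countable_injP[e einj].
have g0 x : 0 < 2^-1 ^+ e x / m x by rewrite divr_gt0// exprn_gt0// invr_gt0.
exists (fun x => Num.sqrt (2^-1 ^+ e x / m x)); split.
  by move=> x; rewrite sqrtr_gt0.
apply/l2P => //; exists 2 => s su.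
rewrite (eq_bigr (fun x => 2^-1 ^+ e x)); last first.
  move=> x _; rewrite sqr_sqrtr ?ltW// divfK ?gt_eqF// ger0_norm//.
rewrite -(big_map e xpredT (fun k => 2^-1 ^+ k)); apply: sum_pow_half.
by rewrite map_inj_in_uniq// => x y _ _; apply: einj; rewrite in_setT.
Qed.

End Countability.

Section GroundState.
Variables (R : realType) (X : choiceType) (b : X -> X -> R) (q m : X -> R).
Hypothesis hb : is_graph b.
Hypothesis hm : forall x, 0 < m x.
Variables (lam : R) (u : X -> R).
Hypothesis uF : FX b u.
Hypothesis u0 : forall x, 0 <= u x.

(** At a zero of u the inequality leaves only - sum_y b x y u y >= 0, a sum of nonnegative terms; so
    zeros spread to neighbours. *)
Lemma harnack_zero x y : 0 <= Hop b q u x - lam * m x * u x -> u x = 0 ->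
  0 < b x y -> u y = 0.
Proof.
rewrite HopE// /Hcc => + ux bxy; rewrite ux !mulr0 subr0 sub0r oppr_ge0 => h.
have bu0 z : 0 <= b x z * u z by rewrite mulr_ge0// graph_ge0.
have := @sum_le_rsum _ _ (fun z => b x z * u z) [:: y] bu0 (FX_summable hb x uF) isT.
rewrite big_seq1 => h1; have h2 := le_trans h1 h.
have /eqP : b x y * u y = 0 by apply/le_anti; rewrite h2 bu0.
by rewrite mulf_eq0 gt_eqF//= => /eqP.
Qed.

Lemma positive_on_component W x : W x ->
  (forall z, W z -> 0 <= Hop b q u z - lam * m z * u z) ->
  positive_in (joined_in b W x) u -> 0 < u x.
Proof.
move=> Wx hsup [_ [y [p [pth lst pW]] uy]].
rewrite lt_neqAle u0 andbT eq_sym; apply/eqP => ux.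
have : u y = 0.
  rewrite -lst; elim: p x ux Wx pth pW {lst} => [//|z p IH] x ux Wx /= /andP[bxz pth] pW.
  have uz := harnack_zero (hsup _ Wx) ux bxz.
  apply: IH => //; first by apply: pW; rewrite !in_cons eqxx orbT.
  by move=> v vp; apply: pW; rewrite in_cons vp orbT.
by move/eqP: uy.
Qed.

(** [gs_pot] and [gs_sq] are the potential and the energy of an edge after the substitution psi = u
    phi, which turns h - lam |.|^2 into a form with weights b x y u x u y. *)
Definition gs_pot (x : X) : R := Hcc b q u x / u x - lam * m x.
Definition gs_sq (psi : X -> R) (x y : X) : R :=
  b x y * u x * u y * (psi x / u x - psi y / u y) ^+ 2.
Definition gs_form (r : seq X) (psi : X -> R) : R :=
  \sum_(x <- r) gs_pot x * psi x ^+ 2 +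
  2^-1 * \sum_(x <- r) \sum_(y <- r) gs_sq psi x y.
(** The contribution of the neighbours outside r: [gs_form r] contains only the edges inside r, and
    the edges leaving r enter the representation through these tails. *)
Definition gs_tail (r : seq X) (x : X) : R :=
  rsum (fun y => b x y * u y) - \sum_(y <- r) b x y * u y.

Lemma gs_tail_ge0 r x : uniq r -> 0 <= gs_tail r x.
Proof.
move=> ru; rewrite subr_ge0; apply: sum_le_rsum => //; last exact: FX_summable.
by move=> y; rewrite mulr_ge0// graph_ge0.
Qed.

Lemma gs_sq_ge0 psi x y : 0 <= gs_sq psi x y.
Proof.
apply: mulr_ge0; last exact: sqr_ge0.
by apply: mulr_ge0 => //; apply: mulr_ge0 => //; exact: graph_ge0.
Qed.

(* gs_form s psi only involves the values of psi on s, and it increases with s. *)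
Lemma ground_state psi s : uniq s -> (forall x, x \notin s -> psi x = 0) ->
  (forall x, x \in s -> 0 < u x) ->
  bform b q psi psi - lam * l2dot m psi psi =
  gs_form s psi + \sum_(x <- s) psi x ^+ 2 / u x * gs_tail s x.
Proof.
move=> su hs us; rewrite (bform_finite b q su)// (l2dot_finite m _ su)//.
pose A x y := b x y * psi x ^+ 2 / u x * u y.
have -> : gs_form s psi = \sum_(x <- s) gs_pot x * psi x ^+ 2 +
    (\sum_(x <- s) \sum_(y <- s) A x y - \sum_(x <- s) \sum_(y <- s) b x y * psi x * psi y).
  rewrite /gs_form; congr (_ + _).
  have -> : \sum_(x <- s) \sum_(y <- s) gs_sq psi x y =
      \sum_(x <- s) \sum_(y <- s) (A x y + A y x - 2 * (b x y * psi x * psi y)).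
    rewrite big_seq [RHS]big_seq; apply: eq_bigr => x xs.
    rewrite big_seq [RHS]big_seq; apply: eq_bigr => y ys.
    rewrite /gs_sq /A (graph_sym hb y x); field.
    by rewrite !gt_eqF// us.
  under eq_bigr do rewrite sumrB big_split/= -mulr_sumr.
  rewrite sumrB big_split/= -mulr_sumr [X in (_ + X) - _]exchange_big/=.
  by field.
have -> : \sum_(x <- s) \sum_(y <- s) A x y =
    \sum_(x <- s) psi x ^+ 2 / u x * \sum_(y <- s) b x y * u y.
  by apply: eq_bigr => x _; rewrite mulr_sumr; apply: eq_bigr => y _; rewrite /A; ring.
have -> : \sum_(x <- s) psi x ^+ 2 / u x * gs_tail s x =
   \sum_(x <- s) psi x ^+ 2 / u x * rsum (fun y => b x y * u y) -
   \sum_(x <- s) psi x ^+ 2 / u x * \sum_(y <- s) b x y * u y.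
  by rewrite -sumrB; apply: eq_bigr => x _; rewrite /gs_tail; ring.
have -> : \sum_(x <- s) gs_pot x * psi x ^+ 2 =
   \sum_(x <- s) hdiag b q x * psi x * psi x - lam * \sum_(x <- s) psi x * psi x * m x
   - \sum_(x <- s) psi x ^+ 2 / u x * rsum (fun y => b x y * u y).
  rewrite mulr_sumr -!sumrB big_seq [RHS]big_seq; apply: eq_bigr => x xs.
  by rewrite /gs_pot /Hcc; field; rewrite gt_eqF// us.
ring.
Qed.

Lemma gs_pot_ge0 x : 0 < u x -> 0 <= Hop b q u x - lam * m x * u x -> 0 <= gs_pot x.
Proof.
move=> ux; rewrite HopE// /gs_pot => h.
by rewrite subr_ge0 ler_pdivlMr// -subr_ge0.
Qed.

Lemma gs_form_ge0 r psi : (forall x, x \in r -> 0 <= gs_pot x) -> 0 <= gs_form r psi.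
Proof.
move=> hr; rewrite addr_ge0//.
  by rewrite big_seq; apply: sumr_ge0 => x xr; rewrite mulr_ge0 ?sqr_ge0// hr.
rewrite mulr_ge0// ?invr_ge0//; apply: sumr_ge0 => x _; apply: sumr_ge0 => y _.
exact: gs_sq_ge0.
Qed.

Lemma gs_form_subset r s psi : uniq r -> uniq s -> {subset r <= s} ->
  (forall x, 0 <= gs_pot x) -> gs_form r psi <= gs_form s psi.
Proof.
move=> ru su rs hp; apply: lerD.
  by apply: sum_subset_le => // x; rewrite mulr_ge0// sqr_ge0.
rewrite ler_pM2l ?invr_gt0//.
apply: (@le_trans _ _ (\sum_(x <- r) \sum_(y <- s) gs_sq psi x y)).
  by apply: ler_sum => x _; apply: sum_subset_le => // y; exact: gs_sq_ge0.
by apply: sum_subset_le => // x; apply: sumr_ge0 => y _; exact: gs_sq_ge0.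
Qed.

Lemma tails_ge0 s psi : uniq s -> 0 <= \sum_(x <- s) psi x ^+ 2 / u x * gs_tail s x.
Proof.
move=> su; apply: sumr_ge0 => x _; rewrite mulr_ge0 ?gs_tail_ge0//.
by rewrite divr_ge0 ?sqr_ge0.
Qed.

Lemma allegretto_piepenbrink (W : set X) phi : (forall x, W x -> 0 < u x) ->
  (forall x, W x -> 0 <= Hop b q u x - lam * m x * u x) ->
  Cc phi -> (forall x, ~ W x -> phi x = 0) ->
  lam * l2dot m phi phi <= hform b q phi.
Proof.
move=> uW hW cphi phiW; rewrite (hform_bform q hb cphi) -subr_ge0.
have [r ru hr] := (CcP phi).1 cphi.
(* The exact support lies in W, the only place where u is known to be positive and superharmonic. *)
pose s := [seq x <- r | phi x != 0].
have sW x : x \in s -> W x.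
  by rewrite mem_filter => /andP[px _]; apply: contrapT => /phiW /eqP; apply/negP.
have su : uniq s by rewrite filter_uniq.
rewrite (ground_state su).
- by rewrite addr_ge0 ?tails_ge0//; apply: gs_form_ge0 => x /sW Wx; apply: gs_pot_ge0; [exact: uW|exact: hW].
- move=> x; rewrite mem_filter negb_and negbK => /orP[/eqP//|]; exact: hr.
by move=> x /sW; exact: uW.
Qed.

End GroundState.

(** * Existence of superharmonic functions *)

Section Existence.
Variables (R : realType) (X : choiceType) (b : X -> X -> R) (q m : X -> R).
Hypothesis hb : is_graph b.
Hypothesis hm : forall x, 0 < m x.
Hypothesis hh : form_ge0 b q.

Definition CcW (W : set X) : set (X -> R) :=
  [set phi | Cc phi /\ forall x, ~ W x -> phi x = 0].

Lemma CcW_is_subspace W : is_subspace (CcW W : set (X -> R^o)).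
Proof.
split; first by split=> //; exact: (Cc_is_subspace R X).1.
move=> c f g [cf fW] [cg gW]; split; first exact: (Cc_is_subspace R X).2.
by move=> x Wx; rewrite lincombE fW// gW// mulr0 addr0.
Qed.

Lemma CcW_Cc W : CcW W `<=` @Cc R X. Proof. by move=> f []. Qed.

Lemma CcW_l2 W : CcW W `<=` l2 m.
Proof. by move=> f /CcW_Cc; exact: Cc_l2. Qed.

Lemma bform_indicl x phi : bform b q (indic R x) phi = Hcc b q phi x.
Proof.
rewrite /bform (@rsum_finite _ _ _ [:: x])//; last first.
  by move=> y; rewrite inE => yx; rewrite /indic (negbTE yx) mul0r.
by rewrite big_seq1 /indic eqxx mul1r.
Qed.

(** Passing to |phi| preserves the diagonal part and can only increase the products phi x phi y,
    which enter with the sign of - b x y. *)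
Lemma bform_abs phi : Cc phi -> bform b q (fun x => `|phi x|) (fun x => `|phi x|) <= bform b q phi phi.
Proof.
move=> /CcP[s su hs]; rewrite !(bform_finite b q su)//; last 2 first.
- by move=> x /hs ->; rewrite normr0.
- by move=> x /hs ->; rewrite normr0.
apply: lerB.
  by apply: ler_sum => x _; rewrite -!mulrA -normrM -expr2 ger0_norm ?sqr_ge0// expr2.
apply: ler_sum => x _; apply: ler_sum => y _.
rewrite -!mulrA -normrM; apply: ler_wpM2l; [exact: graph_ge0|exact: ler_norm].
Qed.

Section Minimiser.
Variables (W : set X) (lam mu : R) (g : X -> R).
Hypothesis mu_lt : mu < lam.
Hypothesis hlam : forall phi, CcW W phi -> lam * l2dot m phi phi <= hform b q phi.
Hypothesis g0 : forall x, 0 < g x.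
Hypothesis gl2 : l2 m g.

Let V := subspace (CcW_is_subspace W).
Let iC : {linear V -> subspace (Cc_is_subspace R X)} :=
  incl_sub (hS := CcW_is_subspace W) (Cc_is_subspace R X) (@CcW_Cc W).
Let iL : {linear V -> l2space hm} :=
  incl_sub (hS := CcW_is_subspace W) (l2_is_subspace hm) (@CcW_l2 W).

Let Q := fun v w : V => ccform b q (iC v) (iC w) + (- mu) * l2d (iL v) (iL w).
Let l := fun v : V => l2dot m g (sval_sub v).

Let QE v w : Q v w = bform b q (sval_sub v) (sval_sub w)
   - mu * l2dot m (sval_sub v) (sval_sub w).
Proof. by rewrite /Q mulNr. Qed.

Let hQ : symbil Q.
Proof.
apply: symbilD; first exact: (symbil_lin iC (ccform_symbil q hb)).
apply: symbilM; exact: (symbil_lin iL (l2d_symbil hm)).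
Qed.

Let N (v : V) := l2dot m (sval_sub v) (sval_sub v).

Let Q_N v : (lam - mu) * N v <= Q v v.
Proof.
rewrite QE -hform_bform//; last exact: CcW_Cc (sval_sub_mem v).
by have := hlam (sval_sub_mem v); rewrite /N; lra.
Qed.

Let N0 v : 0 <= N v. Proof. exact: l2dot_ge0. Qed.

Let d0 : 0 < lam - mu. Proof. by rewrite subr_gt0. Qed.

Let Q0 v : 0 <= Q v v.
Proof. by apply: le_trans (Q_N v); apply: mulr_ge0 => //; exact: ltW. Qed.

Let l_lin c v w : l (c *: v + w) = c * l v + l w.
Proof.
have := (l2d_symbil hm).2 c (iL v) (iL w) (to_sub (l2_is_subspace hm) gl2).
rewrite -linearP !(symbilC (l2d_symbil hm) _ (to_sub _ gl2)); exact.
Qed.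

Let l_bnd v : l v ^+ 2 <= l2dot m g g / (lam - mu) * Q v v.
Proof.
apply: (le_trans (symbil_CauchySchwarz (l2d_symbil hm) (l2d_ge0 (hm := hm))
  (to_sub (l2_is_subspace hm) gl2) (iL v))).
rewrite -mulrA; apply: ler_wpM2l; first exact: l2dot_ge0.
by rewrite ler_pdivlMl//; exact: Q_N.
Qed.

Let vabs_mem (v : V) : CcW W (fun x => `|sval_sub v x|).
Proof.
have [/CcP[s su hs] hW] := sval_sub_mem v; split.
  by apply/CcP; exists s => // x /hs ->; rewrite normr0.
by move=> x /hW ->; rewrite normr0.
Qed.

Let vabs (v : V) : V := to_sub (CcW_is_subspace W) (vabs_mem v).

Let qfun_abs v : qfun Q l (vabs v) <= qfun Q l v.
Proof.
have [cv hW] := sval_sub_mem v.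
have [s su hs] := (CcP _).1 cv.
rewrite /qfun !QE; apply: lerB.
  apply: lerB; first exact: bform_abs.
  rewrite !(l2dot_finite m _ su)//; last by move=> x xs /=; rewrite hs ?normr0.
  rewrite le_eqVlt; apply/orP; left; apply/eqP; congr (_ * _).
  apply: eq_bigr => x _; congr (_ * _).
  by rewrite /= -!expr2 real_normK ?num_real.
rewrite ler_pM2l// /l /l2dot; rewrite !(rsum_finite su).
- apply: ler_sum => x _; rewrite ler_pM2r// ler_pM2l//; exact: ler_norm.
- by move=> x xs /=; rewrite hs// normr0 mulr0 mul0r.
- by move=> x xs /=; rewrite hs// mulr0 mul0r.
Qed.

(* A minimiser of h phi - mu |phi|^2 - 2 <g, phi> on CcW W, obtained as a pointwise
   limit: as h (|phi|) <= h phi, the minimising sequence can be taken nonnegative,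
   and Fatou's lemma turns the variational inequality into (H - mu m) u >= g m. *)
Lemma strict_superharmonic : exists u : X -> R,
  [/\ FX b u, forall x, 0 <= u x, forall x, W x -> 0 < u x &
      forall x, W x -> 0 <= Hop b q u x - mu * m x * u x].
Proof.
have L0 : 0 <= l2dot m g g / (lam - mu).
  by apply: divr_ge0; [exact: l2dot_ge0|exact: ltW].
have [J0 lbJ infJ] := qfun_inf L0 Q0 l_bnd.
have /choice[v hv] : forall n : nat, exists v : V,
    qfun Q l v < J0 + n.+1%:R^-1 /\ forall x, 0 <= sval_sub v x.
  move=> n; have [|v hv] := infJ n.+1%:R^-1; first by rewrite invr_gt0.
  exists (vabs v); split; first exact: le_lt_trans (qfun_abs v) hv.
  by move=> x /=.
pose f n : X -> R := sval_sub (v n).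
have f0 n x : 0 <= f n x by exact: (hv n).2.
have Qdiff (e : R) : 0 < e -> exists M : nat, forall n k, (M <= n)%N -> (M <= k)%N ->
    Q (v n - v k) (v n - v k) <= 4 * e.
  move=> e0; have [M hM] := invS_small e0; exists M => n k Mn Mk.
  apply: (qfun_cauchy hQ l_lin lbJ).
    by apply: (lt_trans (hv n).1); rewrite ltrD2l hM.
  by apply: (lt_trans (hv k).1); rewrite ltrD2l hM.
have /choice[u hu] : forall x, exists c : R, (fun n => f n x) @ \oo --> c.
  move=> x; apply: cauchy_eps_cvg => e e0.
  have mx : 0 < (lam - mu) * m x by rewrite mulr_gt0.
  have e1 : 0 < e ^+ 2 * ((lam - mu) * m x) / 8 by rewrite divr_gt0// mulr_gt0// exprn_gt0.
  have [M hM] := Qdiff _ e1; exists M => n k Mn Mk.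
  have h1 := le_trans (Q_N (v n - v k)) (hM n k Mn Mk).
  have h2 : (f n x - f k x) ^+ 2 * m x <= N (v n - v k).
    have : sval_sub (v n - v k) x ^+ 2 * m x <= N (v n - v k).
      exact: (pointwise_le_l2dot hm x (sval_sub_mem (iL (v n - v k)))).
    by rewrite {1}sval_subB.
  have h3 := ler_wpM2l (ltW d0) h2.
  have h4 : (f n x - f k x) ^+ 2 * ((lam - mu) * m x) < e ^+ 2 * ((lam - mu) * m x).
    have := mulr_gt0 (exprn_gt0 2 e0) mx; lra.
  rewrite ltr_pM2r// in h4; have e0' := ltW e0.
  by rewrite -(@ltr_pXn2r _ 2) ?nnegrE // real_normK ?num_real.
have u0 x : 0 <= u x.
  rewrite -oppr_le0; apply: (@cvg_le_bound R nat \oo (fun n => - f n x) _ 0).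
    by apply: cvgN; exact: hu.
  by exists 0 => // n _ /=; rewrite oppr_le0.
have Hcvf n x (r : seq X) : uniq r -> \sum_(y <- r) b x y * f n y <= hdiag b q x * f n x - Hcc b q (f n) x.
  move=> ru; rewrite /Hcc opprB addrC subrK.
  apply: (@sum_le_rsum _ _ (fun y => b x y * f n y)) => //.
    by move=> y; rewrite mulr_ge0// graph_ge0.
  have [s su hs] := (CcP _).1 (CcW_Cc (sval_sub_mem (v n))).
  by apply: (@rsummable_finite _ _ _ s) => y /hs; rewrite -/(f n y) => ->; rewrite mulr0.
have cvr x (r : seq X) : (fun n => \sum_(y <- r) b x y * f n y) @ \oo -->
    \sum_(y <- r) b x y * u y.
  by apply: cvg_sum_seq => y; apply: cvgMl_tmp; exact: hu.
have uF : FX b u.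
  move=> x; have bu0 y : 0 <= b x y * u y by rewrite mulr_ge0// graph_ge0.
  apply/(esum_ltP (f := fun y => b x y * `|u y|)).
    by move=> y; rewrite mulr_ge0// graph_ge0.
  have [M hM] := Qdiff 1 ltr01.
  pose B := (1 + `|mu| / (lam - mu)) * (2 * Q (v M) (v M) + 8).
  exists (hdiag b q x * u x + (B + bform b q (indic R x) (indic R x))) => r ru.
  under eq_bigr do rewrite ger0_norm//.
  rewrite -lerBlDl.
  apply: (@cvg_le_bound R nat \oo (fun n => \sum_(y <- r) b x y * f n y - hdiag b q x * f n x)).
    by apply: cvgB => //; apply: cvgMl_tmp; exact: hu.
  exists M => // n Mn /=.
  have cfn : Cc (f n) by exact: CcW_Cc (sval_sub_mem (v n)).
  (* u has to be in F(X) at every vertex, also off W, where no variation is allowed. Positivity of h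
     at [f n] plus the indicator of x bounds - H (f n) at x uniformly in n instead. *)
  have hpos : 0 <= bform b q (f n) (f n) + 2 * Hcc b q (f n) x + bform b q (indic R x) (indic R x).
    pose a1 := to_sub (Cc_is_subspace R X) cfn.
    pose a2 := to_sub (Cc_is_subspace R X) (Cc_indic R x).
    have := hh (sval_sub_mem (a1 + a2)).
    rewrite hform_bform//; last exact: sval_sub_mem.
    have h := ccform_symbil q hb.
    have -> : bform b q (sval_sub (a1 + a2)) (sval_sub (a1 + a2)) =
      ccform b q (a1 + a2) (a1 + a2) by [].
    rewrite (symbilDl h) !(symbilDr h) (symbilC h a1 a2).
    have -> : ccform b q a2 a1 = Hcc b q (f n) x by exact: bform_indicl.
    have -> : ccform b q a1 a1 = bform b q (f n) (f n) by [].
    have -> : ccform b q a2 a2 = bform b q (indic R x) (indic R x) by [].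
    lra.
  have hB : bform b q (f n) (f n) <= B.
    have hQn : Q (v n) (v n) <= 2 * Q (v M) (v M) + 8.
      have := hM n M Mn (leqnn _).
      have := symbil_sqD_le hQ Q0 (v n - v M) (v M); rewrite subrK; lra.
    have -> : bform b q (f n) (f n) = Q (v n) (v n) + mu * N (v n) by rewrite QE /f /N; ring.
    have hN : N (v n) <= Q (v n) (v n) / (lam - mu) by rewrite ler_pdivlMr// mulrC.
    have h1 : mu * N (v n) <= `|mu| * N (v n) by apply: ler_wpM2r => //; exact: ler_norm.
    have h2 : `|mu| * N (v n) <= `|mu| * (Q (v n) (v n) / (lam - mu)) by apply: ler_wpM2l.
    have K0 : 0 <= 1 + `|mu| / (lam - mu) by rewrite addr_ge0// divr_ge0// ltW.
    have := ler_wpM2l K0 hQn; rewrite -/B; lra.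
  have B0 : 0 <= B + bform b q (indic R x) (indic R x).
    have i0 := hh (Cc_indic R x); rewrite (hform_bform q hb (Cc_indic R x)) in i0.
    have := hh cfn; rewrite hform_bform//; lra.
  by have := Hcvf n x r ru; lra.
have key x : W x -> rsum (fun y => b x y * u y) <= (hdiag b q x - mu * m x) * u x - g x * m x.
  move=> Wx; apply: rsum_le_bound.
    by move=> y; rewrite mulr_ge0// graph_ge0.
  move=> r ru; have deltaW : CcW W (indic R x).
    split; first exact: Cc_indic.
    by move=> y Wy; rewrite /indic; case: eqP => // yx; rewrite yx in Wy.
  pose delta : V := to_sub (CcW_is_subspace W) deltaW.
  apply/ler_addgt0Pr => e e0.
  (* The size of the variation: the quadratic term t^2 Q delta delta is at most t e, and n is taken
     so large that the defect of minimality is below t e; dividing by t leaves an error e. *)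
  pose t := e / (Q delta delta + 1).
  have Qd1 : 0 < Q delta delta + 1 by rewrite ltr_wpDl.
  have t0 : 0 < t by rewrite divr_gt0.
  have tQ : t * Q delta delta <= e.
    by rewrite /t mulrAC ler_pdivrMr// ler_pM2l// lerDl.
  clearbody t; rewrite -addrA -lerBlDl.
  apply: (@cvg_le_bound R nat \oo (fun n => \sum_(y <- r) b x y * f n y - (hdiag b q x - mu * m x) * f n x)).
    by apply: cvgB => //; apply: cvgMl_tmp; exact: hu.
  have [M hM] := invS_small (mulr_gt0 t0 e0); exists M => // n Mn /=.
  have h1 := lbJ (v n + t *: delta); have h2 := (hv n).1; have h3 := hM n Mn.
  move: h1; rewrite qfunD// (symbilZr hQ) (symbilZl hQ) (symbilZr hQ).
  have -> : l (t *: delta) = t * (g x * m x).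
    have -> : l (t *: delta) = t * l delta.
      have l0 : l 0 = 0.
        apply: (addrI (l 0)); rewrite addr0; apply/esym.
        by have := l_lin 1 0 0; rewrite scale1r addr0 mul1r.
      by have := l_lin t delta 0; rewrite addr0 l0 addr0.
    congr (_ * _); rewrite /l /l2dot (@rsum_finite _ _ _ [:: x])//.
      by rewrite big_seq1 /= /indic eqxx mulr1.
    by move=> y; rewrite inE => yx; rewrite /= /indic (negbTE yx) mulr0 mul0r.
  have -> : Q (v n) delta = Hcc b q (f n) x - mu * (f n x * m x).
    rewrite (symbilC hQ) QE bform_indicl; congr (_ - _ * _).
    rewrite /l2dot (@rsum_finite _ _ _ [:: x])//.
      by rewrite big_seq1 /= /indic eqxx mul1r.
    by move=> y; rewrite inE => yx; rewrite /= /indic (negbTE yx) mul0r mul0r.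
  move=> h1.
  have h4 : 0 <= t * (2 * (Hcc b q (f n) x - mu * (f n x * m x) - g x * m x) + t * Q delta delta + e).
    move: h1 h2 h3; move: (n.+1%:R^-1) (qfun Q l (v n)) (Q delta delta) (Hcc b q (f n) x) (f n x).
    by move=> d A B C F *; lra.
  rewrite pmulr_rge0// in h4.
  by have := Hcvf n x r ru; lra.
have buge0 x : 0 <= rsum (fun y => b x y * u y).
  by apply: rsum_ge0 => y; rewrite mulr_ge0// graph_ge0.
have gm x : 0 < g x * m x by rewrite mulr_gt0.
(* As g > 0, [key] fails at a zero of u in W. Thus u is positive on all of W, whether W is connected
   or not. *)
exists u; split=> // x Wx.
  rewrite lt_neqAle u0 andbT eq_sym; apply/eqP => ux.
  by have := key x Wx; have := buge0 x; have := gm x; rewrite ux; lra.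
by rewrite HopE// /Hcc; have := key x Wx; have := gm x; lra.
Qed.

End Minimiser.

End Existence.

(** Used with one ultrafilter finer than the eventuality filter, this gives limits at all vertices
    at once, in place of a diagonal subsequence. *)
Lemma ultra_bounded_cvg (R : realType) (T : Type) (G : set_system T) (f : T -> R)
    (A B : R) : UltraFilter G -> (forall t, A <= f t <= B) ->
  exists l : R, f t @[t --> G] --> l.
Proof.
move=> GU hf.
have fAB : G (f @^-1` [set` `[A, B]]).
  by apply: filterE => t /=; rewrite in_itv/= hf.
have [l [_ cl]] := @segment_compact R A B (f @ G) _ fAB.
exists l => N Nl.
have [//|GN] := in_ultra_setVsetC (f @^-1` N) GU.
by have [x [NCx Nx]] := cl (~` N) N GN Nl.
Qed.

Section Limit.
Variables (R : realType) (X : choiceType) (b : X -> X -> R) (q m : X -> R).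
Hypothesis hb : is_graph b.
Hypothesis hm : forall x, 0 < m x.
Hypothesis hconn : connected_graph b.

(** Normalisation at x0 excludes the limit 0, and chaining the inequality along paths bounds the
    functions at each vertex. Superharmonicity is kept as an inequality for finite sums, a form that
    passes to pointwise limits. *)
Lemma superharmonic_limit (l : R) (x0 : X) :
  (forall mu, mu < l -> exists u : X -> R,
    [/\ FX b u, forall x, 0 <= u x, forall x, 0 < u x &
        forall x, 0 <= Hop b q u x - mu * m x * u x]) ->
  op_ge0_on b q m l setT.
Proof.
move=> hl.
have inv0 n : 0 < n.+1%:R^-1 :> R by rewrite invr_gt0.
have /choice[v hv] : forall n : nat, exists v : X -> R,
    [/\ forall x, 0 <= v x, v x0 = 1 & forall x (r : seq X), uniq r ->
        \sum_(y <- r) b x y * v y <= (hdiag b q x - (l - n.+1%:R^-1) * m x) * v x].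
  move=> n; have [|u [uF u0 up hu]] := hl (l - n.+1%:R^-1).
    by rewrite gtrBl.
  exists (fun x => u x / u x0); split.
  - by move=> x; rewrite divr_ge0.
  - by rewrite divff// gt_eqF.
  move=> x r ru; under eq_bigr do rewrite mulrA.
  rewrite -mulr_suml mulrA ler_pM2r ?invr_gt0//.
  have bu0 y : 0 <= b x y * u y by rewrite mulr_ge0// graph_ge0.
  have := sum_le_rsum bu0 (FX_summable hb x uF) ru.
  by have := hu x; rewrite HopE// /Hcc; move: (n.+1%:R^-1) => d; lra.
have nx n : n.+1%:R^-1 <= 1 :> R by rewrite invf_le1// ler1n.
have harnack y : exists C, forall n, v n y <= C.
  have [p [pth <- _]] := hconn x0 y.
  have : exists C, forall n, v n x0 <= C by exists 1 => n; have [_ ->] := hv n.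
  elim: p (x0) pth => [|z p IH] x //= /andP[bxz pth] [C hC]; apply: IH => //.
  (* From the inequality at x for the single neighbour z. The 1 added to |l| bounds 1 / (n + 1),
     which makes the constant independent of n. *)
  exists ((`|hdiag b q x| + (`|l| + 1) * m x) * C / b x z) => n.
  have [v0 _ hr] := hv n; have := hr x [:: z] isT; rewrite big_seq1 => h.
  rewrite ler_pdivlMr// mulrC; apply: (le_trans h).
  have c0 : 0 <= `|hdiag b q x| + (`|l| + 1) * m x.
    by apply: addr_ge0 => //; apply: mulr_ge0; [exact: addr_ge0|exact: ltW].
  apply: (@le_trans _ _ ((`|hdiag b q x| + (`|l| + 1) * m x) * v n x)); last exact: ler_wpM2l.
  apply: ler_wpM2r => //; apply: lerD; first exact: ler_norm.
  rewrite -mulNr ler_pM2r//.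
  have := nx n; have := ler_norm (- l); rewrite normrN; move: (n.+1%:R^-1) => d; lra.
have [G [GU oG]] := ultraFilterLemma eventually_filter.
have /choice[u hu] : forall x, exists c : R, v n x @[n --> G] --> c.
  move=> x; have [C hC] := harnack x; apply: (@ultra_bounded_cvg R nat G _ 0 C GU) => n.
  by rewrite hC andbT; have [h _ _] := hv n.
have cinv : (n.+1%:R^-1 : R) @[n --> G] --> (0 : R).
  apply: (@cvg_trans _ ((fun n => n.+1%:R^-1 : R) @ \oo)); last exact: cvg_harmonic.
  by move=> A; exact: oG.
have u0 x : 0 <= u x.
  rewrite -oppr_le0; apply: (@cvg_le_bound R nat G (fun n => - v n x) _ 0).
    by apply: cvgN; exact: hu.
  by apply: filterE => n; rewrite oppr_le0; have [h _ _] := hv n.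
have ux0 : u x0 = 1.
  apply/le_anti/andP; split.
    by apply: (@cvg_le_bound R nat G (fun n => v n x0) _ 1 _ (hu x0)); apply: filterE => n; have [_ -> _] := hv n.
  rewrite -lerN2; apply: (@cvg_le_bound R nat G (fun n => - v n x0)).
    by apply: cvgN; exact: hu.
  by apply: filterE => n; have [_ -> _] := hv n.
have key x (r : seq X) : uniq r -> \sum_(y <- r) b x y * u y <= (hdiag b q x - l * m x) * u x.
  move=> ru; rewrite -subr_le0.
  apply: (@cvg_le_bound R nat G (fun n => \sum_(y <- r) b x y * v n y -
     (hdiag b q x - (l - n.+1%:R^-1) * m x) * v n x) _ 0).
    apply: cvgB; first by apply: cvg_sum_seq => y; apply: cvgMl_tmp; exact: hu.
    apply: cvgM => //; apply: cvgB; first exact: cvg_cst.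
    apply: cvgMr_tmp; rewrite -[l in X in _ --> X]subr0.
    by apply: cvgB => //; exact: cvg_cst.
  by apply: filterE => n; rewrite subr_le0; have [_ _ h] := hv n; exact: h.
have bu0 x y : 0 <= b x y * u y by rewrite mulr_ge0// graph_ge0.
have uF : FX b u.
  move=> x; apply/(esum_ltP (f := fun y => b x y * `|u y|)).
    by move=> y; rewrite mulr_ge0// graph_ge0.
  exists ((hdiag b q x - l * m x) * u x) => r ru.
  by under eq_bigr do rewrite ger0_norm//; exact: key.
exists u; split; last first.
  by split=> //; exists x0 => //; rewrite ux0 oner_eq0.
split=> // x _; rewrite HopE// /Hcc.
have : rsum (fun y => b x y * u y) <= (hdiag b q x - l * m x) * u x.
  by apply: rsum_le_bound => // r ru; exact: key.
lra.
Qed.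

End Limit.

(** * Closability *)

Section Closability.
Variables (R : realType) (X : choiceType) (b : X -> X -> R) (q m : X -> R).
Hypothesis hb : is_graph b.
Hypothesis hconn : connected_graph b.
Hypothesis hm : forall x, 0 < m x.
Hypothesis hh : form_ge0 b q.

Definition core : lmodType R := subspace (Cc_is_subspace R X).
Definition core_incl : {linear core -> l2space hm} :=
  incl_sub (hS := Cc_is_subspace R X) (l2_is_subspace hm) (Cc_l2 hm).

Lemma ccform_ge0 (u : core) : 0 <= ccform b q u u.
Proof. by rewrite /ccform -hform_bform//; [exact: hh (sval_sub_mem u)|exact: sval_sub_mem]. Qed.

(** Tails decrease when the list grows, so the union of lists for the single vertices works for all
    of s. *)
Lemma tail_uniform (u : X -> R) (s : seq X) (e : R) : FX b u -> (forall x, 0 <= u x) ->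
  0 < e -> exists r, [/\ uniq r, {subset s <= r} & forall x, x \in s -> gs_tail b u r x <= e].
Proof.
move=> uF u0 e0.
have bu0 x y : 0 <= b x y * u y by rewrite mulr_ge0// graph_ge0.
have mono r r' x : uniq r -> uniq r' -> {subset r <= r'} -> gs_tail b u r' x <= gs_tail b u r x.
  by move=> ru ru' rr'; rewrite /gs_tail lerD2l lerN2; exact: sum_subset_le.
elim: s => [|x s [r [ru sr hr]]]; first by exists [::].
have [t [tu ht]] := rsummable_tail (bu0 x) (FX_summable hb x uF) e0.
exists (undup (x :: t ++ r)); split; first exact: undup_uniq.
  move=> y; rewrite mem_undup !in_cons mem_cat => /orP[->//|/sr ->].
  by rewrite !orbT.
have ur : uniq (undup (x :: t ++ r)) by exact: undup_uniq.
move=> y; rewrite in_cons => /orP[/eqP ->|ys]; last first.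
  apply: le_trans (hr y ys); apply: mono => // z zr.
  by rewrite mem_undup in_cons mem_cat zr !orbT.
apply: (@le_trans _ _ (gs_tail b u t x)).
  by apply: mono => // z zt; rewrite mem_undup in_cons mem_cat zt !orbT.
rewrite /gs_tail lerBlDl; apply: rsum_le_bound => // s' su'.
rewrite (bigID (mem t))/=; apply: lerD.
  rewrite -big_filter; apply: sum_subset_le => //; first exact: filter_uniq.
  by move=> z; rewrite mem_filter => /andP[].
rewrite -big_filter; apply: ltW; apply: ht; first exact: filter_uniq.
by move=> z; rewrite mem_filter => /andP[].
Qed.

(* As q may be negative, Fatou's lemma does not apply to hform directly; it is
   replaced by the monotone approximation of the ground state representation with
   respect to a positive (-1)-superharmonic function. *)
Lemma hform_lsc (phi : X -> R) (psi : nat -> X -> R) (e : R) : 0 < e ->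
  Cc phi -> (forall k, Cc (psi k)) -> (forall x, (fun k => psi k x) @ \oo --> phi x) ->
  exists N : nat, forall k, (N <= k)%N ->
    bform b q phi phi + l2dot m phi phi <= bform b q (psi k) (psi k) + l2dot m (psi k) (psi k) + e.
Proof.
move=> e0 cphi cpsi hcv.
have [g [g0 gl2]] := positive_l2 hm (connected_countable hb hconn).
have hT phi' : CcW setT phi' -> 0 * l2dot m phi' phi' <= hform b q phi'.
  by move=> [c _]; rewrite mul0r; exact: hh.
(* h >= 0 is a lower bound with lam = 0, so mu = -1 is strictly below it; this is why the squared
   l^2 norm is added to h in the statement. *)
have [|u [uF u0 up usup]] := @strict_superharmonic R X b q m hb hm hh setT 0 (-1) g _ hT g0 gl2.
  by rewrite ltrN10.
have {}up x : 0 < u x by exact: up.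
have hp x : 0 <= gs_pot b q m (-1) u x by apply: gs_pot_ge0 => //; exact: usup.
have [s su hs] := (CcP _).1 cphi.
pose B := \sum_(x <- s) phi x ^+ 2 / u x.
have B0 : 0 <= B by apply: sumr_ge0 => x _; rewrite divr_ge0// ?sqr_ge0.
have e1 : 0 < e / (2 * (B + 1)) by rewrite divr_gt0// mulr_gt0// ltr_wpDl.
have [r [ru sr hr]] := tail_uniform s uF u0 e1.
have hphir x : x \notin r -> phi x = 0.
  by move=> xr; apply: hs; apply: contra xr; exact: sr.
have E (f : X -> R) : bform b q f f + l2dot m f f = bform b q f f - (-1) * l2dot m f f.
  by rewrite mulN1r opprK.
have cgs : (fun k => gs_form b q m (-1) u r (psi k)) @ \oo --> gs_form b q m (-1) u r phi.
  apply: cvgD.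
    by apply: cvg_sum_seq => x; apply: cvgMl_tmp; apply: cvgM; exact: hcv.
  apply: cvgMl_tmp; apply: cvg_sum_seq => x; apply: cvg_sum_seq => y.
  apply: cvgMl_tmp.
  have h : (fun k => psi k x / u x - psi k y / u y) @ \oo --> phi x / u x - phi y / u y.
    by apply: cvgB; apply: cvgMr_tmp; exact: hcv.
  by apply: cvgM.
have e2 : 0 < e / 2 by rewrite divr_gt0.
have [N hN] := (cvg_epsP _ _).1 cgs _ e2; exists N => k /hN {}hN.
rewrite !E (ground_state q m hb (-1) (u := u) ru hphir)//.
have [t tu ht] := (CcP _).1 (cpsi k).
(* The support of [psi k] may grow with k, and convergence is only known on the fixed list r.
   Monotonicity of [gs_form] discards the rest of w with the right sign. *)
pose w := undup (r ++ t); have wu : uniq w by exact: undup_uniq.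
have htw x : x \notin w -> psi k x = 0.
  by rewrite mem_undup mem_cat negb_or => /andP[_ /ht].
rewrite (ground_state q m hb (-1) (u := u) wu htw)//.
have h1 : gs_form b q m (-1) u r (psi k) <= gs_form b q m (-1) u w (psi k).
  by apply: gs_form_subset => // x xr; rewrite mem_undup mem_cat xr.
have h2 := tails_ge0 hb uF u0 (s := w) (psi k) wu.
have h3 : \sum_(x <- r) phi x ^+ 2 / u x * gs_tail b u r x <= e / 2.
  rewrite -(@sum_supset _ _ _ s r su ru)//; last by move=> x /hs ->; rewrite expr0n !mul0r.
  apply: (@le_trans _ _ (B * (e / (2 * (B + 1))))).
    rewrite /B mulr_suml big_seq [leRHS]big_seq; apply: ler_sum => x xs.
    by apply: ler_wpM2l; [rewrite divr_ge0// sqr_ge0|exact: hr].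
  rewrite mulrA ler_pdivrMr ?mulr_gt0 ?ltr_wpDl//.
  have := mulr_ge0 B0 (ltW e0); lra.
have h4 : gs_form b q m (-1) u r phi <= gs_form b q m (-1) u r (psi k) + e / 2.
  have := ler_norm (gs_form b q m (-1) u r phi - gs_form b q m (-1) u r (psi k)).
  by rewrite distrC in hN; lra.
lra.
Qed.

(** For fixed n, phi n - phi k tends pointwise to phi n as k grows. Lower semicontinuity bounds h
    (phi n) by h (phi n - phi k) and l^2 terms, all small by the two parts of [approx]. *)
Lemma ccform_closable (phi : nat -> core) :
  approx core_incl (l2d (hm := hm)) (ccform b q) 0 phi ->
  (fun n => ccform b q (phi n) (phi n)) @ \oo --> (0 : R).
Proof.
move=> [h1 h2]; apply/cvg_epsP => e e0.
have e8 : 0 < e / 8 by rewrite divr_gt0.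
have [N hN] := h1 _ e8; have [M hM] := h2 _ e8.
exists (maxn N M) => n; rewrite geq_max => /andP[Nn Mn].
rewrite subr0 ger0_norm ?ccform_ge0//.
have l0 k : (N <= k)%N -> l2dot m (sval_sub (phi k)) (sval_sub (phi k)) < e / 8.
  move=> /hN; rewrite sub0r (symbilNl (l2d_symbil hm)) (symbilNr (l2d_symbil hm)) opprK.
  exact.
have [|||K hK] := @hform_lsc (sval_sub (phi n)) (fun k => sval_sub (phi n - phi k)) (e / 8) e8.
- exact: sval_sub_mem.
- by move=> k; exact: sval_sub_mem.
- move=> x; apply/cvg_epsP => d d0.
  have d1 : 0 < d ^+ 2 * m x by rewrite mulr_gt0// exprn_gt0.
  have [N' hN'] := h1 _ d1; exists N' => k /hN'.
  rewrite sub0r (symbilNl (l2d_symbil hm)) (symbilNr (l2d_symbil hm)) opprK => hk.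
  rewrite sval_subB.
  have -> : (sval_sub (phi n) - sval_sub (phi k)) x - sval_sub (phi n) x = - sval_sub (phi k) x.
    by rewrite -[(_ - _) x]/(sval_sub (phi n) x - sval_sub (phi k) x); ring.
  have := le_lt_trans (pointwise_le_l2dot hm x (sval_sub_mem (core_incl (phi k)))) hk.
  rewrite ltr_pM2r// normrN => h; have d0' := ltW d0.
  by rewrite -(@ltr_pXn2r _ 2) ?nnegrE // real_normK ?num_real.
pose k := maxn K (maxn N M).
have := hK k (leq_maxl _ _).
have Nk : (N <= k)%N by rewrite /k !leq_max leqnn !orbT.
have Mk : (M <= k)%N by rewrite /k !leq_max leqnn !orbT.
have h3 := hM n k Mn Mk.
have h4 : l2dot m (sval_sub (phi n - phi k)) (sval_sub (phi n - phi k)) <= 4 * (e / 8).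
  have -> : l2dot m (sval_sub (phi n - phi k)) (sval_sub (phi n - phi k)) =
    l2d (hm := hm) (core_incl (phi n) - core_incl (phi k)) (core_incl (phi n) - core_incl (phi k)).
    by rewrite -linearB.
  apply: (le_trans (symbil_sqB_le (l2d_symbil hm) (l2d_ge0 (hm := hm)) _ _)).
  have := l0 n Nn; have := l0 k Nk.
  rewrite -[l2dot m (sval_sub (phi n)) _]/(l2d (hm := hm) (core_incl (phi n)) (core_incl (phi n))).
  rewrite -[l2dot m (sval_sub (phi k)) _]/(l2d (hm := hm) (core_incl (phi k)) (core_incl (phi k))).
  lra.
have := l2dot_ge0 hm (sval_sub (phi n)).
by rewrite /ccform in h3 *; lra.
Qed.

Lemma l2space_complete (x : nat -> l2space hm) : sq_cauchy (l2d (hm := hm)) x ->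
  exists y, sq_cvg (l2d (hm := hm)) x y.
Proof.
move=> hx.
have [|e e0|g [gl2 _ hg]] := @l2_complete R X m hm (fun n => sval_sub (x n)).
- by move=> n; exact: sval_sub_mem.
- have [N hN] := hx e e0; exists N => n k Nn Nk.
  have := hN n k Nn Nk; rewrite /l2d sval_subB; exact.
exists (to_sub (l2_is_subspace hm) gl2) => e e0.
have [N hN] := hg e e0; exists N => n /hN h.
rewrite -opprB (symbilNl (l2d_symbil hm)) (symbilNr (l2d_symbil hm)) opprK.
by rewrite /l2d sval_subB.
Qed.

End Closability.

(** * The operator H^(m) *)

Section Spectrum.
Variables (R : realType) (X : choiceType) (b : X -> X -> R) (q m : X -> R).
Hypothesis hb : is_graph b.
Hypothesis hconn : connected_graph b.
Hypothesis hm : forall x, 0 < m x.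
Hypothesis hh : form_ge0 b q.

Local Notation L := (l2space hm).
Local Notation C := (core R X).
Local Notation j := (core_incl hm).
Local Notation dot := (l2d (hm := hm)).
Local Notation cform := (ccform b q).

Definition hm_dom : lmodType R :=
  form_space j (l2d_symbil hm) (l2d_ge0 (hm := hm)) (ccform_symbil q hb) (ccform_ge0 hb hh).
Definition hm_incl : {linear hm_dom -> L} :=
  fincl j (l2d_symbil hm) (l2d_ge0 (hm := hm)) (ccform_symbil q hb) (ccform_ge0 hb hh).
Definition hm_form : hm_dom -> hm_dom -> R :=
  @fbil R C L j dot cform (l2d_symbil hm) (l2d_ge0 (hm := hm)) (ccform_symbil q hb) (ccform_ge0 hb hh).
Definition hm_core : C -> hm_dom :=
  of_core j (l2d_symbil hm) (l2d_ge0 (hm := hm)) (ccform_symbil q hb) (ccform_ge0 hb hh).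

Local Notation form_op := (form_op hm_incl dot hm_form).
Local Notation form_res := (form_res hm_incl dot hm_form).
Local Notation form_ker := (form_ker hm_incl dot hm_form).
Local Notation form_good := (form_good hm_incl dot hm_form).

Let closable := ccform_closable hb hconn (hm := hm) hh.

Lemma hm_form_symbil : symbil hm_form.
Proof. exact: fbil_symbil. Qed.

Lemma hm_form_ge0 v : 0 <= hm_form v v.
Proof. exact: fbil_ge0. Qed.

Lemma hm_complete : form_complete hm_incl dot hm_form.
Proof. by apply: fbil_complete => //; exact: l2space_complete. Qed.

Lemma hm_form_core x : hm_form (hm_core x) (hm_core x) = cform x x.
Proof. exact: fbil_of_core. Qed.

Lemma form_approxP (u : L) (phi : nat -> C) :
  form_approx b q m (sval_sub u) (fun n => sval_sub (phi n)) <-> approx j dot cform u phi.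
Proof.
have E n : l2norm m (sval_sub u \- sval_sub (phi n)) =
    Num.sqrt (dot (u - j (phi n)) (u - j (phi n))).
  by rewrite /l2norm /l2d sval_subB.
have F n k : hform b q (sval_sub (phi n) \- sval_sub (phi k)) = cform (phi n - phi k) (phi n - phi k).
  have -> : sval_sub (phi n) \- sval_sub (phi k) = sval_sub (phi n - phi k) by rewrite sval_subB.
  by rewrite hform_bform//; exact: sval_sub_mem.
split=> [[_ h1 h2]|[h1 h2]].
  split=> e e0; last first.
    by have [N hN] := h2 e e0; exists N => n k Nn Nk; rewrite -F; exact: hN.
  have s0 : 0 < Num.sqrt e by rewrite sqrtr_gt0.
  have [N hN] := (cvg_epsP _ _).1 h1 _ s0; exists N => n /hN.
  rewrite E subr0 ger0_norm ?sqrtr_ge0// ltr_sqrt//.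
split=> [n||e e0].
- exact: sval_sub_mem.
- apply/cvg_epsP => e e0; have e2 : 0 < e ^+ 2 by rewrite exprn_gt0.
  have [N hN] := h1 _ e2; exists N => n /hN hn.
  rewrite E subr0 ger0_norm ?sqrtr_ge0// -[ltRHS]ger0_norm ?ltW// -sqrtr_sqr.
  by rewrite ltr_sqrt.
by have [N hN] := h2 e e0; exists N => n k Nn Nk; rewrite F; exact: hN.
Qed.

Lemma form_approx_lift (f : X -> R) (phi : nat -> X -> R) : form_approx b q m f phi ->
  exists psi : nat -> C, phi = fun n => sval_sub (psi n).
Proof.
move=> [h _ _]; exists (fun n => to_sub (Cc_is_subspace R X) (h n)).
by apply/funext => n.
Qed.

Lemma closed_form_domP (f : X -> R) :
  closed_form_dom b q m f <-> exists v : hm_dom, sval_sub (hm_incl v) = f.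
Proof.
split=> [[fl2 [phi hphi]]|[v <-]].
  have [psi phiE] := form_approx_lift hphi; rewrite phiE in hphi.
  have hpsi := (form_approxP (to_sub (l2_is_subspace hm) fl2) psi).1 hphi.
  have hD : form_dom j dot cform (to_sub (l2_is_subspace hm) fl2) by exists psi.
  by exists (to_sub (form_dom_is_subspace j (l2d_symbil hm) (l2d_ge0 (hm := hm))
    (ccform_symbil q hb) (ccform_ge0 hb hh)) hD).
split; first exact: sval_sub_mem.
have [psi hpsi] := sval_sub_mem v; exists (fun n => sval_sub (psi n)).
exact: (form_approxP (hm_incl v) psi).2.
Qed.

Lemma closed_formE (u : L) : closed_form b q m (sval_sub u) = closure_sq j dot cform u.
Proof.
rewrite /closed_form /closure_sq; congr (xget 0); apply/seteqP.
have E (psi : nat -> C) : (fun n => hform b q (sval_sub (psi n))) = (fun n => cform (psi n) (psi n)).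
  by apply/funext => n; rewrite hform_bform//; exact: sval_sub_mem.
split=> l [phi hphi cl].
  have [psi phiE] := form_approx_lift hphi; rewrite phiE in hphi cl.
  by exists psi; [exact/form_approxP|rewrite -E].
by exists (fun n => sval_sub (phi n)); [exact/form_approxP|rewrite E].
Qed.

Lemma closed_bilinE (v w : hm_dom) :
  closed_bilin b q m (sval_sub (hm_incl v)) (sval_sub (hm_incl w)) = hm_form v w.
Proof.
rewrite /closed_bilin.
have -> : sval_sub (hm_incl v) \+ sval_sub (hm_incl w) = sval_sub (hm_incl v + hm_incl w).
  by rewrite sval_subD.
have -> : sval_sub (hm_incl v) \- sval_sub (hm_incl w) = sval_sub (hm_incl v - hm_incl w).
  by rewrite sval_subB.
by rewrite !closed_formE.
Qed.

Lemma HmP (f g : X -> R) : Hm b q m f g <-> exists (v : hm_dom) (w : L),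
  [/\ sval_sub (hm_incl v) = f, sval_sub w = g & form_op v w].
Proof.
split=> [[/closed_form_domP[v <-] gl2 h]|[v [w [<- <- h]]]].
  exists v, (to_sub (l2_is_subspace hm) gl2); split=> // z.
  rewrite -closed_bilinE; apply: h; apply/closed_form_domP; by exists z.
split; [by apply/closed_form_domP; exists v|exact: sval_sub_mem|].
by move=> _ /closed_form_domP[z <-]; rewrite closed_bilinE h.
Qed.

Lemma hm_incl_inj : injective hm_incl.
Proof. exact: sval_sub_inj. Qed.

Lemma sval_lin (g : L) (lam : R) (v : hm_dom) :
  sval_sub g \+ (fun x => lam * sval_sub (hm_incl v) x) = sval_sub (g + lam *: hm_incl v).
Proof. by rewrite sval_subD sval_subZ. Qed.

Lemma l2normE (u : L) : l2norm m (sval_sub u) = Num.sqrt (dot u u).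
Proof. by []. Qed.

Lemma resolvent_setP (lam : R) : resolvent_set m (Hm b q m) lam <-> form_res lam.
Proof.
split=> [[h1 [K hK]]|[h1 [K K0 hK]]].
  split.
    move=> g; have [f [hf _]] := h1 _ (sval_sub_mem g).
    have [v [w [vf wf hv]]] := (HmP _ _).1 hf.
    exists v; rewrite -vf sval_lin in wf.
    by rewrite -(sval_sub_inj wf).
  exists (`|K| + 1); first by rewrite ltr_wpDl.
  move=> v g hv.
  have hT : Hm b q m (sval_sub (hm_incl v)) (sval_sub (g + lam *: hm_incl v)).
    by apply/HmP; exists v, (g + lam *: hm_incl v).
  have := hK _ _ hT; rewrite -sval_lin.
  have -> : (sval_sub g \+ (fun x => lam * sval_sub (hm_incl v) x)) \-
    (fun x => lam * sval_sub (hm_incl v) x) = sval_sub g by apply/funext => x /=; rewrite addrK.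
  rewrite !l2normE => h.
  have h2 : Num.sqrt (dot (hm_incl v) (hm_incl v)) <= (`|K| + 1) * Num.sqrt (dot g g).
    apply: (le_trans h); apply: ler_wpM2r; first exact: sqrtr_ge0.
    by rewrite (le_trans (ler_norm _))// lerDl.
  rewrite -[leLHS]sqr_sqrtr ?l2d_ge0// -[X in _ * X]sqr_sqrtr ?l2d_ge0// -exprMn.
  by rewrite !expr2; apply: ler_pM => //; exact: sqrtr_ge0.
split.
  move=> g gl2; have [v hv] := h1 (to_sub (l2_is_subspace hm) gl2).
  have gE : g = sval_sub (to_sub (l2_is_subspace hm) gl2) by [].
  exists (sval_sub (hm_incl v)); split.
    by rewrite gE sval_lin; apply/HmP; exists v, (to_sub (l2_is_subspace hm) gl2 + lam *: hm_incl v).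
  move=> f hf; have [v' [w' [v'f w'f hv']]] := (HmP _ _).1 hf.
  rewrite -v'f gE sval_lin in w'f; have {}w'f := sval_sub_inj w'f.
  rewrite -v'f; congr (sval_sub (hm_incl _)).
  have hd : form_op (v - v') (0 + lam *: hm_incl (v - v')).
    move=> z; have := hv z; have := hv' z; rewrite w'f !(symbilE hm_form_symbil) => -> ->.
    by rewrite [hm_incl (v - v')]linearB !(symbilE (l2d_symbil hm)) (symbil0l (l2d_symbil hm)); ring.
  have := hK _ _ hd; rewrite (symbil0l (l2d_symbil hm)) mulr0 => h0.
  have /l2d_eq0 : dot (hm_incl (v - v')) (hm_incl (v - v')) = 0.
    by apply/le_anti; rewrite h0 l2d_ge0.
  by rewrite linearB => /eqP; rewrite subr_eq0 => /eqP/hm_incl_inj.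
exists K => f g /HmP[v [w [<- <- hv]]].
have hv' : form_op v ((w - lam *: hm_incl v) + lam *: hm_incl v) by rewrite subrK.
have -> : sval_sub w \- (fun x => lam * sval_sub (hm_incl v) x) = sval_sub (w - lam *: hm_incl v).
  by rewrite sval_subB sval_subZ.
rewrite !l2normE; have := hK _ _ hv'.
set A := dot _ _; set B := dot _ _ => h.
have A0 : 0 <= A by exact: l2d_ge0.
have B0 : 0 <= B by exact: l2d_ge0.
rewrite -[leLHS]ger0_norm ?sqrtr_ge0//; apply: norm_le_of_sqr.
  by apply: mulr_ge0; [exact: ltW|exact: sqrtr_ge0].
by rewrite exprMn !sqr_sqrtr.
Qed.

Lemma spectrumP (lam : R) : spectrum m (Hm b q m) lam <-> ~ form_res lam.
Proof. by rewrite /spectrum/=; split=> h h'; apply: h; apply/resolvent_setP. Qed.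

Lemma eigenspaceP (lam : R) (f : X -> R) : Defs.eigenspace (Hm b q m) lam f <->
  exists2 h : L, form_ker lam h & sval_sub h = f.
Proof.
split=> [/HmP[v [w [vf wf hv]]]|[_ [v <- hv] <-]].
  exists (hm_incl v) => //; exists v => //.
  suff <- : w = lam *: hm_incl v by [].
  by apply: sval_sub_inj; rewrite sval_subZ vf wf.
by apply/HmP; exists v, (lam *: hm_incl v); rewrite sval_subZ.
Qed.

Lemma form_lower lam : (forall x : C, lam * dot (j x) (j x) <= cform x x) ->
  forall v, lam * dot (hm_incl v) (hm_incl v) <= hm_form v v.
Proof.
move=> h v; have := fbil_lower (hdot := l2d_symbil hm) (dot_ge0 := l2d_ge0 (hm := hm))
  (hc := ccform_symbil q hb) (c_ge0 := ccform_ge0 hb hh) closable (lam := lam) (K := 0) (es := [::]).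
by move=> /(_ _ v); rewrite mul0r addr0; apply=> x; rewrite mul0r addr0.
Qed.

Lemma cform_hform (x : C) : cform x x = hform b q (sval_sub x).
Proof. by rewrite hform_bform//; exact: sval_sub_mem. Qed.

Lemma superharmonic_lower lam : op_ge0_on b q m lam setT ->
  forall x : C, lam * dot (j x) (j x) <= cform x x.
Proof.
move=> [u [[uF usup] [u0 [x0 _ ux0]]]] x; rewrite cform_hform.
have up y : setT y -> 0 < u y.
  move=> _; apply: (positive_on_component hb uF u0 (W := setT)) => //.
    by move=> z Tz; exact: usup.
  by split=> //; exists x0.
apply: (allegretto_piepenbrink hb uF u0 up usup (sval_sub_mem x)).
by move=> y ny; case: ny.
Qed.

Lemma lower_spectrum lam s : (forall x : C, lam * dot (j x) (j x) <= cform x x) ->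
  spectrum m (Hm b q m) s -> lam <= s.
Proof.
move=> h /spectrumP hs; rewrite leNgt; apply/negP => slam; apply: hs.
apply: (coercive_res (l2d_symbil hm) (l2d_ge0 (hm := hm)) hm_form_symbil hm_complete
  hm_form_ge0 (form_lower h) slam).
Qed.

Lemma superharmonic_exists (W : set X) lam mu : mu < lam ->
  (forall phi, CcW W phi -> lam * l2dot m phi phi <= hform b q phi) ->
  exists u : X -> R,
  [/\ FX b u, forall x, 0 <= u x, forall x, W x -> 0 < u x &
      forall x, W x -> 0 <= Hop b q u x - mu * m x * u x].
Proof.
move=> mulam h; have [g [g0 gl2]] := positive_l2 hm (connected_countable hb hconn).
exact: strict_superharmonic mulam h g0 gl2.
Qed.

Lemma bottom_attained (x0 : X) : exists l : R,
  [/\ spectrum m (Hm b q m) l,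
      forall s, spectrum m (Hm b q m) s -> l <= s &
      op_ge0_on b q m l setT].
Proof.
pose S := [set lam : R | forall x : C, lam * dot (j x) (j x) <= cform x x].
pose d0 : C := to_sub (Cc_is_subspace R X) (Cc_indic R x0).
have N0 : 0 < dot (j d0) (j d0).
  rewrite /l2d (@l2dot_finite _ _ m _ _ [:: x0])//; last first.
    by move=> x xs; apply: indic_out xs; rewrite mem_head.
  by rewrite big_seq1 /= /indic eqxx !mul1r.
have supS : has_sup S.
  split; first by exists 0 => x; rewrite mul0r ccform_ge0.
  exists (cform d0 d0 / dot (j d0) (j d0)) => lam /(_ d0).
  by rewrite ler_pdivlMr.
pose l := sup S.
have lS : S l.
  move=> x; apply/ler_addgt0Pr => e e0.
  have n1 : 0 < dot (j x) (j x) + 1 by rewrite ltr_wpDl// l2d_ge0.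
  have [lam hlam hl] := sup_adherent (divr_gt0 e0 n1) supS.
  have h1 := hlam x; have h2 := l2d_ge0 (j x).
  have h3 : e / (dot (j x) (j x) + 1) * dot (j x) (j x) <= e.
    by rewrite mulrAC ler_pdivrMr// ler_pM2l// lerDl.
  have h4 : l * dot (j x) (j x) <= (lam + e / (dot (j x) (j x) + 1)) * dot (j x) (j x).
    by apply: ler_wpM2r => //; rewrite -lerBlDr ltW.
  lra.
exists l; split.
(* If l were in the resolvent set, [form_good_step] with empty lists and eta = 0 would give the
   lower bound l + K^-1, with [es'] empty and so without correction, beyond the supremum. *)
- apply/spectrumP => hres; have [_ [K K0 hK]] := hres.
  have ho : orthonormal dot ([::] : seq L) by split.
  have [||K' _ [es' es'0 hes']] := form_good_step (l2d_symbil hm) (l2d_ge0 (hm := hm))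
      hm_form_symbil (es := [::]) ho K0 (lexx 0) (lexx 0) hres.
  + by move=> f g h _; exact: hK.
  + by move=> f; rewrite subr0 mul0r addr0; exact: form_lower.
  have : l + K^-1 <= l.
    apply: ub_le_sup; first exact: supS.2.
    move=> x; have := hes' (hm_core x).
    by rewrite es'0// big_nil !mulr0 addr0 subr0 hm_form_core.
  by rewrite gerDl leNgt invr_gt0 K0.
- by move=> s; exact: lower_spectrum.
apply: (superharmonic_limit hb hm hconn x0) => mu mul.
have [|u [uF u0 up usup]] := @superharmonic_exists setT l mu mul.
  move=> phi [cphi _]; have := lS (to_sub (Cc_is_subspace R X) cphi).
  by rewrite cform_hform.
by exists u; split=> // x; [exact: up|exact: usup].
Qed.

Definition cdelta (x : X) : C := to_sub (Cc_is_subspace R X) (Cc_indic R x).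

Lemma sval_sum_cdelta (f : X -> R) (r : seq X) (y : X) :
  sval_sub (\sum_(k <- r) f k *: cdelta k) y = \sum_(k <- r) f k * indic R k y.
Proof.
elim: r => [|k r IH]; first by rewrite !big_nil sval_sub0.
by rewrite !big_cons sval_subP lincombE IH.
Qed.

(** x is cut into xK on r and xW off r. The two parts need not be orthogonal for h, so weighted
    squares separate them; all terms in xK are controlled by the finitely many values of x on r. *)
Lemma good_of_outside (r : seq X) lam s : uniq r ->
  (forall phi, CcW (~` [set` r]) phi -> lam * l2dot m phi phi <= hform b q phi) ->
  s < lam -> exists2 mu, s < mu & form_good mu.
Proof.
move=> ru h slam.
have [s0|s0] := ltP s 0.
  exists 0 => //; exists 0 => //; exists [::] => v.
  by rewrite !mul0r addr0 hm_form_ge0.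
have lam0 : 0 < lam by exact: le_lt_trans slam.
(* Chosen so that mu = lam (1 - 2 eps) is the midpoint of s and lam; mu (1 + eps)^2 <= lam then
   absorbs the factors 1 + eps of both [h2] and [h3]. *)
pose eps := (lam - s) / (4 * lam).
have eps0 : 0 < eps by rewrite divr_gt0 ?subr_gt0 ?mulr_gt0.
have eps1 : eps <= 1.
  by rewrite ler_pdivrMr ?mulr_gt0// mul1r; lra.
pose mu := lam * (1 - 2 * eps).
have muE : mu = (lam + s) / 2 by rewrite /mu /eps; field; rewrite gt_eqF.
have mu0 : 0 <= mu by rewrite muE; lra.
exists mu; first by rewrite muE; lra.
have murho : mu * (1 + eps) ^+ 2 <= lam.
  have -> : mu * (1 + eps) ^+ 2 = lam - lam * (eps ^+ 2 * (3 + 2 * eps)) by rewrite /mu; ring.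
  rewrite gerBl; apply: mulr_ge0; first exact: ltW.
  by apply: mulr_ge0; [exact: sqr_ge0|have := ltW eps0; lra].
pose G (x y : C) := cform x y + dot (j x) (j y).
have hc := ccform_symbil q hb; have c0 := ccform_ge0 hb hh.
have hd : symbil (fun x y : C => dot (j x) (j y)) by exact: (symbil_lin j (l2d_symbil hm)).
have d0 (x : C) : 0 <= dot (j x) (j x) by exact: l2d_ge0.
have hG : symbil G by exact: symbilD.
have G0 x : 0 <= G x x by rewrite addr_ge0// ?c0.
pose n := size r.
pose M := \sum_(k <- r) G (cdelta k) (cdelta k).
have M0 : 0 <= M by apply: sumr_ge0.
pose kappa := 1 + eps^-1.
have kappa0 : 0 <= kappa by rewrite addr_ge0// invr_ge0 ltW.
(* The vector of l^2(X, m) that represents evaluation at k. *)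
pose e (k : X) : L := (m k)^-1 *: j (cdelta k).
have de (x : C) k : dot (j x) (e k) = sval_sub x k.
  rewrite (symbilZr (l2d_symbil hm)) (symbilC (l2d_symbil hm)) /l2d.
  rewrite (@l2dot_finite _ _ m _ _ [:: k]) //; last first.
    by move=> y ys; apply: indic_out ys; rewrite mem_head.
  by rewrite big_seq1 /= /indic eqxx mul1r mulrCA mulVf ?mulr1// gt_eqF.
exists (kappa * (mu + 1) * (n%:R * M)).
  by apply: mulr_ge0; apply: mulr_ge0 => //; exact: addr_ge0.
exists [seq e k | k <- r].
apply: (fbil_lower closable) => x.
rewrite big_map; under eq_bigr do rewrite de.
pose xK : C := \sum_(k <- r) sval_sub x k *: cdelta k.
pose xW : C := x - xK.
have xWout : CcW (~` [set` r]) (sval_sub xW).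
  split; first exact: sval_sub_mem.
  move=> y ny; have yr : y \in r by exact: contrapT ny.
  rewrite /xW sval_subB.
  rewrite -[LHS]/(sval_sub x y - sval_sub xK y) /xK sval_sum_cdelta.
  rewrite (eq_bigr (fun k => sval_sub x k * indic R y k)); last first.
    by move=> k _; rewrite /indic eq_sym.
  by rewrite sum_indic// subrr.
have h1 : lam * dot (j xW) (j xW) <= cform xW xW by rewrite cform_hform; exact: h.
have h2 : dot (j x) (j x) <= (1 + eps) * dot (j xW) (j xW) + kappa * dot (j xK) (j xK).
  by have := @symbil_sqD_weighted _ _ _ eps xW xK hd d0 eps0; rewrite subrK.
have h3 : cform xW xW <= (1 + eps) * cform x x + kappa * cform xK xK.
  have := @symbil_sqD_weighted _ _ _ eps x (- xK) hc c0 eps0.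
  by rewrite (symbilNl hc) (symbilNr hc) opprK.
have h4 : G xK xK <= n%:R * M * \sum_(k <- r) sval_sub x k ^+ 2.
  rewrite /xK big_tnth; apply: (le_trans (symbil_sq_sum_le _ hG G0)).
  rewrite -mulrA; apply: ler_wpM2l => //.
  rewrite [X in _ <= _ * X]big_tnth mulr_sumr; apply: ler_sum => k _.
  rewrite (symbilZl hG) (symbilZr hG) mulrA -expr2 mulrC; apply: ler_wpM2r; first exact: sqr_ge0.
  rewrite /M (bigD1_seq (tnth (in_tuple r) k)) ?mem_tnth//=.
  by rewrite lerDl; apply: sumr_ge0.
have rho1 : 0 < 1 + eps by rewrite addr_gt0.
have h5 : mu * (1 + eps) * dot (j xW) (j xW) <= cform x x + kappa * cform xK xK.
  rewrite -(ler_pM2r rho1).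
  have h6 := ler_wpM2r (d0 xW) murho.
  have h7 : kappa * cform xK xK <= kappa * cform xK xK * (1 + eps).
    rewrite ler_peMr ?lerDl ?(ltW eps0)//; apply: mulr_ge0 => //; exact: c0.
  move: h1 h3 h6 h7; move: (dot (j xW) _) (cform xW xW) (cform x x) (kappa * _) => A B E F.
  rewrite expr2 => *; lra.
have h8 := ler_wpM2l mu0 h2.
have h9 : kappa * cform xK xK + mu * kappa * dot (j xK) (j xK) <= kappa * (mu + 1) * G xK xK.
  rewrite /G; have := mulr_ge0 (mulr_ge0 kappa0 mu0) (c0 xK); have := mulr_ge0 kappa0 (d0 xK); lra.
have h10 : kappa * (mu + 1) * G xK xK <= kappa * (mu + 1) * (n%:R * M * \sum_(k <- r) sval_sub x k ^+ 2).
  by apply: ler_wpM2l => //; apply: mulr_ge0 => //; exact: addr_ge0.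
lra.
Qed.

Lemma outside_of_good (mu lam : R) : lam < mu -> form_good mu ->
  exists r : seq X, uniq r /\ forall phi, CcW (~` [set` r]) phi ->
    lam * l2dot m phi phi <= hform b q phi.
Proof.
move=> lammu [K K0 [es hes]].
(* d is the share of each vector of [es], so that together they cost at most mu - lam. *)
have [d d0 h2] : exists2 d : R, 0 < d & (size es)%:R * K * d <= mu - lam.
  have D0 : 0 < (size es)%:R * K + 1 by rewrite ltr_wpDl// mulr_ge0.
  exists ((mu - lam) / ((size es)%:R * K + 1)); first by rewrite divr_gt0// subr_gt0.
  by rewrite mulrA ler_pdivrMr// mulrC ler_pM2l ?subr_gt0// lerDl.
have single (e : L) : exists r : seq X, uniq r /\ forall phi : C,
    (forall x, x \in r -> sval_sub phi x = 0) -> dot (j phi) e ^+ 2 <= d * dot (j phi) (j phi).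
  have e0 x : 0 <= sval_sub e x ^+ 2 * m x by rewrite mulr_ge0 ?sqr_ge0// ltW.
  have [r [ru hr]] := rsummable_tail e0 ((l2P hm _).1 (sval_sub_mem e)) d0.
  exists r; split=> // phi hphi.
  have [s su hs] := (CcP _).1 (sval_sub_mem phi).
  pose t := [seq x <- s | x \notin r].
  have tu : uniq t by rewrite filter_uniq.
  have ht x : x \notin t -> sval_sub phi x = 0.
    by rewrite mem_filter negb_and negbK => /orP[/hphi//|/hs].
  (* Cauchy-Schwarz against e cut down to t, outside r, involves only the tail of e. *)
  pose e' x := if x \in t then sval_sub e x else 0.
  have e'C : Cc e' by apply/CcP; exists t => // x xt; rewrite /e' (negbTE xt).
  pose e'' : C := to_sub (Cc_is_subspace R X) e'C.
  have -> : dot (j phi) e = dot (j phi) (j e'').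
    rewrite /l2d !(l2dot_finite m _ tu)//.
    by rewrite big_seq [RHS]big_seq; apply: eq_bigr => x xt; rewrite /= /e' xt.
  apply: (le_trans (symbil_CauchySchwarz (l2d_symbil hm) (l2d_ge0 (hm := hm)) _ _)).
  rewrite mulrC; apply: ler_wpM2r; first exact: l2d_ge0.
  apply: ltW; apply: le_lt_trans (hr t tu _); last first.
    by move=> x; rewrite mem_filter => /andP[].
  rewrite /l2d (l2dot_finite m _ tu); last by move=> x xt; rewrite /= /e' (negbTE xt).
  by rewrite big_seq [leRHS]big_seq; apply: ler_sum => x xt; rewrite /= /e' xt expr2.
have [r [ru hr]] : exists r : seq X, uniq r /\ forall e, e \in es -> forall phi : C,
    (forall x, x \in r -> sval_sub phi x = 0) -> dot (j phi) e ^+ 2 <= d * dot (j phi) (j phi).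
  elim: es {hes h2} (single) => [|e es IH] hsingle; first by exists [::].
  have [r [ru hr]] := IH hsingle; have [t [tu ht]] := hsingle e.
  exists (undup (r ++ t)); split; first exact: undup_uniq.
  move=> f; rewrite in_cons => /orP[/eqP ->|fes] phi hphi.
    by apply: ht => x xt; apply: hphi; rewrite mem_undup mem_cat xt orbT.
  by apply: hr => // x xr; apply: hphi; rewrite mem_undup mem_cat xr.
exists r; split=> // phi [cphi hphi].
pose x : C := to_sub (Cc_is_subspace R X) cphi.
have := hes (hm_core x); rewrite hm_form_core cform_hform.
have -> : hm_incl (hm_core x) = j x by [].
have hsum : \sum_(e <- es) dot (j x) e ^+ 2 <= (size es)%:R * (d * dot (j x) (j x)).
  apply: (@le_trans _ _ (\sum_(e <- es) d * dot (j x) (j x))).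
    rewrite big_seq [leRHS]big_seq; apply: ler_sum => e ees; apply: hr => // y yr.
    by apply: hphi => /=; apply.
  by rewrite big_const_seq count_predT iter_addr addr0 -[leLHS]mulr_natl.
have h1 := ler_wpM2l K0 hsum.
have h3 := ler_wpM2r (l2d_ge0 (j x)) h2.
rewrite -[l2dot m phi phi]/(dot (j x) (j x)) -[hform b q phi]/(hform b q (sval_sub x)).
lra.
Qed.

Lemma discrete_of_good lam s : form_good lam -> s < lam -> spectrum m (Hm b q m) s ->
  discrete_spectrum m (Hm b q m) s.
Proof.
move=> hlam slam hs; have /spectrumP hres := hs.
have [[eps eps0 heps] [h hker h0] [fs hfs]] :=
  form_good_discrete (l2d_symbil hm) (l2d_ge0 (hm := hm)) (@l2d_eq0 _ _ _ hm)
    hm_form_symbil hm_form_ge0 hm_complete hlam slam hres.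
split.
- split; first by rewrite inE.
  exists (ball s eps); first exact: nbhsx_ballx.
  apply/seteqP; split=> [t [bt /spectrumP ht]|_ ->]; last by split=> //; exact: ballxx.
  apply: contrapT => ts; apply: ht; rewrite -[t](subrK s) addrC; apply: heps.
    by rewrite subr_eq0; apply/eqP.
  by move: bt; rewrite -ball_normE /= distrC.
- exists (sval_sub h); first by apply/eigenspaceP; exists h.
  apply: contrapT => hx; move/eqP: h0; apply; apply: sval_sub_inj; apply/funext => x.
  by rewrite sval_sub0; apply/eqP; apply: contrapT => /negP hx0; apply: hx; exists x.
exists (size fs), (fun k => sval_sub (tnth (in_tuple fs) k)) => f /eigenspaceP[u uker <-].
exists (fun k => dot u (tnth (in_tuple fs) k)) => x.
rewrite {1}(hfs u uker) /proj big_tnth.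
elim/big_rec2: _ => [|k y v _ <-]; first by rewrite sval_sub0.
by rewrite sval_subP lincombE.
Qed.

(** The spanning functions in [finite_dim] need not lie in l^2(X, m), so the count goes through
    their coefficients: a longer list would have a linear dependence, impossible for an orthonormal
    one. *)
Lemma finite_eigenspace_bound s : finite_dim (Defs.eigenspace (Hm b q m) s) ->
  exists n : nat, forall fs : seq L, orthonormal dot fs ->
    (forall f, f \in fs -> form_ker s f) -> (size fs <= n)%N.
Proof.
move=> [n [e he]]; exists n => fs [fsu fso] hker; rewrite leqNgt; apply/negP => nfs.
pose f (k : 'I_(size fs)) := tnth (in_tuple fs) k.
have /choice[c hc] : forall k, exists c : 'I_n -> R, forall x, sval_sub (f k) x = \sum_(i < n) c i * e i x.
  move=> k; apply: he; apply/eigenspaceP; exists (f k) => //; apply: hker; exact: mem_tnth.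
pose M : 'M[R]_(size fs, n) := \matrix_(k, i) c k i.
have : kermx M != 0.
  rewrite kermx_eq0 /row_free; apply/eqP => rk.
  by have := rank_leq_col M; rewrite rk leqNgt nfs.
case/rowV0Pn => v /sub_kermxP vM v0.
have vf : \sum_k v 0 k *: f k = 0 :> L.
  apply: sval_sub_inj; apply/funext => x; rewrite sval_sub0.
  have -> : sval_sub (\sum_k v 0 k *: f k) x = \sum_k v 0 k * sval_sub (f k) x.
    elim/big_rec2: _ => [|k y w _ <-]; first by rewrite sval_sub0.
    by rewrite sval_subP lincombE.
  under eq_bigr do rewrite hc mulr_sumr.
  rewrite exchange_big/= big1// => i _.
  have /rowP/(_ i) := vM; rewrite !mxE => h.
  rewrite (eq_bigr (fun k => v 0 k * M k i * e i x)); last first.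
    by move=> k _; rewrite mxE mulrA.
  by rewrite -mulr_suml h mul0r.
have [k vk] : exists k, v 0 k != 0 by apply/rV0Pn.
have := symbil0l (l2d_symbil hm) (f k); rewrite -vf (symbil_suml (l2d_symbil hm)).
rewrite (bigD1 k)//= big1 => [|i ik]; last first.
  rewrite (symbilZl (l2d_symbil hm)) fso ?mem_tnth// /f !(tnth_nth 0)/=.
  by rewrite nth_uniq// val_eqE (negbTE ik) mulr0.
rewrite addr0 (symbilZl (l2d_symbil hm)) fso ?mem_tnth// eqxx mulr1.
by move/eqP; apply/negP.
Qed.

Lemma good_above_of_ess lam :
  (forall s, s <= lam -> ~ ess_spectrum m (Hm b q m) s) ->
  exists2 mu, lam < mu & form_good mu.
Proof.
move=> hess; apply: (form_good_above (l2d_symbil hm) (l2d_ge0 (hm := hm))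
  hm_form_symbil hm_form_ge0 hm_complete) => s slam.
have [hres|hres] := pselect (form_res s); [by left|right].
have hs : spectrum m (Hm b q m) s by apply/spectrumP.
have [[_ [V Vs hV]] _ hfin] : discrete_spectrum m (Hm b q m) s.
  by apply: contrapT => hd; apply: (hess s slam); split.
split; last exact: finite_eigenspace_bound.
have /nbhs_ballP[eps/= eps0 heps] := Vs.
exists eps => // t t0 teps; apply: contrapT => ht.
have : (V `&` spectrum m (Hm b q m)) (s + t).
  split; last by apply/spectrumP.
  by apply: heps; rewrite -ball_normE /= opprD addrA subrr sub0r normrN.
rewrite hV /= => /eqP; rewrite -subr_eq0 addrC addKr => /eqP t0'.
by rewrite t0' eqxx in t0.
Qed.

End Spectrum.

(** * The bottoms of the spectrum and of the essential spectrum *)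

Lemma ereal_dense_fin (R : realType) (x y : \bar R) : (x < y)%E ->
  exists r : R, (x < r%:E)%E /\ (r%:E < y)%E.
Proof.
case: x y => [r| |] [s| |] //.
- by rewrite lte_fin => rs; exists ((r + s) / 2); rewrite !lte_fin; split; lra.
- by move=> _; exists (r + 1); rewrite ltry lte_fin ltrDl.
- by move=> _; exists (s - 1); rewrite ltNyr lte_fin gtrBl.
- by move=> _; exists 0; rewrite ltNyr ltry.
Qed.

Theorem theorem4p2 (R : realType) (X : choiceType) (b : X -> X -> R)
    (q m : X -> R)
    (hX : infinite_set [set: X])
    (hb : is_graph b)
    (hconn : connected_graph b)
    (hh : form_ge0 b q)
    (hm : forall x, 0 < m x) :
  [/\ (* (a) *)
      (ereal_sup (EFin @` [set lam : R | op_ge0_on b q m lam setT])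
         <= lambda0 m (Hm b q m))%E,
      (* (b) *)
      op_dom (Hm b q m) `<=` FX b ->
      exists l : R,
        [/\ lambda0 m (Hm b q m) = l%:E,
            op_ge0_on b q m l setT &
            forall lam : R, op_ge0_on b q m lam setT -> lam <= l] &
      (* (c) *)
      (forall phi : X -> R, Cc phi -> l2 m (fun x => Lap b phi x / m x)) ->
      lambda0_ess m (Hm b q m) =
        ereal_sup (EFin @` [set lam : R | exists2 K : set X, finite_set K &
                              op_ge0_on_components b q m lam (~` K)])].
Proof.
have [x0 _] : exists x0 : X, True.
  apply: contrapT => h; apply: hX; have -> : [set: X] = set0; last exact: finite_set0.
  by apply/seteqP; split=> // x _; apply: h; exists x.
have lowerP lam s : op_ge0_on b q m lam setT -> spectrum m (Hm b q m) s -> lam <= s.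
  by move=> hlam; apply: (lower_spectrum hb hconn hh (superharmonic_lower hb hconn hm hlam)).
split.
- apply: ge_ereal_sup => _ [lam hlam <-]; apply: le_ereal_inf_tmp => _ [s hs <-].
  by rewrite lee_fin; exact: lowerP hlam hs.
- move=> _; have [l [lspec lmin lsup]] := bottom_attained hb hconn hm hh x0.
  exists l; split=> //; last by move=> lam hlam; exact: lowerP hlam lspec.
  apply/eqP; rewrite eq_le; apply/andP; split.
    by apply: ge_ereal_inf; exists l%:E => //; exists l.
  by apply: le_ereal_inf_tmp => _ [s hs <-]; rewrite lee_fin; exact: lmin.
move=> _; apply/eqP; rewrite eq_le; apply/andP; split.
  (* Either side may be infinite; a real lam strictly between them is shown to belong to the set,
     which contradicts h1. *)
  rewrite leNgt; apply/negP => /ereal_dense_fin[lam [h1 h2]].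
  move: h1; apply/negP; rewrite -leNgt; apply: le_ereal_sup_tmp.
  exists lam%:E => //; exists lam => //.
  have hess s : s <= lam -> ~ ess_spectrum m (Hm b q m) s.
    move=> slam hs; move: h2; apply/negP; rewrite -leNgt.
    by apply: ge_ereal_inf; exists s%:E; [exists s|rewrite lee_fin].
  have [mu lammu gmu] := good_above_of_ess hb hconn hm hh hess.
  (* Two strict losses have to be accommodated: from the good value mu to a form bound off r, and
     from that bound to a superharmonic function. *)
  have lammid : lam < (lam + mu) / 2 by lra.
  have midmu : (lam + mu) / 2 < mu by lra.
  have [r [_ hr]] := outside_of_good hconn midmu gmu.
  exists [set` r]; first exact: finite_seq.
  have [u [uF u0 up usup]] := superharmonic_exists hb hconn hm hh lammid hr.
  (* u is positive on the whole complement of r, so x, joined to itself by the empty path, is the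
     witness for its own component. *)
  exists u; split=> // x Kx; split=> //; exists x; last by rewrite gt_eqF// up.
  by exists [::]; split=> // z; rewrite inE => /eqP ->.
apply: ge_ereal_sup => _ [lam [K /finite_seqP[r ->] [u [[uF usup] ucomp]]] <-].
apply: le_ereal_inf_tmp => _ [s [hs hnd] <-].
rewrite lee_fin leNgt; apply/negP => slam; apply: hnd.
(* Nonnegativity of u is part of the condition on each component, so one component is needed to
   obtain it; X is infinite, hence the complement of r is nonempty. *)
have [x1 Kx1] : exists x1, (~` [set` r]) x1.
  apply: contrapT => h; apply: hX; apply: sub_finite_set (finite_seq r) => x _.
  by apply: contrapT => xr; apply: h; exists x.
have u0 x : 0 <= u x by have [] := ucomp x1 Kx1.
have up x : (~` [set` r]) x -> 0 < u x.
  by move=> Kx; exact: (positive_on_component hb uF u0 Kx usup (ucomp x Kx)).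
have E : [set` r] = [set` undup r] by apply/seteqP; split=> x /=; rewrite mem_undup.
have hout phi : CcW (~` [set` undup r]) phi -> lam * l2dot m phi phi <= hform b q phi.
  rewrite -E => -[cphi phiW].
  exact: (allegretto_piepenbrink hb uF u0 up usup cphi phiW).
have [mu smu gmu] := good_of_outside hb hconn hm hh (undup_uniq r) hout slam.
exact: (discrete_of_good hconn gmu smu hs).
Qed.
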